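(* Let $U,X$ be complex Hilbert spaces, let $S=\begin{bmatrix}A\&B\\ C\&D\end{bmatrix}$ be an impedance passive well-posed system node on $(U,X,U)$, and let $\Sigma=(\mathbb{T},\Phi,\Psi,\mathbb{F})$ be the associated well-posed linear system. Suppose that the transfer function $P$ of $\Sigma$ satisfies $\mathrm{Re}\,P(\lambda)\ge c_\lambda I$ for some $\lambda,c_\lambda>0$, and that $\phi:U\to U$ satisfies, for some $\gamma>0$, $$\mathrm{Re}\,\langle\phi(u_2)-\phi(u_1),u_2-u_1\rangle_U\ge\gamma\|\phi(u_2)-\phi(u_1)\|_U^2,\qquad u_1,u_2\in U.$$ Consider the system $$(\ast)\qquad\begin{bmatrix}\dot x(t)\\ y(t)\end{bmatrix}=\begin{bmatrix}A\&B\\ C\&D\end{bmatrix}\begin{bmatrix}x(t)\\ \phi(u(t)-y(t))\end{bmatrix},\qquad t\ge0 .$$ If $x_0\in X$ and $u\in L^2_{\mathrm{loc}}(0,\infty;U)$, then $(\ast)$ has a generalised solution $(x,u,y)$ satisfying $x(0)=x_0$. This solution satisfies $t\mapsto\phi(u(t)-y(t))\in L^2_{\mathrm{loc}}(0,\infty;U)$ and $$x(t)=\mathbb{T}_tx_0+\Phi_t\mathbf{P}_t\phi(u-y),\quad t\ge0,\qquad\qquad y=\Psi_\infty x_0+\mathbb{F}_\infty\phi(u-y).$$ If $x_0\in X$ and $u\in H^1_{\mathrm{loc}}(0,\infty;U)$ are such that $(x_0,u(0))^\top\in D_{\mathrm{comp}}$, then this $(x,u,y)$ is a classical solution of $(\ast)$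 on $[0,\infty)$ and $y\in H^1_{\mathrm{loc}}(0,\infty;U)$. If $(x_1,u_1,y_1)$ and $(x_2,u_2,y_2)$ are two generalised solutions of $(\ast)$, then for all $t\ge0$ $$\|x_2(t)-x_1(t)\|_X^2+\gamma\int_0^t\|\phi(u_2(s)-y_2(s))-\phi(u_1(s)-y_1(s))\|_U^2\,ds\le\|x_2(0)-x_1(0)\|_X^2+\frac1\gamma\int_0^t\|u_2(s)-u_1(s)\|_U^2\,ds.$$
   Context: Function spaces: $L^2_{\mathrm{loc}}(0,\infty;U)$ and $H^1_{\mathrm{loc}}(0,\infty;U)$ are the functions whose restriction to $(0,\tau)$ is in $L^2(0,\tau;U)$, resp. $H^1(0,\tau;U)$, for every $\tau>0$. $\mathbf{P}_\tau$ denotes truncation to $[0,\tau]$ (identified with extension by zero when needed). $\mathrm{Re}\,T=\frac12(T+T^* )$. System nodes: for a generator $A$ of a strongly continuous semigroup on $X$, $X_{-1}$ is the completion of $X$ in the norm $\|(\lambda_0-A)^{-1}\cdot\|_X$ ($\lambda_0\in\rho(A)$ fixed), and $A$ also denotes its extension in $\mathcal{L}(X,X_{-1})$. A system node on $(U,X,Y)$ is a closed operator $S=\begin{bmatrix}A\&B\\ C\&D\end{bmatrix}:D(S)\subset X\times U\to X\times Y$ such that: (i) $Ax=A\&B\begin{bmatrix}x\\ 0\end{bmatrix}$, $D(A)=\{x\in X:(x,0)^\top\in D(S)\}$, generates a strongly continuous semigroup on $X$; (ii) $A\&B$ extends to $[A,\ B]\in\mathcal{L}(X\times U,X_{-1})$;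 (iii) $D(S)=\{(x,u)^\top\in X\times U:Ax+Bu\in X\}$. Its transfer function is $P(\lambda)u=C\&D\begin{bmatrix}(\lambda-A)^{-1}Bu\\ u\end{bmatrix}$, $\lambda\in\rho(A)$. $S$ is impedance passive if $Y=U$ and $\mathrm{Re}\,\langle A\&B\begin{bmatrix}x\\ u\end{bmatrix},x\rangle_X\le\mathrm{Re}\,\langle C\&D\begin{bmatrix}x\\ u\end{bmatrix},u\rangle_U$ for all $(x,u)^\top\in D(S)$. Well-posed linear systems: with $u\diamond_\tau v$ the function equal to $u$ on $[0,\tau)$ and $v(\cdot-\tau)$ on $[\tau,\infty)$, a well-posed linear system on $(U,X,Y)$ is $\Sigma=(\mathbb{T}_t,\Phi_t,\Psi_t,\mathbb{F}_t)_{t\ge0}$ with bounded linear $\mathbb{T}_t:X\to X$, $\Phi_t:L^2(0,\infty;U)\to X$, $\Psi_t:X\to L^2(0,\infty;Y)$, $\mathbb{F}_t:L^2(0,\infty;U)\to L^2(0,\infty;Y)$ such that $\mathbb{T}$ is a strongly continuous semigroup, $\Psi_0=0$, $\mathbb{F}_0=0$, $\Phi_{\tau+t}(u\diamond_\tau v)=\mathbb{T}_t\Phi_\tau u+\Phi_tv$, $\Psi_{\tau+t}x=\Psi_\tau x\diamond_\tau\Psi_t\mathbb{T}_\tau x$, $\mathbb{F}_{\tau+t}(u\diamond_\tau v)=\mathbb{F}_\tau u\diamond_\tau(\Psi_t\Phi_\tau u+\mathbb{F}_tv)$. $\Psi_\infty$ and $\mathbb{F}_\infty$ (with values in $L^2_{\mathrm{loc}}(0,\infty;Y)$,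 $\mathbb{F}_\infty$ defined on $L^2_{\mathrm{loc}}(0,\infty;U)$) are determined by $\mathbf{P}_t\Psi_\infty=\Psi_t$, $\mathbf{P}_t\mathbb{F}_\infty=\mathbb{F}_t\mathbf{P}_t$. The system node $S$ is well-posed with associated well-posed linear system $\Sigma$ if for all $x_0\in X$, $u\in H^1_{\mathrm{loc}}(0,\infty;U)$ with $(x_0,u(0))^\top\in D(S)$, the functions $x(t)=\mathbb{T}_tx_0+\Phi_t\mathbf{P}_tu$ and $y=\Psi_\infty x_0+\mathbb{F}_\infty u$ satisfy $x\in C^1([0,\infty);X)$, $y\in H^1_{\mathrm{loc}}(0,\infty;Y)$ and $\begin{bmatrix}\dot x(t)\\ y(t)\end{bmatrix}=S\begin{bmatrix}x(t)\\ u(t)\end{bmatrix}$ for $t\ge0$. In the impedance passive case the transfer function of $\Sigma$ is $P$ on $\{\mathrm{Re}\,\lambda>0\}$. Solutions: $(x,u,y)$ is a classical solution of $(\ast)$ on $[0,\infty)$ if $x\in C^1([0,\infty);X)$, $u,y\in C([0,\infty);U)$, $(x(t),\phi(u(t)-y(t)))^\top\in D(S)$ for all $t\ge0$ and $(\ast)$ holds for every $t\ge0$. It is a generalised solution if $x\in C([0,\infty);X)$, $u,y\in L^2_{\mathrm{loc}}(0,\infty;U)$ and there is a sequence $(x^k,u^k,y^k)$ of classical solutions such that for every $\tau>0$, $(\mathbf{P}_\tau x^k,\mathbf{P}_\tau u^k,\mathbf{P}_\tau y^k)\to(\mathbf{P}_\tau x,\mathbf{P}_\tau u,\mathbf{P}_\tau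 y)$ in $C([0,\tau];X)\times L^2(0,\tau;U)\times L^2(0,\tau;U)$. $D_{\mathrm{comp}}$ is the set of $(x,u)^\top\in X\times U$ for which there exists $v\in U$ such that $Ax+B\phi(u-v)\in X$ and $v=C\&D\begin{bmatrix}x\\ \phi(u-v)\end{bmatrix}$. *)

(* Defs.v *)
From HB Require Import structures.
From mathcomp Require Import all_boot all_order all_algebra.
From mathcomp Require Import sesquilinear complex.
From mathcomp Require Import all_classical all_reals all_analysis.
Set Implicit Arguments.
Unset Strict Implicit.
Unset Printing Implicit Defensive.
Import Order.TTheory GRing.Theory Num.Theory.
Import numFieldNormedType.Exports.
Local Open Scope classical_set_scope.
Local Open Scope ring_scope.
Local Open Scope complex_scope.

(** * Complex Hilbert spaces *)

(* The inner product is linear in its first and antilinear in its second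
   argument. *)
HB.mixin Record isHilbert (R : realType) X of CompleteNormedModule R[i] X := {
  hdot : {dot X for (@Num.conj R[i])} ;
  hdot_normE : forall x : X, `|x| ^+ 2 = hdot x x
}.

#[short(type="hilbertType")]
HB.structure Definition Hilbert (R : realType) :=
  { X of CompleteNormedModule R[i] X & isHilbert R X }.

Notation "''[' x , y ]" := (hdot x y) (format "''[' x ,  y ]") : ring_scope.

(* The norm of a normedModType over R[i] takes its values in R[i]; [rnorm] is
   the same number, as an element of R. *)
Definition rnorm {R : realType} {V : normedModType R[i]} (v : V) : R :=
  complex.Re `|v|.

Section Functions.
Context {R : realType}.
Implicit Types V W : completeNormedModType R[i].

Definition bounded_linear V W (f : V -> W) : Prop :=
  (forall (a : R[i]) (v w : V), f (a *: v + w) = a *: f v + f w)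
  /\ continuous f.

(** * Vector-valued functions of time

   A function on [0, oo) is represented by a function on R whose values at
   negative times are irrelevant. *)

(* Derivative at t of a function on [0, oo); one-sided for t = 0. *)
Definition has_deriv V (x : R -> V) (t : R) (v : V) : Prop :=
  (h^-1)%:C *: (x (t + h) - x t)
    @[h --> within [set h : R | 0 <= t + h] 0^'] --> v.

Definition continuous_halfline V (x : R -> V) : Prop :=
  {within `[0, +oo[%classic, continuous x}.

Definition C1_halfline V (x : R -> V) : Prop :=
  exists dx : R -> V, continuous_halfline dx
    /\ forall t, 0 <= t -> has_deriv x t (dx t).

Definition simple_function V (s : R -> V) : Prop :=
  finite_set (range s) /\ forall v, measurable (s @^-1` [set v]).

(* Measurability is with respect to the Borel sets, and the elements of
   L^2(D; V) are represented by functions that are everywhere on D limits of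
   Borel simple functions.  Every almost-everywhere class of a.e.-limits of
   Lebesgue simple functions contains such a representative. *)
Definition strongly_measurable V (D : set R) (f : R -> V) : Prop :=
  exists s : nat -> R -> V, (forall n, simple_function (s n))
    /\ forall t, D t -> s n t @[n --> \oo] --> f t.

Definition L2norm V (D : set R) (f : R -> V) : \bar R :=
  Lnorm lebesgue_measure 2%:E (fun t => (rnorm (f t) * \1_D t)%:E).

Definition L2_on V (D : set R) (f : R -> V) : Prop :=
  strongly_measurable D f /\ (L2norm D f < +oo)%E.

Definition L2 V (f : R -> V) : Prop := L2_on `[0, +oo[ f.

Definition L2loc V (f : R -> V) : Prop :=
  forall tau : R, 0 < tau -> L2_on `[0, tau] f.

Definition ae_equal V (f g : R -> V) : Prop :=
  f = g %[ae (@lebesgue_measure R) in `[0, +oo[%classic].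

Definition simple_integral V (D : set R) (s : R -> V) : V :=
  \sum_(v \in range s)
    (fine (@lebesgue_measure R (D `&` s @^-1` [set v])))%:C *: v.

(* v is the Bochner integral of f over D. *)
Definition is_bochner_integral V (D : set R) (f : R -> V) (v : V) : Prop :=
  strongly_measurable D f /\
  exists s : nat -> R -> V,
    [/\ forall n, simple_function (s n),
        (\int[lebesgue_measure]_(t in D) (rnorm (f t - s n t))%:E
           @[n --> \oo] --> 0)%E
      & simple_integral D (s n) @[n --> \oo] --> v].

(* H^1(0, tau; V) consists of the absolutely continuous functions on [0, tau]
   that are primitives of functions in L^2(0, tau; V).  The predicate is about
   the continuous representative itself, so that u 0 is meaningful. *)
Definition H1_on V (tau : R) (u : R -> V) : Prop :=
  exists2 g : R -> V, L2_on `[0, tau] g &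
    forall t, 0 <= t <= tau -> is_bochner_integral `[0, t] g (u t - u 0).

Definition H1loc V (u : R -> V) : Prop :=
  forall tau : R, 0 < tau -> H1_on tau u.

(* P_tau *)
Definition trunc V (tau : R) (u : R -> V) : R -> V :=
  patch (fun=> 0) `[0, tau]%classic u.

(* u <>_tau v *)
Definition concat V (tau : R) (u v : R -> V) : R -> V :=
  fun t => if t < tau then u t else v (t - tau).

(** * Semigroups and unbounded operators *)

Definition C0_semigroup V (T : R -> V -> V) : Prop :=
  [/\ forall t, 0 <= t -> bounded_linear (T t),
      forall v, T 0 v = v,
      forall s t v, 0 <= s -> 0 <= t -> T (s + t) v = T s (T t v)
    & forall v, T h v @[h --> 0^'+] --> v].

Definition is_generator V (T : R -> V -> V) (dom : set V) (A : V -> V) : Prop :=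
  forall v w, (dom v /\ A v = w) <->
    ((h^-1)%:C *: (T h v - v) @[h --> 0^'+] --> w).

Definition in_resolvent_set V (dom : set V) (A : V -> V) (l : R[i]) : Prop :=
  exists2 Rl : V -> V, bounded_linear Rl &
    forall v w, (dom v /\ l *: v - A v = w) <-> v = Rl w.

End Functions.

(** * System nodes *)

(* S is given by its domain and by a function whose values outside the domain
   are irrelevant.  The completion X_{-1} of X in the norm
   |(lambda0 - A)^{-1} x| is carried as a Banach space together with an
   isometric embedding of X (for that norm) with dense range. *)
Record systemNode (R : realType) (U X Y : hilbertType R) := SystemNode {
  sn_dom : set (X * U) ;
  sn_op : X * U -> X * Y ;
  sn_dom0 : sn_dom 0 ;
  sn_linear : forall (a : R[i]) p q, sn_dom p -> sn_dom q ->
    sn_dom (a *: p + q) /\ sn_op (a *: p + q) = a *: sn_op p + sn_op q ;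
  sn_closed :
    closed [set pq : (X * U) * (X * Y) | sn_dom pq.1 /\ pq.2 = sn_op pq.1] ;
  sn_domA : set X := [set x | sn_dom (x, 0)] ;
  sn_A : X -> X := fun x => (sn_op (x, 0)).1 ;
  sn_generator : exists T : R -> X -> X,
    C0_semigroup T /\ is_generator T sn_domA sn_A ;
  sn_lambda0 : R[i] ;
  sn_lambda0_resolvent : in_resolvent_set sn_domA sn_A sn_lambda0 ;
  sn_Xm1 : completeNormedModType R[i] ;
  sn_emb : {linear X -> sn_Xm1} ;
  sn_emb_norm : forall z x : X,
    sn_domA z -> sn_lambda0 *: z - sn_A z = x -> `|sn_emb x| = `|z| ;
  sn_emb_dense : closure (range sn_emb) = setT ;
  sn_Aext : X -> sn_Xm1 ;
  sn_Aext_bounded : bounded_linear sn_Aext ;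
  sn_AextE : forall x, sn_domA x -> sn_Aext x = sn_emb (sn_A x) ;
  sn_B : U -> sn_Xm1 ;
  sn_B_bounded : bounded_linear sn_B ;
  sn_AB : forall x u, sn_dom (x, u) ->
    sn_emb (sn_op (x, u)).1 = sn_Aext x + sn_B u ;
  sn_domE : forall x u, sn_dom (x, u) <-> range sn_emb (sn_Aext x + sn_B u)
}.

Section SystemNodes.
Context {R : realType} {U X : hilbertType R}.

(* (l - A)^{-1} as an operator from X_{-1} to X *)
Definition sn_resolvent (Y : hilbertType R) (S : systemNode U X Y) (l : R[i])
    (z : sn_Xm1 S) : X :=
  [get x : X | l *: sn_emb S x - sn_Aext S x = z].

Definition sn_transfer (Y : hilbertType R) (S : systemNode U X Y) (l : R[i]) :
    U -> Y :=
  fun u => (sn_op S (sn_resolvent l (sn_B S u), u)).2.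

Definition impedance_passive (S : systemNode U X U) : Prop :=
  forall x u, sn_dom S (x, u) ->
    complex.Re '[(sn_op S (x, u)).1, x] <= complex.Re '[(sn_op S (x, u)).2, u].

Definition is_adjoint (T T' : U -> U) : Prop :=
  forall u v, '[T u, v] = '[u, T' v].

(* Re T >= c I, where Re T = (T + T^* ) / 2 *)
Definition re_ge (T : U -> U) (c : R) : Prop :=
  exists2 T' : U -> U, is_adjoint T T' &
    forall u, c%:C * '[u, u] <= '[2^-1 *: (T u + T' u), u].

End SystemNodes.

(** * Well-posed linear systems *)

(* An operator defined on L^2 is represented by a function on all functions
   R -> U that is linear and bounded on [L2]; boundedness makes it invariant
   under almost-everywhere equality. *)
Record wpls (R : realType) (U X Y : hilbertType R) := Wpls {
  wT : R -> X -> X ;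
  wPhi : R -> (R -> U) -> X ;
  wPsi : R -> X -> R -> Y ;
  wF : R -> (R -> U) -> R -> Y ;
  wT_semigroup : C0_semigroup wT ;
  wPhi_linear : forall t (a : R[i]) u v, 0 <= t -> L2 u -> L2 v ->
    wPhi t (fun s => a *: u s + v s) = a *: wPhi t u + wPhi t v ;
  wPhi_bounded : forall t, 0 <= t -> exists M : R, forall u, L2 u ->
    ((rnorm (wPhi t u))%:E <= M%:E * L2norm `[0%R, +oo[ u)%E ;
  wPsi_L2 : forall t x, 0 <= t -> L2 (wPsi t x) ;
  wPsi_linear : forall t (a : R[i]) x z, 0 <= t ->
    ae_equal (wPsi t (a *: x + z)) (fun s => a *: wPsi t x s + wPsi t z s) ;
  wPsi_bounded : forall t, 0 <= t -> exists M : R, forall x,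
    (L2norm `[0%R, +oo[ (wPsi t x) <= (M * rnorm x)%:E)%E ;
  wF_L2 : forall t u, 0 <= t -> L2 u -> L2 (wF t u) ;
  wF_linear : forall t (a : R[i]) u v, 0 <= t -> L2 u -> L2 v ->
    ae_equal (wF t (fun s => a *: u s + v s))
             (fun s => a *: wF t u s + wF t v s) ;
  wF_bounded : forall t, 0 <= t -> exists M : R, forall u, L2 u ->
    (L2norm `[0%R, +oo[ (wF t u) <= M%:E * L2norm `[0%R, +oo[ u)%E ;
  wPsi0 : forall x, ae_equal (wPsi 0 x) (fun=> 0) ;
  wF0 : forall u, L2 u -> ae_equal (wF 0 u) (fun=> 0) ;
  wPhi_concat : forall tau t u v, 0 <= tau -> 0 <= t -> L2 u -> L2 v ->
    wPhi (tau + t) (concat tau u v) = wT t (wPhi tau u) + wPhi t v ;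
  wPsi_concat : forall tau t x, 0 <= tau -> 0 <= t ->
    ae_equal (wPsi (tau + t) x)
             (concat tau (wPsi tau x) (wPsi t (wT tau x))) ;
  wF_concat : forall tau t u v, 0 <= tau -> 0 <= t -> L2 u -> L2 v ->
    ae_equal (wF (tau + t) (concat tau u v))
      (concat tau (wF tau u) (fun s => wPsi t (wPhi tau u) s + wF t v s))
}.

Section WellPosed.
Context {R : realType} {U X Y : hilbertType R}.
Implicit Types (Sigma : wpls U X Y) (S : systemNode U X Y).

(* The extended output maps, unique up to almost-everywhere equality. *)
Definition wPsi_inf Sigma (x : X) : R -> Y :=
  [get z : R -> Y | L2loc z /\
    forall t, 0 <= t -> ae_equal (trunc t z) (wPsi Sigma t x)].

Definition wF_inf Sigma (u : R -> U) : R -> Y :=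
  [get w : R -> Y | L2loc w /\
    forall t, 0 <= t -> ae_equal (trunc t w) (wF Sigma t (trunc t u))].

(* S is well-posed with associated well-posed linear system Sigma.  Here y is
   the continuous representative of the output. *)
Definition associated_wpls S Sigma : Prop :=
  forall (x0 : X) (u : R -> U), H1loc u -> sn_dom S (x0, u 0) ->
    let x := fun t => wT Sigma t x0 + wPhi Sigma t (trunc t u) in
    exists y : R -> Y,
      [/\ ae_equal y (fun s => wPsi_inf Sigma x0 s + wF_inf Sigma u s),
          C1_halfline x, H1loc y
        & forall t, 0 <= t ->
            [/\ sn_dom S (x t, u t),
                has_deriv x t (sn_op S (x t, u t)).1
              & y t = (sn_op S (x t, u t)).2]].

End WellPosed.

(** * The nonlinear feedback system *)

Section Feedback.
Context {R : realType} {U X : hilbertType R}.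
Variables (S : systemNode U X U) (phi : U -> U).

Definition classical_solution (x : R -> X) (u y : R -> U) : Prop :=
  [/\ C1_halfline x, continuous_halfline u, continuous_halfline y
    & forall t, 0 <= t ->
        let p := (x t, phi (u t - y t)) in
        [/\ sn_dom S p, has_deriv x t (sn_op S p).1 & y t = (sn_op S p).2]].

Definition generalised_solution (x : R -> X) (u y : R -> U) : Prop :=
  [/\ continuous_halfline x, L2loc u, L2loc y
    & exists (xk : nat -> R -> X) (uk yk : nat -> R -> U),
        (forall k, classical_solution (xk k) (uk k) (yk k)) /\
        forall tau : R, 0 < tau ->
          [/\ {uniform `[0, tau]%classic, xk @ \oo --> x},
              L2norm `[0, tau] (fun t => uk k t - u t) @[k --> \oo] --> 0%E
            & L2norm `[0, tau] (fun t => yk k t - y t) @[k --> \oo] --> 0%E]].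

Definition D_comp : set (X * U) :=
  [set xu | exists v : U,
     let w := phi (xu.2 - v) in
     range (sn_emb S) (sn_Aext S xu.1 + sn_B S w)
     /\ v = (sn_op S (xu.1, w)).2].

End Feedback.

(* Main.v *)
Require Import Defs.
From HB Require Import structures.
From mathcomp Require Import all_boot all_order all_algebra.
From mathcomp Require Import sesquilinear complex.
From mathcomp Require Import all_classical all_reals all_analysis.
From mathcomp Require Import measurable_realfun ring lra.
Import Order.TTheory GRing.Theory Num.Theory.
Import numFieldNormedType.Exports.
Local Open Scope classical_set_scope.
Local Open Scope ring_scope.
Local Open Scope complex_scope.
Set Implicit Arguments.
Unset Strict Implicit.
Unset Printing Implicit Defensive.

(** Passivity and the cocoercivity of phi combine into one estimate.  For two
    solutions, write dx, du, dy, dw for the differences of the states, the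
    external inputs u, the outputs y and the internal inputs w = phi (u - y).
    Passivity says that |dx|^2 grows at most at the rate 2 Re <dy, dw>, and
    cocoercivity together with Young's inequality gives
      2 Re <dy, dw> <= gamma^-1 |du|^2 - gamma |dw|^2
    ([feedback_supply]).  Integrated in time this is the incremental estimate,
    for classical solutions directly ([classical_increment]) and for
    generalised ones in the limit, because phi is Lipschitz
    ([generalised_increment]).

    Existence is first proved on the level of L^2 inputs, where the problem is
    w = phi (u - y) with y = Psi_inf x0 + F_inf w.  Passivity extends to all
    initial states and all L^2 inputs by density ([passive_state]): the domain
    of the generator is dense ([generator_dense]), and so are the Lipschitz
    inputs with prescribed value at 0 ([lipschitz_dense]).  In particular F_inf
    is monotone, and rewriting the equation with the resolvent of phi turns it
    into a fixed point problem for a strict contraction of L^2(0, T), for every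
    T ([feedback_exists_on]).  The estimate above gives uniqueness, so these
    solutions fit together on the half-line ([feedback_exists]).

    For compatible H^1 data the solution is compared with its own translate by
    h.  The initial increment of the state is O(h): over [0, h] the solution is
    compared with the one generated by a constant internal input, which is
    classical ([compatible_start]).  The estimate then bounds the L^2 size of
    w (t + h) - w t by O(h), hence w is in H^1 ([H1_of_translation]), and the
    system node has a classical solution for the input w ([feedback_regular]).

    Compatible H^1 data are dense ([compatible_dense]), and by the estimate the
    classical solutions that they generate converge to the L^2 solution of
    arbitrary data, which is therefore a generalised solution
    ([generalised_exists]). *)

(** * Real-valued norms and inner products *)

Section Norm.
Context {R : realType}.
Implicit Types V W : normedModType R[i].

Lemma norm_rnorm V (v : V) : `|v| = (rnorm v)%:C.
Proof. by rewrite /rnorm RRe_real // normr_real. Qed.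

Lemma rnorm_ge0 V (v : V) : 0 <= rnorm v.
Proof. by rewrite -ler0c -norm_rnorm. Qed.

Lemma rnorm0 V : rnorm (0 : V) = 0.
Proof. by rewrite /rnorm normr0. Qed.

Lemma rnorm_eq0 V (v : V) : rnorm v = 0 -> v = 0.
Proof. by move=> v0; apply/eqP; rewrite -normr_eq0 norm_rnorm v0. Qed.

Lemma rnormN V (v : V) : rnorm (- v) = rnorm v.
Proof. by rewrite /rnorm normrN. Qed.

Lemma rnormB V (v w : V) : rnorm (v - w) = rnorm (w - v).
Proof. by rewrite /rnorm distrC. Qed.

Lemma rnormD_le V (v w : V) : rnorm (v + w) <= rnorm v + rnorm w.
Proof. by rewrite -lecR rmorphD /= -!norm_rnorm ler_normD. Qed.

Lemma rnormB_le V (v w : V) : rnorm (v - w) <= rnorm v + rnorm w.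
Proof. by rewrite -(rnormN w) rnormD_le. Qed.

Lemma rnorm_distD V (z v w : V) : rnorm (v - w) <= rnorm (v - z) + rnorm (z - w).
Proof. by rewrite -lecR rmorphD /= -!norm_rnorm ler_distD. Qed.

Lemma rnorm_dist V (v w : V) : `|rnorm v - rnorm w| <= rnorm (v - w).
Proof.
rewrite ler_norml; apply/andP; split.
  by have := rnormD_le (w - v) v; rewrite subrK (rnormB w); lra.
by have := rnormD_le (v - w) w; rewrite subrK; lra.
Qed.

Lemma rnormZ V (a : R[i]) (v : V) : rnorm (a *: v) = rnorm (a : R[i]^o) * rnorm v.
Proof.
by apply: (@complexI R); rewrite rmorphM /= -!norm_rnorm normrZ.
Qed.

Lemma rnorm_real (a : R) : rnorm (a%:C : R[i]^o) = `|a|.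
Proof. by rewrite /rnorm normc_def /= expr0n /= addr0 sqrtr_sqr. Qed.

Lemma rnormZr V (a : R) (v : V) : rnorm (a%:C *: v) = `|a| * rnorm v.
Proof. by rewrite rnormZ rnorm_real. Qed.

Lemma cvg_rnormP V T (F : set_system T) (FF : Filter F) (f : T -> V) (l : V) :
  f @ F --> l <-> forall e : R, 0 < e -> \forall x \near F, rnorm (f x - l) < e.
Proof.
split=> [/cvgrPdistC_lt h e e0 | h].
  have := h e%:C; rewrite ltcR => /(_ e0).
  by apply: filterS => x; rewrite norm_rnorm ltcR.
apply/cvgrPdistC_lt => e e0.
have eE : e = (complex.Re e)%:C by rewrite RRe_real // gtr0_real.
have e1 : 0 < complex.Re e by rewrite -ltcR -eE.
apply: filterS (h _ e1) => x.
by rewrite norm_rnorm [in X in _ -> X]eE ltcR.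
Qed.

Lemma cvg_rnorm0 V T (F : set_system T) (FF : Filter F) (f : T -> V) (l : V) :
  f @ F --> l <-> (fun x => rnorm (f x - l)) @ F --> (0 : R).
Proof.
rewrite cvg_rnormP; split => [h|/cvgrPdistC_lt h e /h].
  apply/cvgrPdistC_lt => e /h; apply: filterS => x.
  by rewrite subr0 ger0_norm // rnorm_ge0.
by apply: filterS => x; rewrite subr0 ger0_norm // rnorm_ge0.
Qed.

Lemma cvg_rnorm V T (F : set_system T) (FF : Filter F) (f : T -> V) (l : V) :
  f @ F --> l -> rnorm (f x) @[x --> F] --> rnorm l.
Proof.
move=> /cvg_rnormP h; apply/cvgrPdistC_lt => e /h; apply: filterS => x.
exact: le_lt_trans (rnorm_dist _ _).
Qed.

Lemma rnorm_cauchy_cvg (V : completeNormedModType R[i]) (u : nat -> V) :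
  (forall e : R, 0 < e -> exists N, forall m n, (N <= m)%N -> (N <= n)%N ->
     rnorm (u m - u n) < e) ->
  exists l : V, u @ \oo --> l.
Proof.
move=> h; exists (lim (u @ \oo)); apply: cauchy_cvg; apply: cauchy_exP => e e0.
have eE : e = (complex.Re e)%:C by rewrite RRe_real // gtr0_real.
have e1 : 0 < complex.Re e by rewrite -ltcR -eE.
have [N hN] := h _ e1; exists (u N); exists N => // n /= Nn.
rewrite -ball_normE /= norm_rnorm eE ltcR; exact: hN.
Qed.

End Norm.

Section Inner.
Context {R : realType}.
Implicit Types V : hilbertType R.

Definition rdot V (x y : V) : R := complex.Re '[x, y].

Lemma rdotDl V (x y z : V) : rdot (x + y) z = rdot x z + rdot y z.
Proof. by rewrite /rdot linearDl raddfD. Qed.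

Lemma rdotC V (x y : V) : rdot x y = rdot y x.
Proof.
rewrite /rdot (hermC _ x y) /= expr0 mul1r.
by case: (hdot _ _).
Qed.

Lemma rdotDr V (x y z : V) : rdot x (y + z) = rdot x y + rdot x z.
Proof. by rewrite ![rdot x _]rdotC rdotDl. Qed.

Lemma rdotNl V (x y : V) : rdot (- x) y = - rdot x y.
Proof. by rewrite /rdot linearNl raddfN. Qed.

Lemma rdotNr V (x y : V) : rdot x (- y) = - rdot x y.
Proof. by rewrite !(rdotC x) rdotNl. Qed.

Lemma rdotBl V (x y z : V) : rdot (x - y) z = rdot x z - rdot y z.
Proof. by rewrite rdotDl rdotNl. Qed.

Lemma rdotBr V (x y z : V) : rdot x (y - z) = rdot x y - rdot x z.
Proof. by rewrite rdotDr rdotNr. Qed.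

Lemma rdot0l V (x : V) : rdot 0 x = 0.
Proof. by rewrite /rdot linear0l. Qed.

Lemma rdot0r V (x : V) : rdot x 0 = 0.
Proof. by rewrite rdotC rdot0l. Qed.

Lemma rdotZl V (a : R) (x y : V) : rdot (a%:C *: x) y = a * rdot x y.
Proof. by rewrite /rdot linearZl_LR /=; case: (hdot _ _) => u v /=; rewrite mul0r subr0. Qed.

Lemma rdotZr V (a : R) (x y : V) : rdot x (a%:C *: y) = a * rdot x y.
Proof. by rewrite !(rdotC x) rdotZl. Qed.

Lemma rdotxx V (x : V) : rdot x x = rnorm x ^+ 2.
Proof. by rewrite /rdot -hdot_normE norm_rnorm -rmorphXn. Qed.

Lemma rnorm_sqD V (x y : V) :
  rnorm (x + y) ^+ 2 = rnorm x ^+ 2 + 2 * rdot x y + rnorm y ^+ 2.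
Proof. by rewrite -!rdotxx rdotDl !rdotDr (rdotC y x); ring. Qed.

Lemma rnorm_sqB V (x y : V) :
  rnorm (x - y) ^+ 2 = rnorm x ^+ 2 - 2 * rdot x y + rnorm y ^+ 2.
Proof. by rewrite rnorm_sqD rdotNr rnormN; ring. Qed.

Lemma rdot_le V (x y : V) : `|rdot x y| <= rnorm x * rnorm y.
Proof.
have key (u v : V) : rdot u v <= rnorm u * rnorm v.
  have [v0|v0] := eqVneq (rnorm v) 0.
    by rewrite (rnorm_eq0 v0) rdot0r rnorm0 mulr0.
  have [u0|u0] := eqVneq (rnorm u) 0.
    by rewrite (rnorm_eq0 u0) rdot0l rnorm0 mul0r.
  have pv : 0 < rnorm v by rewrite lt0r v0 rnorm_ge0.
  have pu : 0 < rnorm u by rewrite lt0r u0 rnorm_ge0.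
  have := sqr_ge0 (rnorm ((rnorm v)%:C *: u - (rnorm u)%:C *: v)).
  rewrite rnorm_sqB !rnormZr rdotZl rdotZr !ger0_norm ?rnorm_ge0 // => h.
  have : 0 <= (rnorm u * rnorm v) * (rnorm u * rnorm v - rdot u v) by nra.
  by rewrite pmulr_rge0 ?mulr_gt0 // subr_ge0.
by rewrite ler_norml key andbT lerNl -rdotNl -(rnormN x) key.
Qed.

Lemma rdot_young V (e : R) (x y : V) : 0 < e ->
  2 * rdot x y <= e * rnorm x ^+ 2 + e^-1 * rnorm y ^+ 2.
Proof.
move=> e0.
have := sqr_ge0 (rnorm (e%:C *: x - y)).
rewrite rnorm_sqB rnormZr rdotZl (ger0_norm (ltW e0)) => h.
by rewrite -(ler_pM2l e0) mulrDr (mulrA e e^-1) mulfV ?gt_eqF // mul1r; nra.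
Qed.

(** Inner products enter only through their real parts; these determine a
    vector and bound its norm. *)
Lemma rdot_bound V (x : V) (c : R) : 0 <= c ->
  (forall z, rdot x z <= c * rnorm z) -> rnorm x <= c.
Proof.
move=> c0 /(_ x); rewrite rdotxx expr2.
have [->//|x0] := eqVneq (rnorm x) 0.
by rewrite ler_pM2r // lt0r x0 rnorm_ge0.
Qed.

Lemma rdot_ext V (x y : V) : (forall z, rdot x z = rdot y z) -> x = y.
Proof.
move=> h; apply/eqP; rewrite -subr_eq0; apply/eqP/rnorm_eq0/eqP.
by rewrite -sqrf_eq0 -rdotxx rdotBl h subrr.
Qed.

Lemma cvg_rdot V T (F : set_system T) (FF : Filter F) (f g : T -> V) (a b : V) :
  f @ F --> a -> g @ F --> b -> rdot (f x) (g x) @[x --> F] --> rdot a b.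
Proof.
move=> fa gb.
have -> : rdot a b = (rnorm (a + b) ^+ 2 - rnorm a ^+ 2 - rnorm b ^+ 2) / 2.
  by rewrite rnorm_sqD; field.
rewrite (_ : (fun x => _) = fun x => (rnorm (f x + g x) ^+ 2
   - rnorm (f x) ^+ 2 - rnorm (g x) ^+ 2) / 2); last first.
  by apply/funext => x; rewrite rnorm_sqD; field.
apply: cvgMr_tmp; apply: cvgB; [apply: cvgB|]; rewrite ?expr2;
  under eq_fun do rewrite expr2.
- by apply: cvgM; apply: cvg_rnorm; apply: cvgD.
- by apply: cvgM; apply: cvg_rnorm.
- by apply: cvgM; apply: cvg_rnorm.
Qed.

End Inner.

(** Linear identities between vectors become identities of real numbers once
    they are tested against an arbitrary vector. *)
Ltac vlin := apply: rdot_ext => ?; rewrite ?(rdotDl, rdotNl, rdotZl, rdot0l); (ring || field).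

(** * Strong measurability *)

Section StrongMeasurability.
Context {R : realType} d (T : measurableType d).
Implicit Types V W : completeNormedModType R[i].

Definition sfun (V : choiceType) (s : T -> V) : Prop :=
  finite_set (range s) /\ forall v, measurable (s @^-1` [set v]).

(** The domain is an arbitrary measurable space because Tonelli's theorem calls
    for strongly measurable functions on the plane. *)
Definition smeas V (D : set T) (f : T -> V) : Prop :=
  exists s : nat -> T -> V, (forall n, sfun (s n))
    /\ forall t, D t -> s n t @[n --> \oo] --> f t.

Lemma sfun_preimage (V : choiceType) (s : T -> V) (A : set V) : sfun s -> measurable (s @^-1` A).
Proof.
move=> [fs ms].
have -> : s @^-1` A = \bigcup_(v in range s `&` A) (s @^-1` [set v]).
  by apply/seteqP; split=> [t At|t [v [_ Av] /= ->]//]; exists (s t).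
by apply: fin_bigcup_measurable => //; apply: finite_setIl.
Qed.

Lemma sfun_cst (V : choiceType) (v : V) : sfun (fun=> v).
Proof.
split=> [|w]; first by apply: sub_finite_set (finite_set1 v) => _ [t _ <-].
have [->|vw] := eqVneq v w.
  by rewrite (_ : _ @^-1` _ = setT)//; apply/seteqP; split.
rewrite (_ : _ @^-1` _ = set0)//; apply/seteqP; split=> // t /= E.
by rewrite E eqxx in vw.
Qed.

Lemma sfun_comp2 (V W Z : choiceType) (F : V -> W -> Z) (s : T -> V) (s' : T -> W) :
  sfun s -> sfun s' -> sfun (fun t => F (s t) (s' t)).
Proof.
move=> [fs ms] [fs' ms']; split=> [|z].
  apply: (@sub_finite_set _ _ ((fun p => F p.1 p.2) @` (range s `*` range s'))).
    by move=> _ [t _ <-]; exists (s t, s' t) => //=; split; exists t.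
  by apply: finite_image; apply: finite_setX.
have -> : (fun t => F (s t) (s' t)) @^-1` [set z] =
    \bigcup_(v in range s) ((s @^-1` [set v]) `&` (s' @^-1` [set w | F v w = z])).
  apply/seteqP; split=> [t /= E|t [v _ [/= -> //]]]; exists (s t) => //.
apply: fin_bigcup_measurable => // v _; apply: measurableI => //.
exact: sfun_preimage.
Qed.

Lemma sfun_if (V : choiceType) (E : set T) (s s' : T -> V) : measurable E ->
  sfun s -> sfun s' -> sfun (fun t => if t \in E then s t else s' t).
Proof.
move=> mE [fs ms] [fs' ms']; split=> [|z].
  apply: (@sub_finite_set _ _ (range s `|` range s')).
    by move=> _ [t _ <-]; case: ifP => _; [left|right]; exists t.
  by rewrite finite_setU.
have -> : (fun t => if t \in E then s t else s' t) @^-1` [set z] =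
    (E `&` (s @^-1` [set z])) `|` (~` E `&` (s' @^-1` [set z])).
  apply/seteqP; split=> t /=.
    by case: ifPn => [/set_mem|/negP]; rewrite ?inE; [left|right].
  move=> [[Et <-]|[nEt <-]]; first by rewrite mem_set.
  by rewrite memNset.
by apply: measurableU; apply: measurableI => //; apply: measurableC.
Qed.

Lemma smeas_sfun V (D : set T) (s : T -> V) : sfun s -> smeas D s.
Proof. by move=> ss; exists (fun=> s); split=> // t _; apply: cvg_cst. Qed.

Lemma smeas_sub V (D E : set T) (f : T -> V) : E `<=` D -> smeas D f -> smeas E f.
Proof. by move=> ED [s [ss sf]]; exists s; split=> // t /ED /sf. Qed.

Lemma smeas_eq V (D : set T) (f g : T -> V) : {in D, f =1 g} -> smeas D f -> smeas D g.
Proof.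
move=> fg [s [ss sf]]; exists s; split=> // t Dt.
by rewrite -fg ?inE //; exact: sf.
Qed.

Lemma smeas_comp2 V W (Z : completeNormedModType R[i]) (F : V -> W -> Z) D f g :
  (forall (u : nat -> V) (w : nat -> W) a b, u @ \oo --> a -> w @ \oo --> b ->
     F (u n) (w n) @[n --> \oo] --> F a b) ->
  smeas D f -> smeas D g -> smeas D (fun t => F (f t) (g t)).
Proof.
move=> cF [s [ss sf]] [s' [ss' sg]].
exists (fun n t => F (s n t) (s' n t)); split=> [n|t Dt]; first exact: sfun_comp2.
by apply: (cF (s ^~ t) (s' ^~ t)); [exact: sf|exact: sg].
Qed.

Lemma smeas_real V W (G : V -> W -> R) D f g : measurable D ->
  (forall (u : nat -> V) (w : nat -> W) a b, u @ \oo --> a -> w @ \oo --> b ->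
     G (u n) (w n) @[n --> \oo] --> G a b) ->
  smeas D f -> smeas D g -> measurable_fun D (fun t => G (f t) (g t)).
Proof.
move=> mD cG [s [ss sf]] [s' [ss' sg]].
apply: (@measurable_fun_cvg _ _ _ D (fun n t => G (s n t) (s' n t))) => [n|t Dt].
  move=> _ Y mY; apply: measurableI => //.
  exact: sfun_preimage (@sfun_comp2 _ _ R G _ _ (ss n) (ss' n)).
by apply: (cG (s ^~ t) (s' ^~ t)); [exact: sf|exact: sg].
Qed.

Lemma smeasD V D (f g : T -> V) : smeas D f -> smeas D g -> smeas D (fun t => f t + g t).
Proof. by apply: (smeas_comp2 (F := fun x y => x + y)) => u w a b; apply: cvgD. Qed.

Lemma smeasZ V D (c : R[i]) (f : T -> V) : smeas D f -> smeas D (fun t => c *: f t).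
Proof.
move=> mf; apply: (smeas_comp2 (F := fun x _ => c *: x) _ mf mf) => u w a b ua _.
exact: cvgZl_tmp.
Qed.

Lemma smeasB V D (f g : T -> V) : smeas D f -> smeas D g -> smeas D (fun t => f t - g t).
Proof. by apply: (smeas_comp2 (F := fun x y => x - y)) => u w a b; apply: cvgB. Qed.

Lemma smeas_cst V D (v : V) : smeas D (fun=> v).
Proof. exact/smeas_sfun/sfun_cst. Qed.

Lemma smeas_rnorm V D (f : T -> V) : measurable D -> smeas D f ->
  measurable_fun D (fun t => rnorm (f t)).
Proof.
move=> mD mf; apply: (smeas_real (G := fun x _ => rnorm x) mD _ mf mf) => //.
by move=> u w a b ua _; apply: cvg_rnorm.
Qed.

(** The dense set is given as a sequence, so that countably many of them can be
    merged by pairing indices. *)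
Definition separable_on V (D : set T) (f : T -> V) (v : nat -> V) :=
  forall t, D t -> forall e : R, 0 < e -> exists k, rnorm (f t - v k) < e.

Definition unpair_seq V (v : nat -> nat -> V) (m : nat) : V :=
  if (unpickle m : option (nat * nat)) is Some p then v p.1 p.2 else 0.

Lemma unpair_seqE V (v : nat -> nat -> V) n k : unpair_seq v (pickle (n, k)) = v n k.
Proof. by rewrite /unpair_seq pickleK. Qed.

Lemma smeas_separable V D (f : T -> V) : smeas D f -> exists v, separable_on D f v.
Proof.
move=> [s [ss sf]].
have /choice[l hl] : forall n, exists l : seq V, range (s n) = [set` l].
  by move=> n; apply/finite_seqP; case: (ss n).
exists (unpair_seq (fun n k => nth 0 (l n) k)) => t Dt e e0.
have /cvg_rnormP/(_ _ e0)[N _ /(_ N (leqnn _)) /= hN] := sf t Dt.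
have : [set` l N] (s N t) by rewrite -hl; exists t.
move=> /= /(nthP 0) [k _ kE]; exists (pickle (N, k)).
by rewrite unpair_seqE kE rnormB.
Qed.

(** Selecting the nearest among the first points of a dense sequence gives
    simple approximations; as the selection starts from the point 0, they are
    never farther from f than 0 is. *)
Lemma smeas_nearest V D (f : T -> V) (v : nat -> V) : measurable D ->
  separable_on D f v ->
  (forall k, measurable_fun D (fun t => rnorm (f t - v k))) ->
  measurable_fun D (fun t => rnorm (f t)) ->
  exists s : nat -> T -> V, [/\ forall n, sfun (s n),
    forall t, D t -> s n t @[n --> \oo] --> f t
    & forall n t, D t -> rnorm (f t - s n t) <= rnorm (f t)].
Proof.
move=> mD sepf mf mf0.
pose m := fix m n t : R := if n is k.+1 then Num.min (m k t) (rnorm (f t - v k))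
  else rnorm (f t).
pose E n := D `&` [set t | rnorm (f t - v n) < m n t].
pose s := fix s n t : V := if n is k.+1 then (if t \in E k then v k else s k t)
  else 0.
have mm n : measurable_fun D (m n).
  by elim: n => [//|n IH]; apply: measurable_minr.
have mE n : measurable (E n).
  have := measurable_fun_ltr (mf n) (mm n).
  by move=> /(_ mD [set true] I).
have sE n t : D t -> rnorm (f t - s n t) = m n t.
  move=> Dt; elim: n => [|n IH] /=; first by rewrite subr0.
  case: ifPn => [/set_mem[_ /= h]|/negP h].
    by rewrite minElt ltNge (ltW h).
  rewrite IH minElt; case: ifPn => // /negP h1.
  have : m n t <= rnorm (f t - v n).
    rewrite leNgt; apply/negP => h2; apply: h; rewrite inE; split => //.
  by move=> h2; apply/eqP; rewrite eq_le h2 /= leNgt; apply/negP.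
have mle n t : m n t <= rnorm (f t).
  by elim: n => [//|n IH] /=; rewrite ge_min IH.
have mle1 n k t : (k < n)%N -> m n t <= rnorm (f t - v k).
  elim: n => // n IH; rewrite ltnS leq_eqVlt => /orP[/eqP ->|/IH h] /=.
    by rewrite ge_min lexx orbT.
  by rewrite ge_min h.
exists s; split=> [n|t Dt|n t Dt]; last by rewrite sE.
  elim: n => [|n IH] /=; first exact: sfun_cst.
  by apply: sfun_if => //; apply: sfun_cst.
apply/cvg_rnormP => e e0; have [k hk] := sepf t Dt e e0.
exists k.+1 => // n /= kn; rewrite rnormB sE //.
exact: le_lt_trans (mle1 _ _ _ kn) hk.
Qed.

(** Pettis' argument: a pointwise limit has separable range and measurable
    distances to points, which is all that [smeas_nearest] asks for. *)
Lemma smeas_lim V D (f : nat -> T -> V) (g : T -> V) : measurable D ->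
  (forall n, smeas D (f n)) -> (forall t, D t -> f n t @[n --> \oo] --> g t) ->
  smeas D g.
Proof.
move=> mD mf fg.
have /choice[v hv] : forall n, exists v, separable_on D (f n) v.
  by move=> n; apply: smeas_separable.
have mdist z : measurable_fun D (fun t => rnorm (g t - z)).
  apply: (@measurable_fun_cvg _ _ _ D (fun n t => rnorm (f n t - z))) => [n|t Dt].
    by apply: smeas_rnorm => //; apply: smeasB => //; apply: smeas_cst.
  by apply: cvg_rnorm; apply: cvgB; [exact: fg|exact: cvg_cst].
have [s [ss sg _]] : exists s : nat -> T -> V, [/\ forall n, sfun (s n),
    forall t, D t -> s n t @[n --> \oo] --> g t
    & forall n t, D t -> rnorm (g t - s n t) <= rnorm (g t)].
  apply: (@smeas_nearest V D g (unpair_seq v)) => // [t Dt e e0|].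
    have e2 : 0 < e / 2 by rewrite divr_gt0.
    have /cvg_rnormP/(_ _ e2)[N _ /(_ N (leqnn _)) /= hN] := fg t Dt.
    have [k hk] := hv N t Dt _ e2.
    exists (pickle (N, k)); rewrite unpair_seqE.
    by apply: le_lt_trans (rnorm_distD (f N t) _ _) _; rewrite rnormB; lra.
  by have := mdist 0; under eq_fun do rewrite subr0.
by exists s.
Qed.

Lemma smeas_approx V D (f : T -> V) : measurable D -> smeas D f ->
  exists s : nat -> T -> V, [/\ forall n, sfun (s n),
    forall t, D t -> s n t @[n --> \oo] --> f t
    & forall n t, D t -> rnorm (f t - s n t) <= rnorm (f t)].
Proof.
move=> mD mf; have [v hv] := smeas_separable mf.
apply: (smeas_nearest mD hv) => [k|]; last exact: smeas_rnorm.
by apply: smeas_rnorm => //; apply: smeasB => //; apply: smeas_cst.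
Qed.

Lemma smeas_if V (D E : set T) (f g : T -> V) : measurable E ->
  smeas (D `&` E) f -> smeas (D `\` E) g ->
  smeas D (fun t => if t \in E then f t else g t).
Proof.
move=> mE [s [ss sf]] [s' [ss' sg]].
exists (fun n t => if t \in E then s n t else s' n t); split=> [n|t Dt].
  exact: sfun_if.
by case: ifPn => [/set_mem Et|/negP Et]; [apply: sf|apply: sg; split=> //; rewrite inE in Et].
Qed.

End StrongMeasurability.

Lemma smeas_comp {R : realType} d d' (T : measurableType d) (T' : measurableType d')
    (V : completeNormedModType R[i]) (D : set T) (D' : set T') (f : T -> V) (h : T' -> T) :
  measurable_fun setT h -> (forall t, D' t -> D (h t)) -> smeas D f -> smeas D' (f \o h).
Proof.
move=> mh DD' [s [ss sf]]; exists (fun n => s n \o h); split=> [n|t /DD' Dt].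
  have [fs ms] := ss n; split=> [|v].
    by apply: sub_finite_set fs => _ [t _ <-]; exists (h t).
  by rewrite comp_preimage -[X in measurable X]setTI; apply: mh.
exact: sf.
Qed.

(** * Square-integrable functions *)

(** The array a stands for the mutual distances of a sequence; it will be
    filled both with norms and with L^2 distances. *)
Lemma geometric_cauchy {R : realType} (a : nat -> nat -> R) (C q : R) :
  0 <= q < 1 -> 0 <= C -> (forall n, a n n = 0) -> (forall m n, a m n = a n m) ->
  (forall m n, a m n.+1 <= a m n + C * q ^+ n) ->
  forall e, 0 < e -> exists N, forall m n, (N <= m)%N -> (N <= n)%N -> a m n < e.
Proof.
move=> /andP[q0 q1] C0 a0 aC aS.
have q1' : 0 < 1 - q by rewrite subr_gt0.
have key m k : a m (m + k)%N <= C * q ^+ m * (1 - q ^+ k) / (1 - q).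
  elim: k => [|k IH]; first by rewrite addn0 a0 expr0 subrr mulr0 mul0r.
  rewrite addnS; apply: le_trans (aS _ _) _.
  apply: le_trans (lerD IH (lexx _)) _.
  rewrite exprD exprS; set x := q ^+ m; set y := q ^+ k.
  rewrite le_eqVlt; apply/orP; left; apply/eqP; field.
  by rewrite gt_eqF.
move=> e e0.
have : (fun n => C * q ^+ n / (1 - q)) @ \oo --> (0 : R).
  rewrite -(mul0r (1 - q)^-1); apply: cvgMr_tmp.
  by rewrite -(mulr0 C); apply: cvgMl_tmp; apply: cvg_expr; rewrite ger0_norm.
move=> /cvgrPdist_lt/(_ e e0)[N _ hN]; exists N => m n.
wlog mn : m n / (m <= n)%N => [hw Nm Nn|Nm _].
  by case/orP: (leq_total m n) => h; [exact: hw|rewrite aC; exact: hw].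
have := hN m Nm; rewrite /= sub0r normrN ger0_norm; last first.
  by rewrite divr_ge0 ?mulr_ge0 ?exprn_ge0 // ltW.
apply: le_lt_trans; rewrite -(subnKC mn); apply: le_trans (key _ _) _.
rewrite ler_pM2r ?invr_gt0 // ler_piMr ?mulr_ge0 ?exprn_ge0 //.
by rewrite lerBlDr lerDl exprn_ge0.
Qed.

Section L2Space.
Context {R : realType}.
Implicit Types (V W : hilbertType R) (D E : set R).
Local Notation mu := (@lebesgue_measure R).
Local Notation rint D f := (mu.-integrable D (EFin \o f)).

(** The square of the L^2 norm, as a real number. *)
Definition sqint V D (f : R -> V) : R := \int[mu]_(t in D) (rnorm (f t) ^+ 2).

Definition L2dot V D (f g : R -> V) : R := \int[mu]_(t in D) rdot (f t) (g t).

Lemma ae_of_all (P : R -> Prop) : (forall t, P t) -> \forall t \ae mu, P t.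
Proof.
move=> h; exists set0; split; rewrite ?measure0 //.
by move=> t /=; apply; apply: h.
Qed.

Lemma ae_imply (P P' : R -> Prop) : (forall t, P t -> P' t) ->
  (\forall t \ae mu, P t) -> \forall t \ae mu, P' t.
Proof.
move=> h [N [mN N0 hN]]; exists N; split=> // t nP; apply: hN => Pt.
exact/nP/h.
Qed.

Lemma ae_imply2 (P1 P2 P : R -> Prop) : (forall t, P1 t -> P2 t -> P t) ->
  (\forall t \ae mu, P1 t) -> (\forall t \ae mu, P2 t) -> \forall t \ae mu, P t.
Proof.
move=> h [N [mN N0 hN]] [M [mM M0 hM]]; exists (N `|` M); split=> //.
- exact: measurableU.
- by rewrite null_set_setU.
move=> t nP; have [Nt|Nt] := pselect (N t); first by left.
right; apply: hM => P2t; apply: nP; apply: h => //.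
by apply: contrapT => nP1; apply: Nt; apply: hN.
Qed.

Lemma rint_le D (f g : R -> R) : measurable D -> measurable_fun D f ->
  rint D g -> (forall t, D t -> `|f t| <= g t) -> rint D f.
Proof.
move=> mD mf ig fg; apply: le_integrable ig => //; first exact/measurable_EFinP.
move=> t Dt /=; rewrite lee_fin (le_trans (fg _ Dt)) // ler_norm //.
Qed.

Lemma rintD D (f g : R -> R) : measurable D -> rint D f -> rint D g ->
  rint D (fun t => f t + g t).
Proof. by move=> mD fi gi; apply: integrableD fi gi. Qed.

Lemma rintB D (f g : R -> R) : measurable D -> rint D f -> rint D g ->
  rint D (fun t => f t - g t).
Proof. by move=> mD fi gi; apply: integrableB fi gi. Qed.

Lemma rintZ D c (f : R -> R) : measurable D -> rint D f -> rint D (fun t => c * f t).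
Proof. by move=> mD fi; apply: integrableZl fi. Qed.

Lemma rint_sub D E (f : R -> R) : measurable D -> measurable E -> E `<=` D ->
  rint D f -> rint E f.
Proof. by move=> mD mE ED; apply: (@integrableS _ _ _ mu D E). Qed.

Lemma rint_fin D (f : R -> R) : measurable D -> rint D f ->
  (\int[mu]_(t in D) (f t)%:E = (\int[mu]_(t in D) f t)%:E)%E.
Proof. by move=> mD fi; rewrite /Rintegral fineK //; apply: integrable_fin_num. Qed.

Lemma smeas_rnorm2 V D (f : R -> V) : measurable D -> smeas D f ->
  measurable_fun D (fun t => rnorm (f t) ^+ 2).
Proof. by move=> mD mf; apply: measurable_funX; apply: smeas_rnorm. Qed.

Lemma smeas_rdot V D (f g : R -> V) : measurable D -> smeas D f -> smeas D g ->
  measurable_fun D (fun t => rdot (f t) (g t)).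
Proof.
move=> mD; apply: (smeas_real (G := fun x y => rdot x y) mD) => u w a b.
exact: cvg_rdot.
Qed.

Lemma L2normE V D (f : R -> V) :
  L2norm D f = sqrte (\int[mu]_(t in D) (rnorm (f t) ^+ 2)%:E).
Proof.
rewrite /L2norm unlock -poweR12_sqrt; last first.
  by apply: integral_ge0 => t _; rewrite lee_fin sqr_ge0.
congr poweR; rewrite [RHS]integral_mkcond; apply: eq_integral => t _.
rewrite poweR_EFin powR_mulrn ?normr_ge0 // real_normK ?num_real //.
rewrite /patch indicE; case: ifP => _; first by rewrite mulr1.
by rewrite mulr0 expr0n.
Qed.

Lemma L2_smeas V D (f : R -> V) : L2_on D f -> smeas D f.
Proof. by case. Qed.

Lemma L2_rint V D (f : R -> V) : measurable D -> L2_on D f ->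
  rint D (fun t => rnorm (f t) ^+ 2).
Proof.
move=> mD [mf]; rewrite L2normE => fin; apply/integrableP; split.
  by apply/measurable_EFinP; apply: smeas_rnorm2.
under eq_integral do rewrite /= ger0_norm ?sqr_ge0 //.
suff h (x : \bar R) : (sqrte x < +oo -> x < +oo)%E by exact: h fin.
by case: x => [r||] //= _; exact: ltry.
Qed.

Lemma L2_onI V D (f : R -> V) : measurable D -> smeas D f ->
  rint D (fun t => rnorm (f t) ^+ 2) -> L2_on D f.
Proof.
move=> mD mf fi; split=> //; rewrite L2normE rint_fin //=.
exact: ltry.
Qed.

Lemma L2_le V D (f : R -> V) (h : R -> R) : measurable D -> smeas D f ->
  rint D h -> (forall t, D t -> rnorm (f t) ^+ 2 <= h t) -> L2_on D f.
Proof.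
move=> mD mf hi fh; apply: L2_onI => //; apply: rint_le hi _ => //.
  exact: smeas_rnorm2.
by move=> t Dt; rewrite ger0_norm ?sqr_ge0 // fh.
Qed.

Lemma L2norm_sqint V D (f : R -> V) : measurable D -> L2_on D f ->
  L2norm D f = (Num.sqrt (sqint D f))%:E.
Proof. by move=> mD f2; rewrite L2normE rint_fin //; apply: L2_rint. Qed.

Lemma sqint_ge0 V D (f : R -> V) : 0 <= sqint D f.
Proof. by apply: Rintegral_ge0 => t _; rewrite sqr_ge0. Qed.

Lemma sqintE V D (f : R -> V) : measurable D -> L2_on D f ->
  (\int[mu]_(t in D) (rnorm (f t) ^+ 2)%:E = (sqint D f)%:E)%E.
Proof. by move=> mD f2; rewrite rint_fin //; apply: L2_rint. Qed.

Lemma rdot_rint V D (f g : R -> V) : measurable D -> L2_on D f -> L2_on D g ->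
  rint D (fun t => rdot (f t) (g t)).
Proof.
move=> mD f2 g2.
apply: (rint_le mD _ (rintD mD (L2_rint mD f2) (L2_rint mD g2))).
  by apply: smeas_rdot => //; apply: L2_smeas.
move=> t _; apply: le_trans (rdot_le _ _) _.
have := rnorm_ge0 (f t); have := rnorm_ge0 (g t); nra.
Qed.

Lemma L2D V D (f g : R -> V) : measurable D -> L2_on D f -> L2_on D g ->
  L2_on D (fun t => f t + g t).
Proof.
move=> mD f2 g2.
apply: (L2_le (h := fun t => 2 * rnorm (f t) ^+ 2 + 2 * rnorm (g t) ^+ 2)) => //.
- by apply: smeasD; apply: L2_smeas.
- by apply: rintD => //; apply: rintZ => //; apply: L2_rint.
move=> t _; rewrite rnorm_sqD.
have := @rdot_young _ _ 1 (f t) (g t) ltr01; rewrite invr1; lra.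
Qed.

Lemma L2Z V D (c : R[i]) (f : R -> V) : measurable D -> L2_on D f ->
  L2_on D (fun t => c *: f t).
Proof.
move=> mD f2.
apply: (L2_le (h := fun t => rnorm (c : R[i]^o) ^+ 2 * rnorm (f t) ^+ 2)) => //.
- by apply: smeasZ; apply: L2_smeas.
- by apply: rintZ => //; apply: L2_rint.
by move=> t _; rewrite rnormZ exprMn.
Qed.

Lemma L2B V D (f g : R -> V) : measurable D -> L2_on D f -> L2_on D g ->
  L2_on D (fun t => f t - g t).
Proof.
move=> mD f2 g2; have := L2D mD f2 (L2Z (-1) mD g2).
by under eq_fun do rewrite scaleN1r.
Qed.

Lemma rint_cst D (c : R) : measurable D -> (mu D < +oo)%E -> rint D (fun=> c).
Proof.
move=> mD fD; apply/integrableP; split; first exact: measurable_cst.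
by rewrite /= integral_cst //= lte_mul_pinfty // lee_fin.
Qed.

Lemma L2_cst V D (v : V) : measurable D -> (mu D < +oo)%E -> L2_on D (fun=> v).
Proof.
move=> mD fD; apply: (L2_le (h := fun=> rnorm v ^+ 2)) => //.
  exact: smeas_cst.
exact: rint_cst.
Qed.

Lemma L2_sub V D E (f : R -> V) : measurable D -> measurable E -> E `<=` D ->
  L2_on D f -> L2_on E f.
Proof.
move=> mD mE ED f2; apply: L2_onI => //.
  exact: smeas_sub ED (L2_smeas f2).
exact: rint_sub (L2_rint mD f2).
Qed.

Lemma L2_eq V D (f g : R -> V) : measurable D -> {in D, f =1 g} -> L2_on D f -> L2_on D g.
Proof.
move=> mD fg f2; apply: (L2_le (h := fun t => rnorm (f t) ^+ 2)) => //.
- exact: smeas_eq fg (L2_smeas f2).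
- exact: L2_rint.
by move=> t Dt; rewrite fg ?inE.
Qed.

Lemma sqint_sub V D E (f : R -> V) : measurable D -> measurable E -> E `<=` D ->
  L2_on D f -> sqint E f <= sqint D f.
Proof.
move=> mD mE ED f2; rewrite -lee_fin -!sqintE //; last exact: L2_sub ED f2.
apply: ge0_subset_integral => //.
  by apply/measurable_EFinP; apply: smeas_rnorm2 => //; apply: L2_smeas.
by move=> t _; rewrite lee_fin sqr_ge0.
Qed.

Lemma sqint_eq V D (f g : R -> V) : {in D, f =1 g} -> sqint D f = sqint D g.
Proof. by move=> fg; apply: eq_Rintegral => t Dt; rewrite fg. Qed.

Lemma sqint_ae V D (f g : R -> V) : measurable D -> smeas D f -> smeas D g ->
  (\forall t \ae mu, D t -> f t = g t) -> sqint D f = sqint D g.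
Proof.
move=> mD mf mg fg; congr fine; apply: ae_eq_integral => //.
- by apply/measurable_EFinP; apply: smeas_rnorm2.
- by apply/measurable_EFinP; apply: smeas_rnorm2.
by apply: ae_imply fg => t fg /fg ->.
Qed.

Lemma L2dot_ae V D (f g f' g' : R -> V) : measurable D ->
  smeas D f -> smeas D g -> smeas D f' -> smeas D g' ->
  (\forall t \ae mu, D t -> f t = f' t) -> (\forall t \ae mu, D t -> g t = g' t) ->
  L2dot D f g = L2dot D f' g'.
Proof.
move=> mD mf mg mf' mg' ff gg; congr fine; apply: ae_eq_integral => //.
- by apply/measurable_EFinP; apply: smeas_rdot.
- by apply/measurable_EFinP; apply: smeas_rdot.
by apply: ae_imply2 ff gg => t ff gg Dt; rewrite ff // gg.
Qed.

Lemma sqint_le V W D (f : R -> V) (g : R -> W) (c : R) : measurable D ->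
  L2_on D f -> L2_on D g ->
  (forall t, D t -> rnorm (f t) ^+ 2 <= c * rnorm (g t) ^+ 2) -> sqint D f <= c * sqint D g.
Proof.
move=> mD f2 g2 fg; rewrite /sqint -RintegralZl //; last exact: L2_rint.
by apply: le_Rintegral => //; [exact: L2_rint|apply: rintZ => //; exact: L2_rint].
Qed.

Lemma sqintZ V D (c : R) (f : R -> V) : measurable D -> L2_on D f ->
  sqint D (fun t => c%:C *: f t) = c ^+ 2 * sqint D f.
Proof.
move=> mD f2; rewrite /sqint -RintegralZl //; last exact: L2_rint.
by apply: eq_Rintegral => t _; rewrite rnormZr exprMn real_normK ?num_real.
Qed.

Lemma sqintD V D (f g : R -> V) : measurable D -> L2_on D f -> L2_on D g ->
  sqint D (fun t => f t + g t) = sqint D f + 2 * L2dot D f g + sqint D g.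
Proof.
move=> mD f2 g2; have fi := L2_rint mD f2; have gi := L2_rint mD g2.
have ii := rdot_rint mD f2 g2.
rewrite /sqint /L2dot -RintegralZl // -RintegralD //; last exact: rintZ.
rewrite -RintegralD //; last by apply: rintD => //; exact: rintZ.
by apply: eq_Rintegral => t _; rewrite rnorm_sqD.
Qed.

Lemma L2dotZr V D (c : R) (f g : R -> V) : measurable D -> L2_on D f -> L2_on D g ->
  L2dot D f (fun t => c%:C *: g t) = c * L2dot D f g.
Proof.
move=> mD f2 g2; rewrite /L2dot -RintegralZl //; last exact: rdot_rint.
by apply: eq_Rintegral => t _; rewrite rdotZr.
Qed.

Lemma L2dotC V D (f g : R -> V) : L2dot D f g = L2dot D g f.
Proof. by apply: eq_Rintegral => t _; rewrite rdotC. Qed.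

Lemma sqintB V D (f g : R -> V) : measurable D -> L2_on D f -> L2_on D g ->
  sqint D (fun t => f t - g t) = sqint D f - 2 * L2dot D f g + sqint D g.
Proof.
move=> mD f2 g2; have := sqintD mD f2 (L2Z (-1)%:C mD g2).
rewrite sqintZ // L2dotZr // sqrrN expr1n mul1r mulN1r mulrN => <-.
by apply: sqint_eq => t _; rewrite rmorphN1 scaleN1r.
Qed.

Lemma L2dot_young V D (e : R) (f g : R -> V) : measurable D -> 0 < e ->
  L2_on D f -> L2_on D g -> 2 * L2dot D f g <= e * sqint D f + e^-1 * sqint D g.
Proof.
move=> mD e0 f2 g2; have fi := L2_rint mD f2; have gi := L2_rint mD g2.
have ii := rdot_rint mD f2 g2.
rewrite /sqint /L2dot -!RintegralZl // -RintegralD //; try exact: rintZ.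
apply: le_Rintegral => //; first exact: rintZ.
  by apply: rintD => //; exact: rintZ.
by move=> t _; apply: rdot_young.
Qed.

(** Minkowski's inequality: Cauchy-Schwarz follows from Young's inequality by
    choosing its parameter, which is sent to an end point of (0, oo) when one of
    the norms vanishes. *)
Lemma sqrt_sqintD V D (f g : R -> V) : measurable D -> L2_on D f -> L2_on D g ->
  Num.sqrt (sqint D (fun t => f t + g t)) <= Num.sqrt (sqint D f) + Num.sqrt (sqint D g).
Proof.
move=> mD f2 g2; set a := Num.sqrt (sqint D f); set b := Num.sqrt (sqint D g).
have a0 : 0 <= a by apply: sqrtr_ge0.
have b0 : 0 <= b by apply: sqrtr_ge0.
have aE : sqint D f = a ^+ 2 by rewrite sqr_sqrtr ?sqint_ge0.
have bE : sqint D g = b ^+ 2 by rewrite sqr_sqrtr ?sqint_ge0.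
have y e : 0 < e -> 2 * L2dot D f g <= e * a ^+ 2 + e^-1 * b ^+ 2.
  by rewrite -aE -bE => e0; apply: L2dot_young.
have key : L2dot D f g <= a * b.
  have [a1|a1] := eqVneq a 0.
    rewrite a1 mul0r leNgt; apply/negP => i0.
    have e0 : 0 < (b ^+ 2 + 1) / L2dot D f g.
      by rewrite divr_gt0 //; have := sqr_ge0 b; lra.
    have := y _ e0; rewrite a1 expr0n mulr0 add0r invf_div mulrAC.
    rewrite ler_pdivlMr; last by have := sqr_ge0 b; lra.
    have := sqr_ge0 b; nra.
  have [b1|b1] := eqVneq b 0.
    rewrite b1 mulr0 leNgt; apply/negP => i0.
    have e0 : 0 < L2dot D f g / (a ^+ 2 + 1).
      by rewrite divr_gt0 //; have := sqr_ge0 a; lra.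
    have := y _ e0; rewrite b1 expr0n mulr0 addr0 mulrAC.
    rewrite ler_pdivlMr; last by have := sqr_ge0 a; lra.
    have := sqr_ge0 a; nra.
  have pa : 0 < a by rewrite lt0r a1.
  have pb : 0 < b by rewrite lt0r b1.
  have := y (b / a) (divr_gt0 pb pa).
  rewrite (_ : _ + _ = 2 * (a * b)); last by field; rewrite a1 b1.
  by rewrite ler_pM2l.
rewrite -(ler_pXn2r (_ : (0 < 2)%N)) ?nnegrE ?sqrtr_ge0 ?addr_ge0 //.
rewrite sqr_sqrtr ?sqint_ge0 // sqintD // aE bE; nra.
Qed.

Lemma sqrt_sqint_triangle V D (f g h : R -> V) : measurable D -> L2_on D f -> L2_on D g ->
  L2_on D h ->
  Num.sqrt (sqint D (fun t => f t - h t)) <=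
    Num.sqrt (sqint D (fun t => f t - g t)) + Num.sqrt (sqint D (fun t => g t - h t)).
Proof.
move=> mD f2 g2 h2; apply: le_trans (sqrt_sqintD mD (L2B mD f2 g2) (L2B mD g2 h2)).
by rewrite le_eqVlt; apply/orP; left; apply/eqP; congr Num.sqrt; apply: sqint_eq => t _;
  rewrite addrA subrK.
Qed.

Lemma sqint_distC V D (f g : R -> V) :
  sqint D (fun t => f t - g t) = sqint D (fun t => g t - f t).
Proof. by apply: eq_Rintegral => t _; rewrite rnormB. Qed.

Lemma sqintD_le V D (f g : R -> V) : measurable D -> L2_on D f -> L2_on D g ->
  sqint D (fun t => f t + g t) <= 2 * sqint D f + 2 * sqint D g.
Proof.
move=> mD f2 g2; rewrite sqintD //.
by have := L2dot_young mD ltr01 f2 g2; rewrite invr1; lra.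
Qed.

(** The measure of D is finite, so that the constant h 0 is square integrable. *)
Lemma L2_lipschitz V W D (h : V -> W) (L : R) (f : R -> V) : measurable D ->
  (mu D < +oo)%E -> 0 <= L ->
  (forall v w, rnorm (h v - h w) <= L * rnorm (v - w)) ->
  L2_on D f -> L2_on D (fun t => h (f t)).
Proof.
move=> mD fD L0 hL f2.
pose k t := 2 * L ^+ 2 * rnorm (f t) ^+ 2 + 2 * rnorm (h 0) ^+ 2.
apply: (L2_le (h := k)) => //.
- apply: (smeas_comp2 (F := fun x _ => h x) _ (L2_smeas f2) (L2_smeas f2)).
  move=> u _ a _ /cvg_rnormP ua _; apply/cvg_rnormP => e e0.
  have L1 : 0 < L + 1 by lra.
  apply: filterS (ua _ (divr_gt0 e0 L1)) => n; rewrite ltr_pdivlMr // => ne.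
  apply: le_lt_trans (hL _ _) _.
  have := rnorm_ge0 (u n - a); nra.
- by apply: rintD => //; [apply: rintZ => //; exact: L2_rint|exact: rint_cst].
move=> t _; rewrite /k.
have := rnormD_le (h (f t) - h 0) (h 0); rewrite subrK.
have := hL (f t) 0; rewrite subr0.
have := rnorm_ge0 (f t); have := rnorm_ge0 (h 0); have := rnorm_ge0 (h (f t)).
have := rnorm_ge0 (h (f t) - h 0).
move: (rnorm (h (f t) - h 0)) (rnorm (h (f t))) (rnorm (f t)) (rnorm (h 0)).
move=> A B C E A0 B0 E0 C0 AC BAE.
have : B ^+ 2 <= (L * C + E) ^+ 2 by rewrite ler_pXn2r ?nnegrE //; nra.
have := sqr_ge0 (L * C - E); nra.
Qed.

End L2Space.

(** * Completeness of L^2 *)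

Section Completeness.
Context {R : realType}.
Implicit Types (V W : hilbertType R) (D : set R).
Local Notation mu := (@lebesgue_measure R).

(** The series of the squared increments, weighted by 4^k, has a finite
    integral.  Where its sum is finite the increments decay geometrically and
    the sequence is Cauchy; this is almost everywhere, and setting the limit to
    0 on the remaining set makes it an everywhere limit of measurable
    functions. *)
Lemma L2_fast_limit V D (g : nat -> R -> V) : measurable D ->
  (forall k, L2_on D (g k)) ->
  (forall k, sqint D (fun t => g k.+1 t - g k t) <= 8^-1 ^+ k) ->
  exists f, smeas D f /\
    \forall t \ae mu, D t -> g k t @[k --> \oo] --> f t.
Proof.
move=> mD g2 gQ.
pose h k t : \bar R := (4 ^+ k * rnorm (g k.+1 t - g k t) ^+ 2)%:E.
have h0 k t : (0 <= h k t)%E by rewrite lee_fin mulr_ge0 ?sqr_ge0 ?exprn_ge0.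
have mh k : measurable_fun D (h k).
  apply/measurable_EFinP; apply: measurable_funM; first exact: measurable_cst.
  by apply: smeas_rnorm2 => //; apply: smeasB; apply: L2_smeas.
pose S t := (\sum_(0 <= k <oo) h k t)%E.
have S0 t : (0 <= S t)%E by apply: nneseries_ge0 => k _ _; exact: h0.
have mS : measurable_fun D S.
  by apply: ge0_emeasurable_sum => [k t _ _|k _]; [exact: h0|exact: mh].
have intS : (\int[mu]_(t in D) S t < +oo)%E.
  rewrite integral_nneseries //.
  apply: (@le_lt_trans _ _ (\sum_(0 <= k <oo) (1 / 2 ^+ k)%:E)%E); last first.
    have : (fun n => \sum_(0 <= k < n) (1 / 2 ^+ k)%:E)%E @ \oo --> (2%:E : \bar R).
      have := @cvg_geometric_series R 1 (2^-1).
      rewrite ger0_norm // => /(_ ltac:(lra)).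
      rewrite (_ : 1 / (1 - 2^-1) = 2); last by field.
      move=> H.
      have : EFin \o (series (geometric 1 (2^-1 : R))) @ \oo --> (2%:E : \bar R).
        by apply: cvg_EFin => //; apply: nearW.
      move=> H2; rewrite (_ : (fun n => _) = EFin \o (series (geometric 1 (2^-1 : R)))) //.
      apply/funext => n; rewrite /= /series /= -sumEFin; apply: eq_bigr => k _.
      by rewrite exprVn.
    by move/cvg_lim => -> //; exact: ltry.
  apply: lee_nneseries => k _; first by rewrite integral_ge0.
  rewrite /h; under eq_integral do rewrite EFinM.
  have gB := L2B mD (g2 k.+1) (g2 k).
  rewrite ge0_integralZl_EFin //; last 2 first.
  - by move=> t _; rewrite lee_fin sqr_ge0.
  - by apply/measurable_EFinP; apply: smeas_rnorm2 => //; apply: L2_smeas.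
  rewrite sqintE // -EFinM lee_fin.
  apply: le_trans (ler_wpM2l (exprn_ge0 _ _) (gQ k)) _ => //.
  rewrite -exprMn (_ : 4 * 8^-1 = 2^-1); last by field.
  by rewrite exprVn div1r.
pose E := D `&` [set t | (S t < +oo)%E].
have mE : measurable E.
  by have := emeasurable_fun_infty_o mD mS +oo%E.
have aeE : \forall t \ae mu, D t -> E t.
  have /integrable_ae : mu.-integrable D S.
    apply/integrableP; split => //.
    by under eq_integral do rewrite gee0_abs //.
  move=> /(_ mD); apply: ae_imply => t h1 Dt; split => //=.
  by move: (h1 Dt) (S0 t); case: (S t) => //= r _ _; exact: ltry.
have cvgE t : E t -> exists l : V, g k t @[k --> \oo] --> l.
  move=> [Dt /= St]; apply: rnorm_cauchy_cvg.
  have hS k : 4 ^+ k * rnorm (g k.+1 t - g k t) ^+ 2 <= fine (S t).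
    rewrite -lee_fin fineK ?ge0_fin_numE //.
    apply: le_trans (nneseries_lim_ge k.+1 _) => //.
    by rewrite big_nat_recr //= leeDr // sume_ge0.
  have M0 : 0 <= fine (S t) by apply: fine_ge0.
  apply: (@geometric_cauchy _ (fun m n => rnorm (g m t - g n t))
           (Num.sqrt (fine (S t))) 2^-1).
  - by lra.
  - exact: sqrtr_ge0.
  - by move=> n; rewrite subrr rnorm0.
  - by move=> m n; rewrite rnormB.
  move=> m n; apply: le_trans (rnorm_distD (g n t) _ _) _; rewrite lerD2l.
  rewrite rnormB -(ler_pXn2r (_ : (0 < 2)%N)) ?nnegrE ?rnorm_ge0 ?mulr_ge0 ?sqrtr_ge0 ?exprn_ge0 //.
  rewrite exprMn sqr_sqrtr // -(ler_pM2l (_ : 0 < 4 ^+ n)) ?exprn_gt0 //.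
  apply: le_trans (hS n) _.
  rewrite mulrCA -exprM mulnC exprM exprVn -exprMn.
  by rewrite (_ : 4 * _ = 1) ?expr1n ?mulr1 //; field.
pose f t := if t \in E then lim (g k t @[k --> \oo]) else 0.
exists f; split; last first.
  apply: ae_imply aeE => t h1 /h1 Et; rewrite /f mem_set //.
  by have [l hl] := cvgE t Et; rewrite (cvg_lim _ hl).
apply: (@smeas_lim _ _ _ _ _ (fun k t => if t \in E then g k t else 0)) => //.
  move=> n; apply: smeas_if => //; last exact: smeas_cst.
  by apply: smeas_sub (L2_smeas (g2 n)) => t [].
move=> t Dt; rewrite /f; case: ifPn => [/set_mem Et|_]; last exact: cvg_cst.
by have [l hl] := cvgE t Et; rewrite (cvg_lim _ hl).
Qed.

Lemma limn_einf_le (u : nat -> \bar R) (e : \bar R) K :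
  (forall k, (K <= k)%N -> (u k <= e)%E) -> (limn_einf u <= e)%E.
Proof.
move=> h; rewrite limn_einf_lim; apply: lime_le; first exact: is_cvg_einfs.
apply: nearW => n; rewrite /einfs.
apply: le_trans (h (maxn n K) (leq_maxr _ _)).
by apply: ereal_inf_lbound; exists (maxn n K) => //=; exact: leq_maxl.
Qed.

Lemma limn_einf_ge (u : nat -> \bar R) : (forall k, (0 <= u k)%E) -> (0 <= limn_einf u)%E.
Proof.
move=> h; rewrite limn_einf_lim; apply: lime_ge; first exact: is_cvg_einfs.
by apply: nearW => n; apply: le_ereal_inf_tmp => _ [k _ <-].
Qed.

(** Riesz-Fischer: Fatou's lemma along a fast subsequence bounds the distance
    of the sequence to the limit of [L2_fast_limit]. *)
Theorem L2_complete V D (f : nat -> R -> V) : measurable D ->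
  (forall n, L2_on D (f n)) ->
  (forall e, 0 < e -> exists N, forall m n, (N <= m)%N -> (N <= n)%N ->
     sqint D (fun t => f m t - f n t) < e) ->
  exists2 g, L2_on D g & forall e, 0 < e -> exists N, forall n, (N <= n)%N ->
     sqint D (fun t => f n t - g t) <= e.
Proof.
move=> mD f2 cf.
have /choice[K hK] : forall k, exists N, forall m n, (N <= m)%N -> (N <= n)%N ->
     sqint D (fun t => f m t - f n t) < 8^-1 ^+ k.
  by move=> k; apply: cf; rewrite exprn_gt0 // invr_gt0.
pose nk k := (\sum_(0 <= j < k.+1) K j + k)%N.
have nkK k : (K k <= nk k)%N by rewrite /nk big_nat_recr //= -addnA addnCA leq_addr.
have nkS k : (nk k <= nk k.+1)%N.
  by rewrite {2}/nk big_nat_recr //= -addnA leq_add2l addnS ltnW // ltnS leq_addl.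
have [g [mg gae]] : exists g, smeas D g /\
    \forall t \ae mu, D t -> f (nk k) t @[k --> \oo] --> g t.
  apply: (@L2_fast_limit V D (fun k => f (nk k))) => // k.
  by apply/ltW/hK; [exact: leq_trans (nkK k) (nkS k)|exact: nkK].
(* Fatou's lemma, along the subsequence nk *)
have key e N : (forall m n, (N <= m)%N -> (N <= n)%N ->
     sqint D (fun t => f m t - f n t) <= e) -> forall n, (N <= n)%N ->
     (\int[mu]_(t in D) (rnorm (f n t - g t) ^+ 2)%:E <= e%:E)%E.
  move=> hN n Nn.
  pose u k t := (rnorm (f n t - f (nk k) t) ^+ 2)%:E.
  have mu_ k : measurable_fun D (u k).
    apply/measurable_EFinP; apply: smeas_rnorm2 => //.
    by apply: smeasB; apply: L2_smeas.
  have u0 k t : (0 <= u k t)%E by rewrite lee_fin sqr_ge0.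
  apply: (@le_trans _ _ (\int[mu]_(t in D) limn_einf (u ^~ t))%E).
    apply: ae_ge0_le_integral => //.
    - by move=> t _; rewrite lee_fin sqr_ge0.
    - apply/measurable_EFinP; apply: smeas_rnorm2 => //; apply: smeasB => //.
      exact: L2_smeas.
    - by move=> t _; apply: limn_einf_ge.
    - under eq_fun => t do rewrite -[limn_einf _]oppeK -limn_esupN.
      apply: measurableT_comp => //; apply: measurable_fun_limn_esup => k.
      by apply: (measurableT_comp (f := oppe)) => //; exact: mu_.
    apply: ae_imply gae => t h Dt.
    have : u k t @[k --> \oo] --> (rnorm (f n t - g t) ^+ 2)%:E.
      apply: cvg_EFin; first exact: nearW.
      rewrite [X in X @ _ --> _](_ : _ = fun k => rnorm (f n t - f (nk k) t) ^+ 2) //.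
      under eq_fun do rewrite expr2; rewrite expr2.
      by apply: cvgM; apply: cvg_rnorm; apply: cvgB; [exact: cvg_cst|exact: h
        |exact: cvg_cst|exact: h].
    by move=> hu; rewrite is_cvg_limn_einfE ?(cvg_lim _ hu) //; apply/cvg_ex; eexists; exact: hu.
  apply: (le_trans (@fatou _ _ _ mu D mD u mu_ (fun k t _ => u0 k t))).
  apply: (@limn_einf_le _ _ N) => k Nk.
  rewrite sqintE // ?lee_fin; last exact: L2B.
  by apply: hN => //; apply: leq_trans Nk _; exact: leq_addl.
have gL2 : L2_on D g.
  have [N hN] := cf 1 ltr01.
  have h1 : L2_on D (fun t => f N t - g t).
    apply: L2_onI => //; first by apply: smeasB => //; exact: L2_smeas.
    apply/integrableP; split.
      apply/measurable_EFinP; apply: smeas_rnorm2 => //; apply: smeasB => //.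
      exact: L2_smeas.
    under eq_integral do rewrite /= ger0_norm ?sqr_ge0 //.
    apply: le_lt_trans (key 1 N _ N _) _ => //; last exact: ltry.
    by move=> m n Nm Nn; apply/ltW/hN.
  apply: L2_eq mD _ (L2B mD (f2 N) h1) => t _ /=.
  by rewrite opprB addrC subrK.
exists g => // e e0; have [N hN] := cf e e0; exists N => n Nn.
rewrite -lee_fin -sqintE //; last exact: L2B.
by apply: (key e N) => // m k Nm Nk; apply/ltW/hN.
Qed.

End Completeness.

(** * Translations and iterated integrals *)

Section Translation.
Context {R : realType}.
Local Notation mu := (@lebesgue_measure R).
Local Notation rint D f := (mu.-integrable D (EFin \o f)).
Implicit Types (D : set R) (h : R).

Definition shiftR h : measurableTypeR R -> measurableTypeR R := fun t => t + h.

Lemma measurable_shift h : measurable_fun setT (shiftR h).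
Proof. by apply: measurable_funD => //; exact: measurable_cst. Qed.

Lemma measurable_shift_preimage h D : measurable D -> measurable (shiftR h @^-1` D).
Proof. by move=> mD; rewrite -[X in measurable X]setTI; apply: measurable_shift. Qed.

(** Translation invariance follows from uniqueness of Lebesgue measure, as the
    image measure has the same values on half-open intervals. *)
Lemma lebesgue_shift h D : measurable D -> pushforward mu (shiftR h) D = mu D.
Proof.
move=> mD; apply/esym.
pose mh_mixin := isMeasurableFun.Build _ _ _ _ _ (measurable_shift h).
pose F : {mfun measurableTypeR R >-> measurableTypeR R} := HB.pack (shiftR h) mh_mixin.
apply: (@lebesgue_measure_unique R (pushforward mu F)) => //= _ [[a b]] _ <-.
rewrite /pushforward /=.
have -> : shiftR h @^-1` `]a, b]%classic = `]a - h, b - h]%classic.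
  by apply/seteqP; split=> t /=; rewrite /shiftR !in_itv /= ltrBlDr lerBrDr.
rewrite !lebesgue_measure_itv /= !lte_fin ltrBlDr subrK.
by case: ifP => // _; congr (_%:E); ring.
Qed.

Lemma ge0_integral_shift h D (f : R -> \bar R) : measurable D -> measurable_fun D f ->
  (forall t, D t -> (0 <= f t)%E) ->
  (\int[mu]_(t in shiftR h @^-1` D) f (t + h)%R = \int[mu]_(t in D) f t)%E.
Proof.
move=> mD mf f0.
have := @ge0_integral_pushforward _ _ (measurableTypeR R) (measurableTypeR R) R
  (shiftR h) (measurable_shift h) mu D f mD mf.
move=> E; rewrite [LHS](_ : _ =
   (\int[mu]_(x in shiftR h @^-1` D) (f \o shiftR h) x)%E) // -E.
  apply: eq_measure_integral => [|mh A mA _]; first exact: measurable_shift.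
  exact: (lebesgue_shift h mA).
by move=> y; rewrite inE; exact: f0.
Qed.

Lemma rint_shift h D (f : R -> R) : measurable D -> rint D f ->
  rint (shiftR h @^-1` D) (fun t => f (t + h)).
Proof.
move=> mD /integrableP[mf fi]; apply/integrableP; split.
  apply/measurable_EFinP.
  move/measurable_EFinP : mf => mf.
  apply: (@measurable_comp _ _ _ _ _ _ D f _ (shiftR h)) => //.
    by move=> _ [t Dt <-].
  exact: measurable_funS (measurable_shift h).
have := @ge0_integral_shift h D (fun t => `|(f t)%:E|%E) mD.
by move=> -> //; exact: measurableT_comp.
Qed.

Lemma Rintegral_shift h D (f : R -> R) : measurable D -> rint D f ->
  \int[mu]_(t in shiftR h @^-1` D) f (t + h) = \int[mu]_(t in D) f t.
Proof.
move=> mD fi.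
have mf : measurable_fun D (EFin \o f) by case/integrableP : fi.
rewrite /Rintegral integralE [in RHS]integralE; congr fine; congr (_ - _)%E.
  rewrite -(ge0_integral_shift h mD (measurable_funepos mf) (fun t _ => funepos_ge0 _ t)).
  by apply: eq_integral => t _; rewrite !funeposE.
rewrite -(ge0_integral_shift h mD (measurable_funeneg mf) (fun t _ => funeneg_ge0 _ t)).
  by apply: eq_integral => t _; rewrite !funenegE.
Qed.

Lemma shift_itvcc h a b : shiftR h @^-1` `[a, b]%classic = `[a - h, b - h]%classic.
Proof. by apply/seteqP; split=> t /=; rewrite /shiftR !in_itv /= lerBlDr lerBrDr. Qed.

Lemma rint_itvB (f : R -> R) (a b c : R) : a <= b <= c -> rint `[a, c] f ->
  \int[mu]_(t in `[b, c]) f t = \int[mu]_(t in `[a, c]) f t - \int[mu]_(t in `[a, b]) f t.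
Proof.
move=> /andP[ab bc] fi; rewrite Rintegral_itvB //.
rewrite Rintegral_itv_obnd_cbnd //.
apply: rint_sub fi => //.
by apply: subset_itv; rewrite bnd_simp.
Qed.

Lemma itv_measure_fin (a b : R) : (mu `[a, b]%classic < +oo)%E.
Proof. by rewrite lebesgue_measure_itv /=; case: ifP => _; rewrite -?EFinD ?ltry. Qed.

Lemma itv_measure_fine (a b : R) : a <= b -> fine (mu `[a, b]%classic) = b - a.
Proof.
rewrite lebesgue_measure_itv /= lte_fin le_eqVlt => /predU1P[->|->] //.
by rewrite ltxx subrr.
Qed.

Lemma Rintegral_itv_cst (a b c : R) : a <= b ->
  \int[mu]_(t in `[a, b]) c = c * (b - a).
Proof. by move=> ab; rewrite Rintegral_cst // itv_measure_fine. Qed.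

Lemma subset_itvcc (a b c d : R) : a <= c -> d <= b -> `[c, d] `<=` `[a, b].
Proof. by move=> ac db; apply: subset_itv; rewrite bnd_simp. Qed.

Lemma tonelli_rect (A B : set R) (G : R -> R -> R) : measurable A -> measurable B ->
  (forall t s, 0 <= G t s) ->
  measurable_fun setT (fun p : measurableTypeR R * measurableTypeR R => G p.1 p.2) ->
  (\int[mu]_(t in A) \int[mu]_(s in B) (G t s)%:E =
   \int[mu]_(s in B) \int[mu]_(t in A) (G t s)%:E)%E.
Proof.
move=> mA mB G0 mG.
pose f (p : measurableTypeR R * measurableTypeR R) : \bar R :=
  (G p.1 p.2 * \1_A p.1 * \1_B p.2)%:E.
have mI (E : set R) : measurable E ->
    measurable_fun [set: measurableTypeR R] (\1_E : measurableTypeR R -> R).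
  by move=> mE; apply: measurable_indic.
have mf : measurable_fun setT f.
  apply/measurable_EFinP; apply: measurable_funM; first apply: measurable_funM => //.
    exact: (measurableT_comp (mI A mA) measurable_fst).
  exact: (measurableT_comp (mI B mB) measurable_snd).
have f0 p : (0 <= f p)%E by rewrite lee_fin !mulr_ge0 // indicE ler0n.
have := @fubini_tonelli _ _ _ _ R mu mu f mf f0.
have E1 : (\int[mu]_x \int[mu]_y f (x, y) =
    \int[mu]_(t in A) \int[mu]_(s in B) (G t s)%:E)%E.
  rewrite [RHS]integral_mkcond; apply: eq_integral => t _; rewrite /patch.
  case: ifPn => tA; last first.
    rewrite (eq_integral (cst 0%E)) ?integral0 // => s _.
    by rewrite /f /= indicE (negbTE tA) mulr0 mul0r.
  rewrite [RHS]integral_mkcond; apply: eq_integral => s _; rewrite /patch /f /= !indicE tA mulr1.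
  by case: ifPn => _; rewrite ?mulr1 ?mulr0.
have E2 : (\int[mu]_y \int[mu]_x f (x, y) =
    \int[mu]_(s in B) \int[mu]_(t in A) (G t s)%:E)%E.
  rewrite [RHS]integral_mkcond; apply: eq_integral => s _; rewrite /patch.
  case: ifPn => sB; last first.
    rewrite (eq_integral (cst 0%E)) ?integral0 // => t _.
    by rewrite /f /= [\1_B _]indicE (negbTE sB) mulr0.
  rewrite [RHS]integral_mkcond; apply: eq_integral => t _; rewrite /patch /f /= !indicE sB mulr1.
  by case: ifPn => _; rewrite ?mulr1 ?mulr0.
by rewrite E1 E2.
Qed.

End Translation.

(** * The Bochner integral *)

Section Bochner.
Context {R : realType}.
Local Notation mu := (@lebesgue_measure R).
Local Notation rint D f := (mu.-integrable D (EFin \o f)).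
Implicit Types (V : hilbertType R) (D : set R).

(** The integral tested against vectors.  It agrees with the Bochner integral
    for strongly measurable integrable functions, and reduces linear properties
    of that integral to those of real integrals. *)
Definition weak_int V D (f : R -> V) (v : V) : Prop :=
  forall z, rdot v z = \int[mu]_(t in D) rdot (f t) z.

Lemma rint_sum (I : Type) (r : seq I) D (F : I -> R -> R) : measurable D ->
  (forall i, rint D (F i)) ->
  rint D (fun t => \sum_(i <- r) F i t) /\
  \int[mu]_(t in D) (\sum_(i <- r) F i t) = \sum_(i <- r) \int[mu]_(t in D) F i t.
Proof.
move=> mD Fi; elim: r => [|i r [IH1 IH2]].
  under eq_fun do rewrite big_nil.
  rewrite big_nil; split; first exact: (@integrable0 _ _ _ mu D).
  by rewrite Rintegral_cst // mul0r.
have E : (fun t => \sum_(j <- i :: r) F j t) = (fun t => F i t + \sum_(j <- r) F j t).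
  by apply/funext => t; rewrite big_cons.
rewrite E; split; first exact: rintD.
by rewrite RintegralD // IH2 big_cons.
Qed.

(** Homogeneity is over the real numbers, since the functionals of interest are
    real parts. *)
Definition real_linear V (l : V -> R) : Prop :=
  [/\ forall x y, l (x + y) = l x + l y, forall a x, l (a%:C *: x) = a * l x
    & exists C, forall x, `|l x| <= C * rnorm x].

Lemma real_linear_rdot V (z : V) : real_linear (fun x => rdot x z).
Proof.
split=> [x y|a x|]; [exact: rdotDl|exact: rdotZl|exists (rnorm z) => x].
by rewrite mulrC; exact: rdot_le.
Qed.

Lemma real_linearB V (l : V -> R) x y : real_linear l -> l (x - y) = l x - l y.
Proof.
move=> [lD lZ _]; have := lZ (-1) y; rewrite rmorphN1 scaleN1r mulN1r => lN.
by rewrite lD lN.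
Qed.

Lemma sfun_bounded V (s : R -> V) : sfun s ->
  exists M, forall t, rnorm (s t) <= M.
Proof.
move=> [/finite_seqP[L hL] _].
exists (\sum_(v <- L) rnorm v) => t.
have : s t \in L by have : [set` L] (s t) by rewrite -hL; exists t.
elim: L {hL} => // v L IH; rewrite inE big_cons => /orP[/eqP ->|/IH h].
  by rewrite lerDl sumr_ge0 // => i _; exact: rnorm_ge0.
by apply: le_trans h _; rewrite lerDr rnorm_ge0.
Qed.

Lemma sfun_rint V D (s : R -> V) : measurable D -> (mu D < +oo)%E ->
  sfun s -> rint D (fun t => rnorm (s t)).
Proof.
move=> mD fD ss; have [M hM] := sfun_bounded ss.
apply: (rint_le mD _ (rint_cst M mD fD)); first by apply: smeas_rnorm => //; exact: smeas_sfun.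
by move=> t _; rewrite ger0_norm // rnorm_ge0.
Qed.

Lemma linear_rint V D (f : R -> V) (l : V -> R) : measurable D -> real_linear l ->
  smeas D f -> rint D (fun t => rnorm (f t)) ->
  rint D (fun t => l (f t)).
Proof.
move=> mD ll mf fi; have [lD lZ [C hC]] := ll.
apply: (rint_le mD _ (rintZ C mD fi)); last by move=> t _; exact: hC.
apply: (smeas_real (G := fun x _ => l x) mD _ mf mf) => u _ a _ /cvg_rnorm0 ua _.
apply/cvgrPdistC_lt => e e0.
have C0 : 0 < `|C| + 1 by have := normr_ge0 C; lra.
have /cvgrPdistC_lt/(_ _ (divr_gt0 e0 C0)) := ua.
apply: filterS => n; rewrite subr0 ger0_norm ?rnorm_ge0 // ltr_pdivlMr //.
rewrite -real_linearB // => h; apply: le_lt_trans (hC _) _.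
have := rnorm_ge0 (u n - a); have := ler_norm C; nra.
Qed.

Lemma simple_integral_lin V D (s : R -> V) (l : V -> R) : measurable D ->
  (mu D < +oo)%E -> sfun s -> real_linear l ->
  l (simple_integral D s) = \int[mu]_(t in D) l (s t).
Proof.
move=> mD fD ss ll; have [lD lZ _] := ll; have [fs ms] := ss.
have [L0 hL0] : exists L : seq V, range s = [set` L] by apply/finite_seqP.
pose L := undup L0.
have hL : range s = [set` L] by rewrite hL0; apply/seteqP; split=> x /=; rewrite mem_undup.
rewrite /simple_integral hL -fsbig_seq ?undup_uniq //.
have l0 : l 0 = 0 by have := lZ 0 0; rewrite scaler0 mul0r.
rewrite (big_morph l lD l0).
under eq_bigr do rewrite lZ.
have sE t : l (s t) = \sum_(v <- L) (\1_(s @^-1` [set v]) t * l v).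
  rewrite (bigD1_seq (s t)) ?undup_uniq //=; last by have : [set` L] (s t) by rewrite -hL; exists t.
  rewrite big1 ?addr0 => [|v /eqP vs]; last first.
    by rewrite indicE memNset ?mul0r //= => sv; apply: vs.
  by rewrite indicE mem_set ?mul1r.
under eq_Rintegral do rewrite sE.
have ii v : rint D (fun t => \1_(s @^-1` [set v]) t * l v).
  apply: (rint_le mD _ (rint_cst `|l v| mD fD)).
    by apply: measurable_funM; [apply: measurable_indic; exact: ms|exact: measurable_cst].
  move=> t _; rewrite normrM ler_piMl // indicE; case: (_ \in _) => /=; rewrite ?normr1 ?normr0 //.
have [_ ->] := rint_sum L mD ii.
apply: eq_bigr => v _; rewrite RintegralZr //.
  congr (_ * _); rewrite /Rintegral (@integral_indic _ _ _ mu D mD (s @^-1` [set v]) (ms v)).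
  by congr (fine (mu _)); exact: setIC.
apply: (rint_le mD _ (rint_cst 1 mD fD)); first by apply: measurable_indic; exact: ms.
by move=> t _; rewrite indicE; case: (_ \in _) => /=; rewrite ?normr1 ?normr0.
Qed.

(** Dominated convergence: the approximations of [smeas_approx] have errors
    bounded by the norm of f. *)
Lemma simple_approx V D (f : R -> V) : measurable D -> (mu D < +oo)%E ->
  smeas D f -> rint D (fun t => rnorm (f t)) ->
  exists s : nat -> R -> V, [/\ forall n, sfun (s n),
    forall n, rint D (fun t => rnorm (f t - s n t)) &
    (\int[mu]_(t in D) (rnorm (f t - s n t))%:E @[n --> \oo] --> 0)%E].
Proof.
move=> mD fD mf fi; have [s [ss sf sle]] := smeas_approx mD mf.
have mfs n : measurable_fun D (fun t => rnorm (f t - s n t)).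
  by apply: smeas_rnorm => //; apply: smeasB => //; exact: smeas_sfun.
exists s; split=> // [n|].
  by apply: (rint_le mD _ fi) => // t Dt; rewrite ger0_norm ?rnorm_ge0 // sle.
have := @dominated_convergence _ _ R mu D mD (fun n t => (rnorm (f t - s n t))%:E)
   (cst 0%E) (fun t => (rnorm (f t))%:E).
case=> //.
- by move=> n; apply/measurable_EFinP; exact: mfs.
- apply: ae_of_all => t Dt; apply: cvg_EFin; first exact: nearW.
  rewrite [X in X @ _ --> _](_ : _ = fun n => rnorm (f t - s n t)) //.
  have := sf t Dt => /cvg_rnorm0.
  by under eq_fun do rewrite rnormB.
- apply: ae_of_all => t n Dt; rewrite lee_fin.
  by rewrite ger0_norm ?rnorm_ge0 // sle.
move=> _ _; rewrite integral0 => h; exact: h.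
Qed.

(** Test with the difference v - w itself. *)
Lemma weak_int_dist_le V D (f g : R -> V) (v w : V) : measurable D ->
  smeas D f -> smeas D g ->
  rint D (fun t => rnorm (f t)) -> rint D (fun t => rnorm (g t)) ->
  weak_int D f v -> weak_int D g w ->
  rnorm (v - w) <= \int[mu]_(t in D) rnorm (f t - g t).
Proof.
move=> mD mf mg fi gi fv gw.
have di : rint D (fun t => rnorm (f t - g t)).
  apply: (rint_le mD _ (rintD mD fi gi)).
    by apply: smeas_rnorm => //; apply: smeasB.
  by move=> t _; rewrite ger0_norm ?rnorm_ge0 // rnormB_le.
apply: rdot_bound => [|z]; first by apply: Rintegral_ge0 => t _; exact: rnorm_ge0.
rewrite rdotBl fv gw -RintegralB //; try by apply: (linear_rint (l := fun x => rdot x z)) => //;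
  exact: real_linear_rdot.
rewrite -RintegralZr //; apply: le_Rintegral => //.
- apply: (rint_le mD _ (rintZ (rnorm z) mD di)).
    by apply: measurable_funB; apply: smeas_rdot => //; exact: smeas_cst.
  move=> t _; rewrite -rdotBl mulrC; exact: rdot_le.
- by under eq_fun do rewrite mulrC; exact: rintZ.
by move=> t _; rewrite -rdotBl; apply: le_trans (ler_norm _) (rdot_le _ _).
Qed.

Lemma simple_weak_int V D (s : R -> V) : measurable D -> (mu D < +oo)%E ->
  sfun s -> weak_int D s (simple_integral D s).
Proof. by move=> mD fD ss z; apply: (simple_integral_lin mD fD ss (real_linear_rdot z)). Qed.

Lemma weak_int_bochner V D (f : R -> V) (v : V) : measurable D -> (mu D < +oo)%E ->
  smeas D f -> rint D (fun t => rnorm (f t)) ->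
  weak_int D f v -> is_bochner_integral D f v.
Proof.
move=> mD fD mf fi fv; split=> //.
have [s [ss di sf]] := simple_approx mD fD mf fi; exists s; split=> //.
apply/cvg_rnorm0/(@squeeze_cvgr _ _ _ _ (cst 0) (fun n => \int[mu]_(t in D) rnorm (f t - s n t))).
- apply: nearW => n; rewrite rnorm_ge0 /= rnormB.
  exact: (weak_int_dist_le mD mf (smeas_sfun _ (ss n)) fi (sfun_rint mD fD (ss n)) fv
    (simple_weak_int mD fD (ss n))).
- exact: cvg_cst.
- exact: (@fine_cvg _ _ _ _ _ 0 sf).
Qed.

(** This is what moves a bounded operator under the integral sign: l will be an
    inner product composed with such an operator. *)
Lemma bochner_lin V D (f : R -> V) (v : V) (l : V -> R) : measurable D ->
  (mu D < +oo)%E -> real_linear l -> is_bochner_integral D f v ->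
  rint D (fun t => rnorm (f t)) /\ l v = \int[mu]_(t in D) l (f t).
Proof.
move=> mD fD ll [mf [s [ss sf sv]]].
have ms n : smeas D (s n) by apply/smeas_sfun/ss.
have mfs n : measurable_fun D (fun t => rnorm (f t - s n t)).
  by apply: smeas_rnorm => //; apply: smeasB.
have : \forall n \near \oo, (\int[mu]_(t in D) (rnorm (f t - s n t))%:E < 1)%E.
  exact: (sf _ (@nbhs_open_ereal_lt R 0 (cst 1) ltr01)).
move=> [N _ hN].
have di n : (N <= n)%N -> rint D (fun t => rnorm (f t - s n t)).
  move=> Nn; apply/integrableP; split; first by apply/measurable_EFinP; exact: (mfs n).
  under eq_integral do rewrite /= ger0_norm ?rnorm_ge0 //.
  by apply: lt_le_trans (hN n Nn) _; rewrite leey.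
have si n : rint D (fun t => rnorm (s n t)) by exact: (sfun_rint mD fD (ss n)).
have fi : rint D (fun t => rnorm (f t)).
  apply: (rint_le mD _ (rintD mD (di N (leqnn _)) (si N))); first exact: smeas_rnorm.
  move=> t _; rewrite ger0_norm ?rnorm_ge0 //.
  by have := rnormD_le (f t - s N t) (s N t); rewrite subrK.
split=> //; have [lD lZ [C hC]] := ll.
have C0 : 0 < `|C| + 1 by have := normr_ge0 C; lra.
apply/eqP; rewrite -subr_eq0 -normr_eq0 eq_le normr_ge0 andbT.
apply/ler_addgt0Pl => e e0; rewrite addr0.
have e1 : 0 < e / (`|C| + 1) / 2 by rewrite !divr_gt0.
have : \forall n \near \oo, (\int[mu]_(t in D) (rnorm (f t - s n t))%:E < (e / (`|C| + 1) /
  2)%:E)%E.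
  exact: (sf _ (@nbhs_open_ereal_lt R 0 (cst _) e1)).
have /cvg_rnormP/(_ _ e1) := sv.
move=> [N1 _ hN1] [N2 _ hN2].
pose n := (N + N1 + N2)%N.
have /= h1 := hN1 n (leq_trans (leq_addl _ _) (leq_addr _ _)).
have /= := hN2 n (leq_addl _ _).
have Nn : (N <= n)%N by rewrite /n -addnA leq_addr.
rewrite rint_fin ?lte_fin //; last exact: di.
move=> h2.
have -> : l v - \int[mu]_(t in D) l (f t) =
   l (v - simple_integral D (s n)) - \int[mu]_(t in D) l (f t - s n t).
  under [in RHS]eq_Rintegral do rewrite real_linearB //.
  rewrite RintegralB //; try by apply: linear_rint.
  rewrite real_linearB // (simple_integral_lin mD fD (ss n) ll); lra.
have h3 : `|l (v - simple_integral D (s n))| <= (`|C| + 1) * (e / (`|C| + 1) / 2).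
  apply: le_trans (hC _) _; rewrite rnormB; have := ler_norm C.
  have := rnorm_ge0 (simple_integral D (s n) - v); nra.
have h4 : `|\int[mu]_(t in D) l (f t - s n t)| <= (`|C| + 1) * (e / (`|C| + 1) / 2).
  have li : rint D (fun t => l (f t - s n t)).
    by apply: linear_rint => //; [exact: smeasB|exact: di].
  have le1 := @le_normr_Rintegral _ _ _ mu D _ mD li; apply: (le_trans le1).
  have le2 : \int[mu]_(t in D) `|l (f t - s n t)| <=
      \int[mu]_(t in D) ((`|C| + 1) * rnorm (f t - s n t)).
    apply: le_Rintegral => //; [exact: integrable_norm li|exact/rintZ/di|].
    move=> t _; apply: le_trans (hC _) _; have := ler_norm C; have := rnorm_ge0 (f t - s n t); nra.
  apply: (le_trans le2); rewrite RintegralZl //; last exact: di.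
  by rewrite ler_pM2l // ltW.
apply: le_trans (ler_normB _ _) _; apply: le_trans (lerD h3 h4) _.
rewrite le_eqVlt; apply/orP; left; apply/eqP; field; exact: lt0r_neq0.
Qed.

Lemma bochner_weak_int V D (f : R -> V) (v : V) : measurable D -> (mu D < +oo)%E ->
  is_bochner_integral D f v -> weak_int D f v.
Proof. by move=> mD fD fv z; have [] := bochner_lin mD fD (real_linear_rdot z) fv. Qed.

(** The integrals of the approximations of [simple_approx] form a Cauchy
    sequence. *)
Lemma weak_int_exists V D (f : R -> V) : measurable D -> (mu D < +oo)%E ->
  smeas D f -> rint D (fun t => rnorm (f t)) ->
  exists v, weak_int D f v.
Proof.
move=> mD fD mf fi; have [s [ss di sf]] := simple_approx mD fD mf fi.
pose I n := simple_integral D (s n); pose d n := \int[mu]_(t in D) rnorm (f t - s n t).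
have d_cvg : d @ \oo --> (0 : R) by exact: (@fine_cvg _ _ _ _ _ 0 sf).
have ms n : smeas D (s n) by apply/smeas_sfun/ss.
have Ile m n : rnorm (I m - I n) <= d m + d n.
  apply: le_trans (weak_int_dist_le mD (ms m) (ms n) _ _ (simple_weak_int mD fD (ss m))
    (simple_weak_int mD fD (ss n))) _; try exact: sfun_rint.
  rewrite /d -RintegralD //; apply: le_Rintegral => //.
  - apply: (rint_le mD _ (rintD mD (di m) (di n))).
      by apply: smeas_rnorm => //; exact: smeasB.
    move=> t _; rewrite ger0_norm ?rnorm_ge0 //.
    by apply: le_trans (rnorm_distD (f t) _ _) _; rewrite rnormB.
  - exact: rintD.
  by move=> t _; apply: le_trans (rnorm_distD (f t) _ _) _; rewrite rnormB.
have [v Iv] : exists v : V, I @ \oo --> v.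
  apply: rnorm_cauchy_cvg => e e0; have e2 : 0 < e / 2 by rewrite divr_gt0.
  have /cvgrPdistC_lt/(_ _ e2)[N _ hN] := d_cvg.
  exists N => m n Nm Nn; apply: le_lt_trans (Ile m n) _.
  have := hN m Nm; have := hN n Nn; rewrite /= !subr0 => h1 h2.
  have := ler_norm (d m); have := ler_norm (d n); lra.
exists v => z.
have : is_bochner_integral D f v by split=> //; exists s; split.
by move=> /(bochner_lin mD fD (real_linear_rdot z))[].
Qed.

Lemma weak_int_unique V D (f : R -> V) v w : weak_int D f v -> weak_int D f w -> v = w.
Proof. by move=> fv fw; apply: rdot_ext => z; rewrite fv fw. Qed.

Lemma L2_rint1 V D (f : R -> V) : measurable D -> (mu D < +oo)%E -> L2_on D f ->
  rint D (fun t => rnorm (f t)).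
Proof.
move=> mD fD f2.
apply: (rint_le mD _ (rintD mD (rint_cst 1 mD fD) (L2_rint mD f2))).
  by apply: smeas_rnorm => //; exact: L2_smeas.
move=> t _; rewrite ger0_norm ?rnorm_ge0 //.
have := sqr_ge0 (rnorm (f t) - 1); have := rnorm_ge0 (f t); nra.
Qed.

(** Young's inequality for f and the constant v, with parameter mu D. *)
Lemma weak_int_norm_sq V D (f : R -> V) v : measurable D -> (mu D < +oo)%E -> L2_on D f ->
  weak_int D f v -> rnorm v ^+ 2 <= fine (mu D) * sqint D f.
Proof.
move=> mD fD f2 fv.
have [D0|D0] := eqVneq (fine (mu D)) 0.
  rewrite D0 mul0r -rdotxx fv.
  have mu0 : mu D = 0%E by rewrite -(fineK (_ : mu D \is a fin_num)) ?D0 ?ge0_fin_numE.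
  rewrite /Rintegral null_set_integral //.
  have m := smeas_rdot mD (L2_smeas f2) (smeas_cst D v).
  by apply/measurable_EFinP; exact: m.
have d0 : 0 < fine (mu D) by rewrite lt0r D0 fine_ge0.
have := L2dot_young mD d0 f2 (L2_cst v mD fD).
rewrite /L2dot -fv rdotxx {2}/sqint Rintegral_cst // [X in _ + X](_ : _ = rnorm v ^+ 2).
  lra.
by rewrite mulrCA mulVf // mulr1.
Qed.

End Bochner.

(** * Primitives of square-integrable functions *)

Section Sobolev.
Context {R : realType}.
Local Notation mu := (@lebesgue_measure R).
Implicit Types (V : hilbertType R) (D : set R) (tau : R).

Lemma sqdist_eq V (x y : V) : (forall e : R, 0 < e -> rnorm (x - y) ^+ 2 <= e) -> x = y.
Proof.
move=> h; apply/eqP; rewrite -subr_eq0; apply/eqP/rnorm_eq0/eqP.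
rewrite -sqrf_eq0 eq_le sqr_ge0 andbT; apply/ler_addgt0Pl => e e0.
by rewrite addr0 h.
Qed.

Lemma sqint0_ae V D (f g : R -> V) : measurable D -> L2_on D f -> L2_on D g ->
  sqint D (fun t => f t - g t) = 0 -> \forall t \ae mu, D t -> f t = g t.
Proof.
move=> mD f2 g2 Q0; have d2 := L2B mD f2 g2.
have mf : measurable_fun D (fun t => (rnorm (f t - g t) ^+ 2)%:E).
  by apply/measurable_EFinP; exact: (smeas_rnorm2 mD (L2_smeas d2)).
have := (ae_eq_integral_abs mu mD mf).1.
under eq_integral do rewrite /= ger0_norm ?sqr_ge0 //.
rewrite (sqintE mD d2) Q0 => /(_ erefl); apply: ae_imply => t h Dt.
have /= [/eqP] := h Dt; rewrite sqrf_eq0 => /eqP/rnorm_eq0/eqP.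
by rewrite subr_eq0 => /eqP.
Qed.

(** The weak integral is preferred to the Bochner integral because convex
    combinations and limits of primitives are then immediate. *)
Definition is_primitive V (tau : R) (W g : R -> V) : Prop :=
  forall t, 0 <= t <= tau -> weak_int `[0, t] g (W t - W 0).

Lemma H1_onP V tau (u : R -> V) : H1_on tau u <->
  exists2 g, L2_on `[0, tau] g & is_primitive tau u g.
Proof.
split=> -[g g2 gu]; exists g => // t t0.
  by apply: bochner_weak_int => //; [exact: itv_measure_fin|exact: gu].
have /andP[t0' tt] := t0.
have g2' : L2_on `[0, t] g by apply: L2_sub g2 => //; exact: subset_itvcc.
apply: weak_int_bochner => //; first exact: itv_measure_fin.
- exact: L2_smeas.
- by apply: L2_rint1 => //; exact: itv_measure_fin.
- exact: gu.
Qed.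

Lemma weak_int_itvB V (f : R -> V) (a b c : R) v w : a <= b <= c -> L2_on `[a, c] f ->
  weak_int `[a, b] f v -> weak_int `[a, c] f w -> weak_int `[b, c] f (w - v).
Proof.
move=> abc f2 fv fw z; rewrite rdotBl fv fw (rint_itvB abc) //.
exact: rdot_rint f2 (L2_cst z _ (itv_measure_fin _ _)).
Qed.

Lemma primitive_itv V tau (W g : R -> V) a b : L2_on `[0, tau] g -> is_primitive tau W g ->
  0 <= a -> a <= b -> b <= tau -> weak_int `[a, b] g (W b - W a).
Proof.
move=> g2 Wg a0 ab bt.
have ha : weak_int `[0, a] g (W a - W 0) by apply: Wg; rewrite a0 (le_trans ab).
have hb : weak_int `[0, b] g (W b - W 0) by apply: Wg; rewrite bt (le_trans a0).
have := weak_int_itvB (introT andP (conj a0 ab)) (L2_sub _ _ _ g2) ha hb.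
by rewrite opprB addrA subrK; apply => //; exact: subset_itvcc.
Qed.

Lemma primitive_holder V tau (W g : R -> V) a b : L2_on `[0, tau] g -> is_primitive tau W g ->
  0 <= a -> a <= b -> b <= tau -> rnorm (W b - W a) ^+ 2 <= (b - a) * sqint `[a, b] g.
Proof.
move=> g2 Wg a0 ab bt; rewrite -itv_measure_fine //.
apply: weak_int_norm_sq (primitive_itv g2 Wg a0 ab bt) => //; first exact: itv_measure_fin.
by apply: L2_sub g2 => //; exact: subset_itvcc.
Qed.

Lemma primitive_holder_le V tau (W g : R -> V) a b : L2_on `[0, tau] g -> is_primitive tau W g ->
  0 <= a -> a <= b -> b <= tau -> rnorm (W b - W a) ^+ 2 <= (b - a) * sqint `[0, tau] g.
Proof.
move=> g2 Wg a0 ab bt; apply: le_trans (primitive_holder g2 Wg a0 ab bt) _.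
by rewrite ler_wpM2l ?subr_ge0 //; apply: sqint_sub g2 => //; exact: subset_itvcc.
Qed.

(** The step functions that sample f at the next point of the grid of mesh
    1/(n+1) converge to f, as that point lies to the right of the argument. *)
Lemma right_cvg_smeas (W : completeNormedModType R[i]) (f : R -> W) (T : R) :
  (forall t, 0 <= t < T -> forall e : R, 0 < e -> exists2 d : R, 0 < d &
     forall s, t <= s -> s < t + d -> s <= T -> rnorm (f s - f t) < e) ->
  smeas `[0, T] f.
Proof.
move=> hf.
pose p n (t : R) : R := (Num.truncn (t * n.+1%:R)).+1%:R / n.+1%:R.
pose s n t := if t \in `[0, T]%classic then f (Num.min T (p n t)) else 0.
have ple n t : 0 <= t -> t <= p n t <= t + n.+1%:R^-1.
  move=> t0; rewrite /p; have n0 : 0 < n.+1%:R :> R by rewrite ltr0n.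
  have := truncn_itv (mulr_ge0 t0 (ltW n0)).
  move=> /andP[h1 h2].
  rewrite ler_pdivlMr // (ltW h2) /= ler_pdivrMr // mulrDl mulVf ?gt_eqF //.
  by rewrite -natr1 lerD2r.
exists s; split=> [n|t].
  have fs : sfun (fun t => if t \in `[0, T]%classic then p n t else 0).
    have n0 : 0 < n.+1%:R :> R by rewrite ltr0n.
    split.
      apply: (@sub_finite_set _ _ ((fun k : nat => k%:R / n.+1%:R) @`
         `I_(Num.truncn (T * n.+1%:R)).+2)); last exact/finite_image/finite_II.
      move=> _ [t _ <-]; case: ifPn => [|_]; last by exists 0%N => //; rewrite mul0r.
      rewrite inE /= in_itv /= => /andP[t0 tT].
      exists (Num.truncn (t * n.+1%:R)).+1 => //=; rewrite !ltnS.
      by apply: le_truncn; rewrite ler_pM2r.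
    move=> v.
    have mp : measurable_fun setT (p n).
      apply: measurable_funM; last exact: measurable_cst.
      apply: nondecreasing_measurable => // x y xy; rewrite ler_nat ltnS.
      by apply: le_truncn; rewrite ler_pM2r.
    have : measurable_fun setT (fun t => if t \in `[0, T]%classic then p n t else 0).
      apply: measurable_fun_ifT => //.
      apply: (@measurable_fun_bool _ _ _ _ true).
      rewrite setTI (_ : _ @^-1` _ = `[0, T]%classic) //.
      by apply/seteqP; split=> x /= => [/set_mem//|h]; exact: mem_set.
    by move=> /(_ measurableT [set v] (measurable_set1 v)); rewrite setTI.
  have -> : s n = fun t => (fun b x => if b then f (Num.min T x) else 0)
      (t \in `[0, T]%classic) ((fun t => if t \in `[0, T]%classic then p n t else 0) t).
    by apply/funext => t; rewrite /s; case: ifP.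
  have fb : sfun (fun t : R => t \in `[0, T]%classic).
    rewrite (_ : (fun t => _) = (fun t => if t \in `[0, T]%classic then true else false)).
      by apply: sfun_if => //; exact: sfun_cst.
    by apply/funext => t; case: ifP.
  exact: (sfun_comp2 (fun b x => if b then f (Num.min T x) else 0) fb fs).
rewrite /= in_itv /= => /andP[t0 tT].
apply/cvg_rnormP => e e0; rewrite /s mem_set /= ?in_itv /= ?t0 ?tT //.
move: tT; rewrite le_eqVlt => /predU1P[tE|tT].
  exists 0%N => // n _ /=; have /andP[h _] := ple n t t0.
  by rewrite tE min_l ?subrr ?rnorm0 // -tE.
have [d d0 hd] := hf t (introT andP (conj t0 tT)) e e0.
have [N hN] : exists N : nat, d^-1 < N%:R.
  by exists (Num.truncn d^-1).+1; apply: truncnS_gt.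
exists N => // n /= Nn; have /andP[h1 h2] := ple n t t0.
apply: hd.
- by rewrite le_min (ltW tT).
- rewrite gt_min; apply/orP; right; apply: le_lt_trans h2 _; rewrite ltrD2l.
  rewrite invf_plt ?posrE ?ltr0n //; apply: lt_le_trans hN _.
  by rewrite ler_nat ltnW.
- by rewrite ge_min lexx.
Qed.

Lemma holder_smeas V tau (W : R -> V) (C : R) : 0 <= C ->
  (forall a b, 0 <= a -> a <= b -> b <= tau -> rnorm (W b - W a) ^+ 2 <= (b - a) * C) ->
  smeas `[0, tau] W.
Proof.
move=> C0 hW; apply: right_cvg_smeas => t /andP[t0 tT] e e0.
have C1 : 0 < C + 1 by lra.
exists (e ^+ 2 / (C + 1)); first by rewrite divr_gt0 ?exprn_gt0.
move=> s ts std sT; rewrite -(ltr_pXn2r (_ : (0 < 2)%N)) ?nnegrE ?rnorm_ge0 ?ltW //.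
apply: le_lt_trans (hW t s t0 ts sT) _.
have : s - t < e ^+ 2 / (C + 1) by lra.
rewrite ltr_pdivlMr // => h; apply: le_lt_trans h; rewrite ler_wpM2l ?subr_ge0 //; lra.
Qed.

Lemma bounded_L2 V tau (W : R -> V) (M : R) : smeas `[0, tau] W ->
  (forall t, 0 <= t <= tau -> rnorm (W t) <= M) -> L2_on `[0, tau] W.
Proof.
move=> mW hW; apply: (L2_le (h := fun=> M ^+ 2)) => //.
  by apply: rint_cst => //; exact: itv_measure_fin.
move=> t; rewrite /= in_itv /= => /hW h.
by rewrite ler_pXn2r ?nnegrE ?rnorm_ge0 // (le_trans (rnorm_ge0 _) h).
Qed.

Lemma primitive_L2 V tau (W g : R -> V) : L2_on `[0, tau] g -> is_primitive tau W g ->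
  L2_on `[0, tau] W.
Proof.
move=> g2 Wg; have Q0 := sqint_ge0 `[0, tau]%classic g.
apply: (bounded_L2 (M := rnorm (W 0) + (1 + tau * sqint `[0, tau] g))).
  by apply: (holder_smeas Q0) => a b; exact: (primitive_holder_le g2 Wg).
move=> t /andP[t0 tt]; have := primitive_holder_le g2 Wg (lexx 0) t0 tt.
rewrite subr0 => h; have := rnormD_le (W 0) (W t - W 0); rewrite addrC subrK => h1.
have : t * sqint `[0, tau] g <= tau * sqint `[0, tau] g by rewrite ler_wpM2r.
have := sqr_ge0 (rnorm (W t - W 0) - 1); have := rnorm_ge0 (W t - W 0); nra.
Qed.

(** The derivative is a closed operator, and here a bounded sequence of
    derivatives is enough: elements of nearly minimal norm among the
    derivatives of functions close to w form a Cauchy sequence by the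
    parallelogram law. *)
Lemma H1_closure V tau (w : R -> V) (C : R) : 0 < tau -> L2_on `[0, tau] w ->
  (forall e, 0 < e -> exists W g, [/\ L2_on `[0, tau] g, is_primitive tau W g,
     sqint `[0, tau] (fun t => W t - w t) <= e & sqint `[0, tau] g <= C]) ->
  exists2 W, H1_on tau W & \forall t \ae mu, `[0, tau]%classic t -> w t = W t.
Proof.
move=> tau0 w2 hw; set D : set R := `[0, tau]%classic.
have mD : measurable D by exact: measurable_itv.
pose P (e : R) : set R := [set q | exists W g, [/\ L2_on D g, is_primitive tau W g,
  sqint D (fun t => W t - w t) <= e & q = sqint D g]].
have P0 e : 0 < e -> has_inf (P e).
  move=> e0; split; last by exists 0 => _ [W [g [_ _ _ ->]]]; exact: sqint_ge0.
  by have [W [g [g2 Wg We gC]]] := hw e e0; exists (sqint D g), W, g.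
pose d n := inf (P n.+1%:R^-1).
have n0 n : 0 < n.+1%:R^-1 :> R by rewrite invr_gt0 ltr0n.
have dC n : d n <= C.
  have [W [g [g2 Wg We gC]]] := hw _ (n0 n); apply: le_trans gC.
  by apply: ge_inf; [case: (P0 _ (n0 n))|exists W, g].
have d_mono m n : (m <= n)%N -> d m <= d n.
  move=> mn; apply: lb_le_inf; first by case: (P0 _ (n0 n)).
  move=> _ [W [g [g2 Wg We ->]]]; apply: ge_inf; first by case: (P0 _ (n0 m)).
  exists W, g; split=> //; apply: le_trans We _.
  by rewrite lef_pV2 ?posrE ?ltr0n // ler_nat ltnS.
have /choice[Wg hWg] : forall n, exists Wg : (R -> V) * (R -> V),
    [/\ L2_on D Wg.2, is_primitive tau Wg.1 Wg.2, sqint D (fun t => Wg.1 t - w t) <= n.+1%:R^-1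
      & sqint D Wg.2 < d n + n.+1%:R^-1].
  move=> n; have [_ [W [g [g2 Wg We ->]]] h] := inf_adherent (n0 n) (P0 _ (n0 n)).
  by exists (W, g).
pose W n := (Wg n).1; pose g n := (Wg n).2.
have g2 n : L2_on D (g n) by case: (hWg n).
have Wgp n : is_primitive tau (W n) (g n) by case: (hWg n).
have Ww n : sqint D (fun t => W n t - w t) <= n.+1%:R^-1 by case: (hWg n).
have gd n : sqint D (g n) < d n + n.+1%:R^-1 by case: (hWg n).
have W2 n : L2_on D (W n) by exact: primitive_L2 (g2 n) (Wgp n).
(* The midpoint of two near-minimizers competes in the infimum d m. *)
have key m n : (m <= n)%N ->
    sqint D (fun t => g m t - g n t) <= 2 * (d n - d m) + 4 * m.+1%:R^-1.
  move=> mn.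
  pose gg t := (2^-1 : R)%:C *: (g m t + g n t).
  pose WW t := (2^-1 : R)%:C *: (W m t + W n t).
  have gs2 := L2D mD (g2 m) (g2 n).
  have hmid : d m <= sqint D gg.
    apply: ge_inf; first by case: (P0 _ (n0 m)).
    exists WW, gg; split=> //; first exact: L2Z.
      move=> t t0 z; rewrite /WW -scalerBr rdotZl opprD addrACA rdotDl.
      rewrite (Wgp m t t0 z) (Wgp n t t0 z).
      have sub : `[0, t]%classic `<=` D by case/andP: t0 => _ tt; exact: subset_itvcc.
      have i1 := rdot_rint (measurable_itv `[0, t]) (L2_sub mD _ sub (g2 m))
                    (L2_cst z (measurable_itv `[0, t]) (itv_measure_fin 0 t)).
      have i2 := rdot_rint (measurable_itv `[0, t]) (L2_sub mD _ sub (g2 n))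
                    (L2_cst z (measurable_itv `[0, t]) (itv_measure_fin 0 t)).
      rewrite -RintegralD //; [|exact: i1|exact: i2].
      rewrite -RintegralZl //; last by apply: rintD => //; [exact: i1|exact: i2].
      by apply: eq_Rintegral => s _; rewrite rdotZl rdotDl.
    have -> : sqint D (fun t => WW t - w t) =
       4^-1 * sqint D (fun t => (W m t - w t) + (W n t - w t)).
      rewrite (_ : 4^-1 = (2^-1) ^+ 2); last by field.
      rewrite -sqintZ //; last by apply: L2D => //; apply: L2B.
      by apply: sqint_eq => t _; rewrite /WW; vlin.
    have := sqintD_le mD (L2B mD (W2 m) w2) (L2B mD (W2 n) w2).
    have : n.+1%:R^-1 <= m.+1%:R^-1 :> R.
      by rewrite lef_pV2 ?posrE ?ltr0n // ler_nat ltnS.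
    have := Ww m; have := Ww n; move: (n.+1%:R^-1 : R) (m.+1%:R^-1 : R) => b a; lra.
  have : sqint D (fun t => g m t - g n t) = 2 * sqint D (g m) + 2 * sqint D (g n) - 4 * sqint D gg.
    by rewrite (sqintB mD (g2 m) (g2 n)) /gg (sqintZ _ mD gs2) (sqintD mD (g2 m) (g2 n)); field.
  have := gd m; have := gd n.
  have : n.+1%:R^-1 <= m.+1%:R^-1 :> R.
    by rewrite lef_pV2 ?posrE ?ltr0n // ler_nat ltnS.
  have := d_mono _ _ mn; move: (n.+1%:R^-1 : R) (m.+1%:R^-1 : R) => b a; lra.
have d_cauchy e : 0 < e -> exists N, forall m n, (N <= m)%N -> (m <= n)%N -> d n - d m < e.
  move=> e0; have sd : has_sup (range d).
    by split; [exists (d 0%N), 0%N|exists C => _ [n _ <-]].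
  have [_ [N _ <-] hN] := sup_adherent e0 sd.
  exists N => m n Nm mn.
  have : d n <= sup (range d) by apply: ub_le_sup; [case: sd|exists n].
  have := d_mono _ _ Nm; lra.
have small (e : R) : 0 < e -> exists N, forall n, (N <= n)%N -> n.+1%:R^-1 < e.
  move=> e0; exists (Num.truncn e^-1) => n Nn.
  rewrite invf_plt ?posrE ?ltr0n //; apply: lt_le_trans (truncnS_gt _) _.
  by rewrite ler_nat ltnS.
have [gl gl2 hgl] : exists2 gl, L2_on D gl & forall e, 0 < e ->
    exists N, forall n, (N <= n)%N -> sqint D (fun t => g n t - gl t) <= e.
  apply: L2_complete => // e e0.
  have [N1 h1] := d_cauchy _ (divr_gt0 e0 (ltr0Sn R 3)).
  have [N2 h2] := small _ (divr_gt0 e0 (ltr0Sn R 15)).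
  exists (maxn N1 N2) => m n.
  wlog mn : m n / (m <= n)%N => [hwlog Nm Nn|].
    by case/orP: (leq_total m n) => h; [exact: hwlog|rewrite sqint_distC; exact: hwlog].
  rewrite !geq_max => /andP[m1 m2] _.
  apply: le_lt_trans (key m n mn) _.
  have := h1 m n m1 mn; have := h2 m m2; move: (m.+1%:R^-1 : R) => a; lra.
have fD : (mu D < +oo)%E by exact: itv_measure_fin.
have sub t : 0 <= t <= tau -> `[0, t]%classic `<=` D.
  by move=> /andP[_ tt]; exact: subset_itvcc.
have /choice[I hI] : forall t, exists v : V, 0 <= t <= tau -> weak_int `[0, t] gl v.
  move=> t; have [tt|tt] := boolP (0 <= t <= tau); last by exists 0.
  have gt2 := L2_sub mD (measurable_itv `[0, t]) (sub t tt) gl2.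
  have [v hv] := weak_int_exists (measurable_itv `[0, t]) (itv_measure_fin 0 t) (L2_smeas gt2)
    (L2_rint1 (measurable_itv `[0, t]) (itv_measure_fin 0 t) gt2).
  by exists v.
have I0 : I 0 = 0.
  have h0 : weak_int `[0, 0] gl (I 0) by apply: hI; rewrite lexx ltW.
  apply: weak_int_unique h0 _ => z; rewrite rdot0l set_itv1.
  by rewrite Rintegral_set1.
have Iprim : is_primitive tau I gl by move=> t tt; rewrite I0 subr0; exact: hI.
have I2 : L2_on D I by exact: primitive_L2 gl2 Iprim.
have WI n t : 0 <= t <= tau -> rnorm (W n t - W n 0 - I t) ^+ 2 <=
     tau * sqint D (fun t => g n t - gl t).
  move=> tt; have /andP[t0 t1] := tt.
  have dw : weak_int `[0, t] (fun t => g n t - gl t) (W n t - W n 0 - I t).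
    move=> z; rewrite rdotBl (Wgp n t tt z) (hI t tt z).
    have gn2 := L2_sub mD (measurable_itv `[0, t]) (sub t tt) (g2 n).
    have gt2 := L2_sub mD (measurable_itv `[0, t]) (sub t tt) gl2.
    have z2 := L2_cst z (measurable_itv `[0, t]) (itv_measure_fin 0 t).
    rewrite -RintegralB //; [|exact: rdot_rint gn2 z2|exact: rdot_rint gt2 z2].
    by apply: eq_Rintegral => s _; rewrite rdotBl.
  have d2 := L2B mD (g2 n) gl2.
  apply: le_trans (weak_int_norm_sq (measurable_itv _) (itv_measure_fin 0 t)
     (L2_sub mD (measurable_itv _) (sub t tt) d2) dw) _.
  rewrite itv_measure_fine // subr0; apply: ler_pM => //; first exact: sqint_ge0.
  exact: sqint_sub mD (measurable_itv _) (sub t tt) d2.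
pose k t := w t - I t.
have k2 : L2_on D k by exact: L2B.
have cst2 v : L2_on D (fun=> v : V) by exact: L2_cst.
have ck e : 0 < e -> exists N, forall n, (N <= n)%N -> sqint D (fun t => W n 0 - k t) <= e.
  move=> e0.
  have [N1 h1] := hgl _ (divr_gt0 e0 (mulr_gt0 (mulr_gt0 tau0 tau0) (ltr0Sn R 3))).
  have [N2 h2] := small _ (divr_gt0 e0 (ltr0Sn R 3)).
  exists (maxn N1 N2) => n; rewrite geq_max => /andP[n1 n2].
  have -> : sqint D (fun t => W n 0 - k t) =
      sqint D (fun t => (W n t - w t) + (-1)%:C *: (W n t - W n 0 - I t)).
    by apply: sqint_eq => t _; rewrite /k; vlin.
  have WI2 : L2_on D (fun t => W n t - W n 0 - I t) by do 2 apply: L2B => //.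
  apply: le_trans (sqintD_le mD (L2B mD (W2 n) w2) (L2Z _ mD WI2)) _.
  rewrite sqintZ // sqrrN expr1n mul1r.
  have : sqint D (fun t => W n t - W n 0 - I t) <=
      \int[mu]_(t in D) (tau * sqint D (fun t => g n t - gl t)).
    apply: le_Rintegral => //; [exact: L2_rint|exact: rint_cst|].
    by move=> t; rewrite /D /= in_itv /= => tt; exact: WI.
  rewrite Rintegral_itv_cst ?(ltW tau0) // subr0.
  have := h1 n n1; rewrite ler_pdivlMr ?mulr_gt0 // => h3.
  have := Ww n; have := h2 n n2; move: (n.+1%:R^-1 : R) => a; nra.
have [c hc] : exists c : V, (fun n => W n 0) @ \oo --> c.
  apply: rnorm_cauchy_cvg => e e0.
  have e1 : 0 < tau * e ^+ 2 / 8 by rewrite divr_gt0 // mulr_gt0 ?exprn_gt0.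
  have [N hN] := ck _ e1; exists N => m n Nm Nn.
  rewrite -(ltr_pXn2r (_ : (0 < 2)%N)) ?nnegrE ?rnorm_ge0 ?ltW //.
  have : sqint D (fun=> W m 0 - W n 0) = rnorm (W m 0 - W n 0) ^+ 2 * tau.
    by rewrite /sqint Rintegral_itv_cst ?(ltW tau0) // subr0.
  have -> : sqint D (fun=> W m 0 - W n 0) =
      sqint D (fun t => (W m 0 - k t) + (-1)%:C *: (W n 0 - k t)).
    by apply: sqint_eq => t _; vlin.
  have := sqintD_le mD (L2B mD (cst2 (W m 0)) k2) (L2Z (-1)%:C mD (L2B mD (cst2 (W n 0)) k2)).
  rewrite sqintZ; [|by []|exact: L2B]; rewrite sqrrN expr1n mul1r.
  have := hN m Nm; have := hN n Nn => h1 h2 h3 h4.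
  have : rnorm (W m 0 - W n 0) ^+ 2 * tau < e ^+ 2 * tau.
    have : 0 < tau * e ^+ 2 by rewrite mulr_gt0 ?exprn_gt0.
    rewrite -h4; lra.
  by rewrite ltr_pM2r.
have Qc : sqint D (fun t => c - k t) = 0.
  apply/eqP; rewrite eq_le sqint_ge0 andbT; apply/ler_addgt0Pl => e e0; rewrite addr0.
  have [N1 h1] := ck _ (divr_gt0 e0 (ltr0Sn R 3)).
  have e1 : 0 < Num.sqrt (e / 4 / tau) by rewrite sqrtr_gt0 !divr_gt0.
  have /cvg_rnormP/(_ _ e1)[N2 _ h2] := hc.
  pose n := maxn N1 N2.
  have -> : sqint D (fun t => c - k t) =
      sqint D (fun t => (W n 0 - k t) + (-1)%:C *: (W n 0 - c)).
    by apply: sqint_eq => t _; vlin.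
  apply: le_trans (sqintD_le mD (L2B mD (cst2 (W n 0)) k2) (L2Z _ mD (cst2 _))) _.
  rewrite sqintZ // sqrrN expr1n mul1r [X in _ + 2 * X](_ : _ = rnorm (W n 0 - c) ^+ 2 * tau);
    last first.
    by rewrite /sqint Rintegral_itv_cst ?(ltW tau0) // subr0.
  have := h2 n (leq_maxr _ _); rewrite /= -(ltr_pXn2r (_ : (0 < 2)%N)) ?nnegrE ?rnorm_ge0
    ?sqrtr_ge0 //.
  rewrite sqr_sqrtr; last by rewrite !divr_ge0 // ltW.
  rewrite ltr_pdivlMr //.
  have := h1 n (leq_maxl _ _); lra.
exists (fun t => c + I t).
  apply/H1_onP; exists gl => // t tt z; rewrite I0 addr0 [c + _]addrC addrK.
  exact: hI.
have := sqint0_ae mD (cst2 c) k2 Qc; apply: ae_imply => t h /h; rewrite /k => ->.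
by rewrite subrK.
Qed.

End Sobolev.

(** * Translation criterion for H^1 *)

Section Regularity.
Context {R : realType}.
Local Notation mu := (@lebesgue_measure R).
Local Notation rint D f := (mu.-integrable D (EFin \o f)).
Implicit Types (V : hilbertType R) (D : set R) (tau h : R).

Lemma L2loc_on V (w : R -> V) a b : L2loc w -> 0 <= a -> L2_on `[a, b] w.
Proof.
move=> w2 a0; have b0 : 0 < Num.max 1 b by rewrite lt_max ltr01.
apply: L2_sub (w2 _ b0) => //; apply: subset_itvcc => //.
by rewrite le_max lexx orbT.
Qed.

Lemma L2_shift V (w : R -> V) h a b : L2_on `[a, b] w ->
  L2_on `[a - h, b - h] (fun t => w (t + h)).
Proof.
move=> w2; apply: L2_onI => //.
  apply: (smeas_comp (h := fun t : R => t + h) _ _ (L2_smeas w2)) => //.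
    exact: measurable_shift.
  by move=> t; rewrite /= !in_itv /= lerBlDr lerBrDr.
have := rint_shift h (measurable_itv _) (L2_rint (measurable_itv _) w2).
by rewrite shift_itvcc.
Qed.

Lemma sqint_shift V (w : R -> V) h a b : L2_on `[a, b] w ->
  sqint `[a - h, b - h] (fun t => w (t + h)) = sqint `[a, b] w.
Proof.
move=> w2; have := Rintegral_shift h (measurable_itv _) (L2_rint (measurable_itv _) w2).
by rewrite shift_itvcc.
Qed.

Lemma L2loc_shift V (w : R -> V) h : 0 <= h -> L2loc w -> L2loc (fun t => w (t + h)).
Proof.
move=> h0 w2 tau tau0.
have := L2_shift h (L2loc_on (h + tau) w2 h0).
by rewrite subrr (addrC h) addrK.
Qed.

Lemma L2_trunc V (w : R -> V) tau : L2_on `[0, tau] w ->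
  smeas setT (trunc tau w) /\ L2_on setT (trunc tau w).
Proof.
move=> w2.
have m : smeas setT (trunc tau w).
  apply: smeas_if => //; last exact: smeas_cst.
  by apply: smeas_sub (L2_smeas w2) => t [].
split=> //; apply: L2_onI => //.
have := (@integrable_mkcond _ _ R mu `[0, tau] (EFin \o (fun t => rnorm (w t) ^+ 2))
  (measurable_itv _)).1 (L2_rint (measurable_itv _) w2).
rewrite restrict_EFin; congr (_.-integrable _ _); apply/funext => t /=; rewrite /trunc /patch.
by case: ifP => // _; rewrite rnorm0 expr0n.
Qed.

Lemma trunc_in V (w : R -> V) tau t : 0 <= t <= tau -> trunc tau w t = w t.
Proof. by move=> tt; rewrite /trunc /patch mem_set //= in_itv. Qed.

Lemma trunc_out V (w : R -> V) tau t : ~~ (0 <= t <= tau) -> trunc tau w t = 0.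
Proof.
by move=> /negP tt; rewrite /trunc /patch memNset //= in_itv.
Qed.

Lemma sqint_trunc V (w : R -> V) tau D : measurable D -> `[0, tau] `<=` D ->
  sqint D (trunc tau w) = sqint `[0, tau] w.
Proof.
move=> mD sD; rewrite /sqint Rintegral_mkcond [RHS]Rintegral_mkcond.
apply: eq_Rintegral => t _; rewrite /patch /trunc /patch.
case: ifPn => h; first by case: ifP => // _; rewrite rnorm0 expr0n.
case: ifPn => // h'; move/negP : h => []; rewrite inE; apply: sD.
exact: set_mem.
Qed.

Lemma tonelli_measurable (A B : set R) (G : R -> R -> R) : measurable A -> measurable B ->
  (forall t s, 0 <= G t s) ->
  measurable_fun setT (fun p : measurableTypeR R * measurableTypeR R => G p.1 p.2) ->
  measurable_fun A (fun t : measurableTypeR R => \int[mu]_(s in B) (G t s)%:E)%E.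
Proof.
move=> mA mB G0 mG.
pose f (p : measurableTypeR R * measurableTypeR R) : \bar R := (G p.1 p.2 * \1_B p.2)%:E.
have mI : measurable_fun [set: measurableTypeR R] (\1_B : measurableTypeR R -> R).
  exact: measurable_indic.
have mf : measurable_fun setT f.
  apply/measurable_EFinP; apply: measurable_funM => //.
  exact: (measurableT_comp mI measurable_snd).
have f0 p : (0 <= f p)%E by rewrite lee_fin mulr_ge0 // indicE ler0n.
have := @measurable_fun_fubini_tonelli_F _ _ _ _ R mu f mf f0.
rewrite /fubini_F; move/(measurable_funS measurableT (@subsetT _ A)).
apply: eq_measurable_fun => t _.
rewrite [RHS]integral_mkcond; apply: eq_integral => s _; rewrite /patch /f /= indicE.
by case: ifPn => _; rewrite ?mulr1 ?mulr0.
Qed.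

(** Tonelli's theorem lets the integral over t, which is bounded uniformly in s,
    be taken first. *)
Lemma rectangle_integral_le (G : R -> R -> R) (T h C : R) : 0 <= h ->
  (forall t s, 0 <= G t s) ->
  measurable_fun setT (fun q : measurableTypeR R * measurableTypeR R => G q.1 q.2) ->
  (forall s, 0 <= s <= h -> (\int[mu]_(t in `[0%R, T]) (G t s)%:E <= C%:E)%E) ->
  (\int[mu]_(t in `[0%R, T]) \int[mu]_(s in `[0%R, h]) (G t s)%:E <= (h * C)%:E)%E.
Proof.
move=> h0 G0 mG hC; rewrite tonelli_rect //.
have mG' : measurable_fun setT (fun q : measurableTypeR R * measurableTypeR R => G q.2 q.1).
  exact: (measurableT_comp mG (measurable_fun_pair measurable_snd measurable_fst)).
have -> : (h * C)%:E = (\int[mu]_(s in `[0%R, h]) (cst C%:E) s)%E.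
  rewrite integral_cst //= -(fineK (_ : mu `[0%R, h] \is a fin_num)) ?itv_measure_fine ?subr0 //.
    by rewrite muleC.
  by rewrite ge0_fin_numE // itv_measure_fin.
apply: ge0_le_integral => //.
- by move=> s _; apply: integral_ge0 => t _; rewrite lee_fin.
- by apply: (tonelli_measurable (G := fun s t => G t s)) => // t s.
Qed.

Lemma smeas_translate V (p : R -> V) : smeas setT p ->
  smeas setT (fun q : measurableTypeR R * measurableTypeR R => p (q.1 + q.2)).
Proof.
apply: (@smeas_comp R _ _ (measurableTypeR R)
  (measurableTypeR R * measurableTypeR R)%type V setT setT p (fun q => q.1 + q.2)) => //.
by apply: measurable_funD; [exact: measurable_fst|exact: measurable_snd].
Qed.

(** The averages of w over windows of length h are primitives of the difference
    quotients of w, which are bounded in L^2 by hypothesis.  By Jensen's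
    inequality and [rectangle_integral_le] they converge to w, and [H1_closure]
    applies. *)
Theorem H1_of_translation V (w : R -> V) (T h0 C : R) : 0 < T -> 0 < h0 -> L2loc w ->
  (forall h, 0 < h < h0 -> sqint `[0, T] (fun t => w (t + h) - w t) <= C * h ^+ 2) ->
  exists2 W, H1_on T W & \forall t \ae mu, `[0, T]%classic t -> w t = W t.
Proof.
move=> T0 h00 w2 hw.
have C0 : 0 <= C.
  have h1 : 0 < h0 / 2 < h0 by rewrite divr_gt0 //=; lra.
  have := le_trans (sqint_ge0 _ _) (hw _ h1).
  by rewrite pmulr_lge0 // exprn_gt0 //; case/andP: h1.
apply: (H1_closure (C := C) T0) => [|e e0]; first exact: L2loc_on.
have [h [h1 h2 h3]] : exists h, [/\ 0 < h, h < h0 & C * h ^+ 2 <= e].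
  pose h := Num.min (h0 / 2) (Num.min 1 (e / (C + 1))).
  have hp : 0 < h by rewrite !lt_min ltr01 !divr_gt0 //; lra.
  exists h; split=> //; first by rewrite gt_min; apply/orP; left; lra.
  have h1 : h <= 1 by rewrite !ge_min lexx orbT.
  have : h <= e / (C + 1) by rewrite !ge_min lexx !orbT.
  rewrite ler_pdivlMr; last by lra.
  nra.
pose Tm := T + h.
pose p := trunc Tm w.
have [mp p2] : smeas setT p /\ L2_on setT p by apply: L2_trunc; exact: L2loc_on.
have pE t : 0 <= t <= Tm -> p t = w t by exact: trunc_in.
have p2l a b : L2_on `[a, b] p by apply: L2_sub p2.
have psh s a b : L2_on `[a, b] (fun t => p (t + s)).
  by have := L2_shift s (p2l (a + s) (b + s)); rewrite !addrK.
have psh' s a b : L2_on `[a, b] (fun t => p (s + t)).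
  by have := psh s a b; congr (L2_on _ _); apply/funext => t; rewrite addrC.
have /choice[I hI] : forall t, exists v : V, weak_int `[0, h] (fun s => p (t + s)) v.
  move=> t; have i2 : L2_on `[0, h] (fun s => p (t + s)).
    exact: psh'.
  exact: (weak_int_exists (measurable_itv _) (itv_measure_fin 0 h) (L2_smeas i2)
           (L2_rint1 (measurable_itv _) (itv_measure_fin 0 h) i2)).
pose W t := (h^-1)%:C *: I t.
pose g t := (h^-1)%:C *: (p (t + h) - p t).
have dp2 a b : L2_on `[a, b] (fun t => p (t + h) - p t) by apply: L2B.
have g2 : L2_on `[0, T] g by apply: L2Z.
have Iz t z : 0 <= t -> rdot (I t) z =
    \int[mu]_(s in `[0, t + h]) rdot (p s) z - \int[mu]_(s in `[0, t]) rdot (p s) z.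
  move=> t0.
  have r a b : rint `[a, b] (fun s => rdot (p s) z).
    exact: (rdot_rint (measurable_itv _) (p2l a b) (L2_cst z (measurable_itv _) (itv_measure_fin
      _ _))).
  rewrite -rint_itvB //; last by rewrite t0 lerDl ltW.
  rewrite hI -(Rintegral_shift t (measurable_itv _) (r t (t + h))) shift_itvcc subrr.
  by rewrite (addrC t h) addrK; apply: eq_Rintegral => s _; rewrite addrC.
have Wprim : is_primitive T W g.
  move=> t /andP[t0 tT] z; rewrite /W -scalerBr rdotZl rdotBl !Iz // add0r.
  under [in RHS]eq_Rintegral do rewrite /g rdotZl rdotBl.
  have r a b : rint `[a, b] (fun s => rdot (p s) z).
    exact: (rdot_rint (measurable_itv _) (p2l a b) (L2_cst z (measurable_itv _) (itv_measure_fin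
      _ _))).
  have rh : rint `[0, t] (fun s => rdot (p (s + h)) z).
    exact: (rdot_rint (measurable_itv _) (psh h 0 t) (L2_cst z (measurable_itv _)
      (itv_measure_fin _ _))).
  rewrite RintegralZl //; last first.
    exact: (rintB (measurable_itv _) rh (r 0 t)).
  rewrite RintegralB //; congr (_ * _).
  have := Rintegral_shift h (measurable_itv _) (r h (t + h)).
  rewrite shift_itvcc subrr addrK => ->.
  have h00' : 0 <= h <= t + h by rewrite ltW //= lerDr.
  rewrite (rint_itvB h00' (r 0 (t + h))) set_itv1 Rintegral_set1; lra.
have W2 : L2_on `[0, T] W by exact: primitive_L2 g2 Wprim.
have trans s : 0 <= s <= h -> sqint `[0, T] (fun t => p (t + s) - p t) <= C * h ^+ 2.
  move=> /andP[s0 sh]; have -> : sqint `[0, T] (fun t => p (t + s) - p t) =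
      sqint `[0, T] (fun t => w (t + s) - w t).
    apply: sqint_eq => t; rewrite inE /= in_itv /= => /andP[t0 tT].
    rewrite !pE //; apply/andP; split; rewrite /Tm; lra.
  move: s0; rewrite le_eqVlt => /predU1P[<-|s0].
    rewrite (_ : sqint _ _ = 0); first by apply: mulr_ge0 => //; exact: sqr_ge0.
    rewrite /sqint; under eq_Rintegral do rewrite addr0 subrr rnorm0 expr0n /=.
    by rewrite Rintegral_itv_cst ?(ltW T0) // mul0r.
  apply: le_trans (hw s _) _; first by rewrite s0 (le_lt_trans sh).
  by rewrite ler_wpM2l // ler_pXn2r ?nnegrE // ltW.
exists W, g; split=> //; last first.
  rewrite /g sqintZ //.
  have := trans h; rewrite (ltW h1) lexx => /(_ isT) h4.
  rewrite exprVn ler_pdivrMl ?exprn_gt0 // mulrC //.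
apply: le_trans h3; rewrite -lee_fin -sqintE //; last by apply: L2B => //; exact: L2loc_on.
have jensen t : 0 <= t <= T -> rnorm (W t - w t) ^+ 2 <=
    h^-1 * sqint `[0, h] (fun s => p (t + s) - p t).
  move=> /andP[t0 tT].
  have i2 : L2_on `[0, h] (fun s => p (t + s)).
    exact: psh'.
  have c2 v : L2_on `[0, h] (fun=> v : V) by exact: L2_cst (itv_measure_fin _ _).
  have dw : weak_int `[0, h] (fun s => p (t + s) - p t) (I t - h%:C *: p t).
    move=> z; rewrite rdotBl hI rdotZl.
    under [RHS]eq_Rintegral do rewrite rdotBl.
    rewrite RintegralB //; [|exact: rdot_rint|exact: rdot_rint].
    by rewrite Rintegral_itv_cst ?(ltW h1) // subr0 mulrC.
  have := weak_int_norm_sq (measurable_itv _) (itv_measure_fin 0 h) (L2B (measurable_itv _) i2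
    (c2 (p t))) dw.
  rewrite itv_measure_fine ?(ltW h1) // subr0 => h4.
  have -> : W t - w t = (h^-1)%:C *: (I t - h%:C *: p t).
    rewrite /W scalerBr scalerA -rmorphM /= mulVf ?gt_eqF // scale1r pE //.
    by rewrite t0 /Tm; lra.
  rewrite rnormZr exprMn real_normK ?num_real //.
  apply: le_trans (ler_wpM2l (sqr_ge0 _) h4) _.
  by rewrite mulrA expr2 -(mulrA h^-1) mulVf ?gt_eqF // mulr1.
have mG : measurable_fun setT (fun q : measurableTypeR R * measurableTypeR R =>
    rnorm (p (q.1 + q.2) - p q.1) ^+ 2).
  apply: measurable_funX; apply: smeas_rnorm => //; apply: smeasB; first exact: smeas_translate.
  exact: (@smeas_comp R _ _ (measurableTypeR R)
    (measurableTypeR R * measurableTypeR R)%type V setT setT p fst).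
have mGs : measurable_fun `[0, T] (fun t : measurableTypeR R =>
    \int[mu]_(s in `[0%R, h]) (rnorm (p (t + s) - p t) ^+ 2)%:E)%E.
  apply: (tonelli_measurable (G := fun t s => rnorm (p (t + s) - p t) ^+ 2)) => //.
  by move=> t s; exact: sqr_ge0.
apply: (@le_trans _ _ (\int[mu]_(t in `[0%R, T]) ((h^-1)%:E *
    \int[mu]_(s in `[0%R, h]) (rnorm (p (t + s) - p t) ^+ 2)%:E))%E).
  apply: ge0_le_integral => //.
  - by move=> t _; rewrite lee_fin sqr_ge0.
  - apply/measurable_EFinP; apply: (smeas_rnorm2 (measurable_itv _)).
    by apply: smeasB; [exact: (L2_smeas W2)|exact: (L2_smeas (L2loc_on T w2 (lexx 0)))].
  - exact: measurable_funeM.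
  move=> t; rewrite /= in_itv /= => tT.
  have d2 : L2_on `[0, h] (fun s => p (t + s) - p t).
    by apply: L2B => //; exact: L2_cst (itv_measure_fin _ _).
  by rewrite sqintE // -EFinM lee_fin jensen.
rewrite ge0_integralZl_EFin //; last 2 first.
- by move=> t _; apply: integral_ge0 => s _; rewrite lee_fin sqr_ge0.
- by rewrite invr_ge0 ltW.
apply: (@le_trans _ _ ((h^-1)%:E * (h * (C * h ^+ 2))%:E)%E).
  apply: lee_wpmul2l; first by rewrite lee_fin invr_ge0 ltW.
  apply: (rectangle_integral_le (G := fun t s => rnorm (p (t + s) - p t) ^+ 2)) => //.
  - exact: ltW.
  - by move=> t s; exact: sqr_ge0.
  move=> s sh; have d2 : L2_on `[0, T] (fun t => p (t + s) - p t) by apply: L2B.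
  by rewrite (sqintE _ d2) // lee_fin trans.
by rewrite -(EFinM h^-1) lee_fin (mulrA h^-1) mulVf ?gt_eqF // mul1r.
Qed.

End Regularity.

(** * Continuous, Lipschitz and H^1 functions *)

Section Continuity.
Context {R : realType}.
Local Notation mu := (@lebesgue_measure R).
Implicit Types (V : hilbertType R) (D : set R) (tau h T : R).

Lemma continuous_halflineP (W : completeNormedModType R[i]) (x : R -> W) :
  continuous_halfline x <-> forall t, 0 <= t -> forall e, 0 < e ->
    exists2 d : R, 0 < d & forall s, 0 <= s -> `|s - t| < d -> rnorm (x s - x t) < e.
Proof.
rewrite /continuous_halfline; split=> [/subspace_continuousP h t t0 e e0|h].
  have /h/cvg_rnormP/(_ e e0) : `[0, +oo[%classic t by rewrite /= in_itv /= andbT.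
  rewrite near_withinE => /nbhs_ballP[d /= d0 hd]; exists d => // s s0 st.
  apply: hd; first by rewrite /ball /= distrC.
  by rewrite /= in_itv /= andbT.
apply/subspace_continuousP => t; rewrite /= in_itv /= andbT => t0.
apply/cvg_rnormP => e e0; have [d d0 hd] := h t t0 e e0.
rewrite near_withinE; apply/nbhs_ballP; exists d => // s.
by rewrite /ball /= distrC in_itv /= andbT => st s0; exact: hd.
Qed.

Lemma has_derivP (W : completeNormedModType R[i]) (x : R -> W) t v :
  has_deriv x t v <-> forall e, 0 < e -> exists2 d : R, 0 < d & forall h, h != 0 ->
    `|h| < d -> 0 <= t + h -> rnorm ((h^-1)%:C *: (x (t + h) - x t) - v) < e.
Proof.
rewrite /has_deriv; split=> [/cvg_rnormP h e e0|h].
  have := h e e0; rewrite near_withinE => /nbhs_ballP[d /= d0 hd].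
  exists d => // k k0 kd tk; apply: hd => //.
  by rewrite /ball /= sub0r normrN.
apply/cvg_rnormP => e e0; have [d d0 hd] := h e e0.
rewrite near_withinE; apply/nbhs_ballP; exists d => // k /=.
by rewrite /ball /= sub0r normrN => kd k0 tk; exact: hd.
Qed.

Definition cont_on V T (x : R -> V) : Prop := forall t, 0 <= t <= T -> forall e, 0 < e ->
  exists2 d : R, 0 < d & forall s, 0 <= s <= T -> `|s - t| < d -> rnorm (x s - x t) < e.

Lemma halfline_cont_on V T (x : R -> V) : continuous_halfline x -> cont_on T x.
Proof.
move=> /continuous_halflineP h t /andP[t0 _] e e0; have [d d0 hd] := h t t0 e e0.
by exists d => // s /andP[s0 _]; exact: hd.
Qed.

Lemma cont_on_halfline V (x : R -> V) : (forall T, 0 < T -> cont_on T x) ->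
  continuous_halfline x.
Proof.
move=> h; apply/continuous_halflineP => t t0 e e0.
have t1 : 0 < t + 1 by lra.
have [|d d0 hd] := h _ t1 t _ e e0; first by rewrite t0; lra.
exists (Num.min d 1); first by rewrite lt_min d0 ltr01.
move=> s s0; rewrite lt_min => /andP[sd s1]; apply: hd => //.
by rewrite s0 /=; move: s1; rewrite ltr_norml => /andP[_]; lra.
Qed.

Lemma holder_cont_on V T (x : R -> V) C : 0 <= C ->
  (forall a b, 0 <= a -> a <= b -> b <= T -> rnorm (x b - x a) ^+ 2 <= (b - a) * C) ->
  cont_on T x.
Proof.
move=> C0 hx t /andP[t0 tT] e e0; have C1 : 0 < C + 1 by lra.
exists (e ^+ 2 / (C + 1)); first by rewrite divr_gt0 ?exprn_gt0.
move=> s /andP[s0 sT] st; rewrite -(ltr_pXn2r (_ : (0 < 2)%N)) ?nnegrE ?rnorm_ge0 ?(ltW e0) //.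
have key a b : 0 <= a -> a <= b -> b <= T -> b - a < e ^+ 2 / (C + 1) ->
    rnorm (x b - x a) ^+ 2 < e ^+ 2.
  move=> a0 ab bT; rewrite ltr_pdivlMr // => h; apply: le_lt_trans (hx a b a0 ab bT) _.
  by apply: le_lt_trans h; rewrite ler_wpM2l ?subr_ge0 //; lra.
case: (leP s t) => h.
  by rewrite rnormB; apply: key => //; rewrite ler0_norm ?subr_le0 // in st; lra.
by apply: key => //; [exact: ltW|rewrite gtr0_norm ?subr_gt0 // in st].
Qed.

(** Two continuous functions that differ at a point differ on an interval, which
    has positive measure. *)
Lemma cont_on_eq V T (x y : R -> V) : 0 < T -> cont_on T x -> cont_on T y ->
  (\forall t \ae mu, `[0, T]%classic t -> x t = y t) ->
  forall t, 0 <= t <= T -> x t = y t.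
Proof.
move=> T0 cx cy [N [mN N0 hN]] t tT; apply/eqP; rewrite -subr_eq0; apply: contraT => xy.
have e0 : 0 < rnorm (x t - y t) / 2.
  rewrite divr_gt0 // lt0r rnorm_ge0 andbT; apply: contra xy => /eqP/rnorm_eq0 ->.
  by rewrite eqxx.
have [d1 d10 h1] := cx t tT _ e0; have [d2 d20 h2] := cy t tT _ e0.
pose a := Num.max 0 (t - Num.min d1 d2 / 2); pose b := Num.min T (t + Num.min d1 d2 / 2).
have d0 : 0 < Num.min d1 d2 by rewrite lt_min d10.
have /andP[t0 tT'] := tT.
have ab : a < b.
  by rewrite /a /b lt_min !gt_max T0 /= ; apply/andP; split; [lra|apply/andP; split; lra].
have sub : `[a, b] `<=` N.
  move=> s; rewrite /= in_itv /= /a /b ge_max le_min => /andP[/andP[s0 s1] /andP[s2 s3]].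
  apply: hN => /= /(_ _) sE.
  have sT : 0 <= s <= T by rewrite s0.
  have sd : `|s - t| < Num.min d1 d2 by rewrite ltr_norml; apply/andP; split; lra.
  move: sd; rewrite lt_min => /andP[sd1 sd2].
  have := h1 s sT sd1; have := h2 s sT sd2.
  rewrite sE; last by rewrite /= in_itv.
  have := rnorm_distD (y s) (x t) (y t); rewrite [rnorm (x t - y s)]rnormB; lra.
have : (mu `[a, b] <= mu N)%E by apply: le_measure => //; rewrite inE //; exact: measurable_itv.
by rewrite N0 lebesgue_measure_itv /= lte_fin ab -EFinD lee_fin subr_le0 leNgt ab.
Qed.

Lemma cont_on_smeas V T (x : R -> V) : cont_on T x -> smeas `[0, T] x.
Proof.
move=> cx; apply: right_cvg_smeas => t /andP[t0 tT] e e0.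
have [|d d0 hd] := cx t _ e e0; first by rewrite t0 ltW.
exists d => // s ts std sT; apply: hd; first by rewrite sT (le_trans t0).
by rewrite ger0_norm ?subr_ge0 //; lra.
Qed.

Lemma cont_on_bounded V T (x : R -> V) : 0 < T -> cont_on T x ->
  exists M, forall t, 0 <= t <= T -> rnorm (x t) <= M.
Proof.
move=> T0 cx.
have c : {within `[0, T], continuous (fun t => rnorm (x t))}.
  apply/subspace_continuousP => t; rewrite /= in_itv /= => tT.
  apply/cvgrPdist_lt => e e0; have [d d0 hd] := cx t tT e e0.
  rewrite near_withinE; apply/nbhs_ballP; exists d => // s.
  rewrite /ball /= distrC in_itv /= => st sT; rewrite distrC.
  by apply: le_lt_trans (rnorm_dist _ _) _; exact: hd.
have [m _ hm] := EVT_max (ltW T0) c; exists (rnorm (x m)) => t tT.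
by apply: hm; rewrite in_itv.
Qed.

Lemma cont_on_L2 V T (x : R -> V) : 0 < T -> cont_on T x -> L2_on `[0, T] x.
Proof.
move=> T0 cx; have [M hM] := cont_on_bounded T0 cx.
exact: bounded_L2 (cont_on_smeas cx) hM.
Qed.

Lemma halfline_L2loc V (x : R -> V) : continuous_halfline x -> L2loc x.
Proof. by move=> cx tau tau0; apply: cont_on_L2 => //; exact: halfline_cont_on. Qed.

Lemma H1_holder V T (u : R -> V) : H1_on T u -> exists2 C, 0 <= C & forall a b,
  0 <= a -> a <= b -> b <= T -> rnorm (u b - u a) ^+ 2 <= (b - a) * C.
Proof.
move=> /H1_onP[g g2 ug]; exists (sqint `[0, T] g); first exact: sqint_ge0.
by move=> a b; exact: (primitive_holder_le g2 ug).
Qed.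

Lemma H1_cont_on V T (u : R -> V) : H1_on T u -> cont_on T u.
Proof. by move=> /H1_holder[C C0 hC]; exact: holder_cont_on C0 hC. Qed.

Lemma H1loc_continuous V (u : R -> V) : H1loc u -> continuous_halfline u.
Proof. by move=> hu; apply: cont_on_halfline => T T0; apply/H1_cont_on/hu. Qed.

Lemma H1loc_L2loc V (u : R -> V) : H1loc u -> L2loc u.
Proof. by move/H1loc_continuous/halfline_L2loc. Qed.

Lemma H1_on_eq V T (u v : R -> V) : (forall t, 0 <= t <= T -> u t = v t) -> 0 <= T ->
  H1_on T u -> H1_on T v.
Proof.
move=> uv T0 [g g2 ug]; exists g => // t tT.
by rewrite -!uv //; [exact: ug|rewrite lexx].
Qed.

Lemma H1_of_ae V T (u W : R -> V) : 0 < T -> cont_on T u -> H1_on T W ->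
  (\forall t \ae mu, `[0, T]%classic t -> u t = W t) -> H1_on T u.
Proof.
move=> T0 cu hW uW; apply: (H1_on_eq _ (ltW T0) hW) => t tT; apply/esym.
exact: (cont_on_eq T0 cu (H1_cont_on hW) uW).
Qed.

Lemma sqint_bound V T (f : R -> V) M : 0 <= T -> L2_on `[0, T] f ->
  (forall t, 0 <= t <= T -> rnorm (f t) ^+ 2 <= M) -> sqint `[0, T] f <= M * T.
Proof.
move=> T0 f2 hM; have E := @Rintegral_itv_cst R 0 T M T0; rewrite subr0 in E.
rewrite -E; apply: le_Rintegral; [exact: measurable_itv|exact: (L2_rint (measurable_itv _) f2)
  |exact: (rint_cst _ (measurable_itv _) (itv_measure_fin _ _))|].
by move=> t; rewrite /= in_itv /=; exact: hM.
Qed.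

Definition lipschitz_fun V (v : R -> V) : Prop :=
  exists2 L, 0 <= L & forall s t, rnorm (v s - v t) <= L * `|s - t|.

Lemma lipschitz_continuous V (v : R -> V) : lipschitz_fun v -> continuous_halfline v.
Proof.
move=> [L L0 hL]; apply/continuous_halflineP => t t0 e e0.
have L1 : 0 < L + 1 by lra.
exists (e / (L + 1)); first exact: divr_gt0.
move=> s s0; rewrite ltr_pdivlMr // => h; apply: le_lt_trans (hL s t) _.
have := normr_ge0 (s - t); nra.
Qed.

(** An instance of the Radon-Nikodym property of Hilbert spaces, by way of the
    translation criterion. *)
Lemma lipschitz_H1loc V (v : R -> V) : lipschitz_fun v -> H1loc v.
Proof.
move=> lv T T0; have cv := lipschitz_continuous lv; have [L L0 hL] := lv.
have [||W HW vW] := @H1_of_translation _ V v T 1 (L ^+ 2 * T) T0 ltr01.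
- exact: halfline_L2loc.
- move=> h /andP[h0 _].
  have d2 : L2_on `[0, T] (fun t => v (t + h) - v t).
    apply: L2B => //; last exact: halfline_L2loc.
    exact: (L2loc_shift (ltW h0) (halfline_L2loc cv) T0).
  rewrite mulrAC; apply: sqint_bound (ltW T0) d2 _ => t _.
  rewrite -exprMn ler_pXn2r ?nnegrE ?rnorm_ge0 ?mulr_ge0 ?(ltW h0) //.
  by apply: le_trans (hL _ _) _; rewrite addrAC subrr add0r ger0_norm // ltW.
have cT : cont_on T v by exact: halfline_cont_on.
exact: (H1_of_ae T0 cT HW vW).
Qed.

(** Cauchy-Schwarz bounds the squared increment over [t, t + h] by h times the
    integral of |g|^2 over that interval; integrating in t gains a second factor
    h by Tonelli's theorem. *)
Lemma H1_translation V (u : R -> V) T : 0 < T -> H1loc u ->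
  exists C, forall h, 0 < h < 1 -> sqint `[0, T] (fun t => u (t + h) - u t) <= C * h ^+ 2.
Proof.
move=> T0 hu; have T1 : 0 < T + 1 by lra.
have /H1_onP[g g2 ug] := hu _ T1.
exists (sqint `[0, T + 1] g) => h /andP[h0 h1].
have u2 := H1loc_L2loc hu.
pose p := trunc (T + 1) g.
have [mp p2] : smeas setT p /\ L2_on setT p by exact: L2_trunc.
have p2l a b : L2_on `[a, b] p by apply: L2_sub p2.
have psh s a b : L2_on `[a, b] (fun t => p (t + s)).
  by have := L2_shift s (p2l (a + s) (b + s)); rewrite !addrK.
have d2 : L2_on `[0, T] (fun t => u (t + h) - u t).
  by apply: L2B; [|exact: (L2loc_shift (ltW h0) u2 T0)|exact: u2].
have pw t : 0 <= t <= T -> rnorm (u (t + h) - u t) ^+ 2 <=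
    h * sqint `[0, h] (fun s => p (t + s)).
  move=> /andP[t0 tT].
  have tth : t <= t + h by rewrite lerDl ltW.
  have thT : t + h <= T + 1 by lra.
  apply: le_trans (primitive_holder g2 ug t0 tth thT) _.
  rewrite addrAC subrr add0r ler_pM2l //.
  have -> : sqint `[t, t + h] g = sqint `[t, t + h] p.
    apply: sqint_eq => s; rewrite inE /= in_itv /= => /andP[s1 s2].
    by rewrite /p trunc_in //; apply/andP; split; lra.
  rewrite -(sqint_shift t (p2l t (t + h))) subrr (addrC t h) addrK.
  by rewrite le_eqVlt; apply/orP; left; apply/eqP; apply: sqint_eq => s _; rewrite addrC.
have mG : measurable_fun setT (fun q : measurableTypeR R * measurableTypeR R =>
    rnorm (p (q.1 + q.2)) ^+ 2).
  by apply: measurable_funX; apply: smeas_rnorm => //; exact: smeas_translate.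
have mGs : measurable_fun `[0, T] (fun t : measurableTypeR R =>
    \int[mu]_(s in `[0%R, h]) (rnorm (p (t + s)) ^+ 2)%:E)%E.
  apply: (tonelli_measurable (G := fun t s => rnorm (p (t + s)) ^+ 2)) => //.
  by move=> t s; exact: sqr_ge0.
rewrite -lee_fin -sqintE //.
apply: (@le_trans _ _ (\int[mu]_(t in `[0%R, T]) (h%:E *
    \int[mu]_(s in `[0%R, h]) (rnorm (p (t + s)) ^+ 2)%:E))%E).
  apply: ge0_le_integral => //.
  - by move=> t _; rewrite lee_fin sqr_ge0.
  - by apply/measurable_EFinP; exact: (smeas_rnorm2 (measurable_itv _) (L2_smeas d2)).
  - exact: measurable_funeM.
  move=> t; rewrite /= in_itv /= => tT.
  have q2 : L2_on `[0, h] (fun s => p (t + s)).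
    by have := psh t 0 h; congr (L2_on _ _); apply/funext => s; rewrite addrC.
  by rewrite sqintE // -EFinM lee_fin pw.
rewrite ge0_integralZl_EFin //; last 2 first.
- by move=> t _; apply: integral_ge0 => s _; rewrite lee_fin sqr_ge0.
- exact: ltW.
rewrite mulrC expr2 -mulrA EFinM; apply: lee_wpmul2l; first by rewrite lee_fin ltW.
apply: (rectangle_integral_le (G := fun t s => rnorm (p (t + s)) ^+ 2)) => //.
- exact: ltW.
- by move=> t s; exact: sqr_ge0.
move=> s /andP[s0 sh]; rewrite sqintE // lee_fin.
have := sqint_shift s (p2l s (T + s)); rewrite subrr addrK => ->.
apply: le_trans (sqint_sub measurableT (measurable_itv _) (@subsetT _ _) p2) _.
by rewrite sqint_trunc.
Qed.

End Continuity.

(** * Density of Lipschitz functions *)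

Section Density.
Context {R : realType}.
Local Notation mu := (@lebesgue_measure R).
Local Notation rint D f := (mu.-integrable D (EFin \o f)).
Implicit Types (V : hilbertType R) (D : set R) (T : R).

Definition dist_set (K : set R) (t : R) : R := inf [set `|t - k| | k in K].

Lemma dist_set_has_inf (K : set R) (t : R) : K !=set0 -> has_inf [set `|t - k| | k in K].
Proof.
move=> [k Kk]; split; first by exists `|t - k|, k.
by exists 0 => _ [k' _ <-].
Qed.

Lemma dist_set_ge0 (K : set R) t : K !=set0 -> 0 <= dist_set K t.
Proof.
move=> K0; apply: lb_le_inf; first by case: (dist_set_has_inf t K0).
by move=> _ [k _ <-].
Qed.

Lemma dist_set_lip K s t : K !=set0 -> `|dist_set K s - dist_set K t| <= `|s - t|.
Proof.
move=> K0; have key a b : dist_set K a - dist_set K b <= `|a - b|.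
  rewrite lerBlDl -lerBlDr; apply: lb_le_inf; first by case: (dist_set_has_inf b K0).
  move=> _ [k Kk <-]; rewrite lerBlDr; apply: le_trans (_ : `|a - k| <= _).
    by apply: ge_inf; [case: (dist_set_has_inf a K0)|exists k].
  by rewrite [X in _ <= X]addrC; exact: (ler_distD b a k).
by rewrite ler_norml key andbT lerNl opprB distrC key.
Qed.

Lemma dist_set_in (K : set R) t : K t -> dist_set K t = 0.
Proof.
move=> Kt; have K0 : K !=set0 by exists t.
apply/eqP; rewrite eq_le dist_set_ge0 // andbT; apply: ge_inf.
  by case: (dist_set_has_inf t K0).
by exists t => //; rewrite subrr normr0.
Qed.

Lemma dist_set_gt0 K t : closed K -> K !=set0 -> ~ K t -> 0 < dist_set K t.
Proof.
move=> cK K0 nKt; have /nbhs_ballP[e /= e0 he] : nbhs t (~` K).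
  by apply: open_nbhs_nbhs; split=> //; exact: closed_openC.
apply: lt_le_trans e0 _; apply: lb_le_inf; first by case: (dist_set_has_inf t K0).
move=> _ [k Kk <-]; rewrite leNgt; apply/negP => tk.
by have := he k; apply.
Qed.

(** A Lipschitz function that equals 1 on K and, for closed K, tends to 0 off K
    as n grows. *)
Definition bump (K : set R) (n : nat) (t : R) : R := Num.max 0 (1 - n%:R * dist_set K t).

Lemma bump_itv K n t : K !=set0 -> 0 <= bump K n t <= 1.
Proof.
move=> K0; rewrite /bump le_max lexx /= ge_max ler01 /= lerBlDr lerDl.
by rewrite mulr_ge0 ?ler0n // dist_set_ge0.
Qed.

Lemma max0_lip (a b : R) : `|Num.max 0 a - Num.max 0 b| <= `|a - b|.
Proof.
have key (x y : R) : Num.max 0 x - Num.max 0 y <= `|x - y|.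
  have := ler_norm (x - y); have := normr_ge0 (x - y).
  by case: (leP 0 x) => h1; case: (leP 0 y) => h2 h3 h4; lra.
by rewrite ler_norml key andbT lerNl opprB distrC key.
Qed.

Lemma bump_lip K n s t : K !=set0 -> `|bump K n s - bump K n t| <= n%:R * `|s - t|.
Proof.
move=> K0; apply: le_trans (max0_lip _ _) _.
have -> : 1 - n%:R * dist_set K s - (1 - n%:R * dist_set K t) = n%:R * (dist_set K t - dist_set K
  s) by ring.
rewrite normrM ger0_norm ?ler0n //; by rewrite ler_wpM2l ?ler0n // distrC dist_set_lip.
Qed.

Lemma sqint_eq0 V D (f : R -> V) : (forall t, D t -> f t = 0) -> sqint D f = 0.
Proof.
move=> f0; rewrite /sqint /Rintegral integral0_eq // => t Dt.
by rewrite f0 // rnorm0 expr0n.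
Qed.

Definition lip_approx V T (f : R -> V) : Prop := forall e : R, 0 < e ->
  exists2 v, lipschitz_fun v & sqint `[0, T] (fun t => v t - f t) <= e.

Lemma lipschitz_L2loc V (v : R -> V) : lipschitz_fun v -> L2loc v.
Proof. by move=> lv; apply/halfline_L2loc/lipschitz_continuous. Qed.

Lemma lipschitzD V (v w : R -> V) : lipschitz_fun v -> lipschitz_fun w ->
  lipschitz_fun (fun t => v t + w t).
Proof.
move=> [L L0 hL] [M M0 hM]; exists (L + M); first exact: addr_ge0.
move=> s t; rewrite opprD addrACA mulrDl; apply: le_trans (rnormD_le _ _) _.
exact: lerD.
Qed.

Lemma lipschitz_scalar V (r : R -> R) L (x : V) : 0 <= L ->
  (forall s t, `|r s - r t| <= L * `|s - t|) -> lipschitz_fun (fun t => (r t)%:C *: x).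
Proof.
move=> L0 hr; exists (L * rnorm x); first by rewrite mulr_ge0 ?rnorm_ge0.
move=> s t; rewrite -scalerBl -rmorphB rnormZr mulrAC ler_wpM2r ?rnorm_ge0 //.
Qed.

Lemma lip_approxD V T (f g : R -> V) : 0 < T -> L2_on `[0, T] f -> L2_on `[0, T] g ->
  lip_approx T f -> lip_approx T g -> lip_approx T (fun t => f t + g t).
Proof.
move=> T0 f2 g2 hf hg e e0; have e4 : 0 < e / 4 by rewrite divr_gt0.
have [v lv vf] := hf _ e4; have [w lw wg] := hg _ e4.
exists (fun t => v t + w t); first exact: lipschitzD.
have -> : sqint `[0, T] (fun t => v t + w t - (f t + g t)) =
    sqint `[0, T] (fun t => (v t - f t) + (w t - g t)).
  by apply: sqint_eq => t _; vlin.
have := sqintD_le (measurable_itv _) (L2B (measurable_itv _) (lipschitz_L2loc lv T0) f2)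
  (L2B (measurable_itv _) (lipschitz_L2loc lw T0) g2).
lra.
Qed.

Lemma lip_approx_lim V T (f : R -> V) : 0 < T -> L2_on `[0, T] f ->
  (forall e : R, 0 < e -> exists g, [/\ L2_on `[0, T] g, lip_approx T g
     & sqint `[0, T] (fun t => g t - f t) <= e]) -> lip_approx T f.
Proof.
move=> T0 f2 hf e e0; have e4 : 0 < e / 4 by rewrite divr_gt0.
have [g [g2 hg gf]] := hf _ e4; have [v lv vg] := hg _ e4.
exists v => //.
have -> : sqint `[0, T] (fun t => v t - f t) = sqint `[0, T] (fun t => (v t - g t) + (g t - f t)).
  by apply: sqint_eq => t _; vlin.
have := sqintD_le (measurable_itv _) (L2B (measurable_itv _) (lipschitz_L2loc lv T0) g2)
  (L2B (measurable_itv _) g2 f2).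
lra.
Qed.

Lemma sqint_scalar V D (r : R -> R) (x : V) : measurable D -> rint D (fun t => r t ^+ 2) ->
  sqint D (fun t => (r t)%:C *: x) = \int[mu]_(t in D) (r t ^+ 2) * rnorm x ^+ 2.
Proof.
move=> mD ri; rewrite /sqint -RintegralZr //; apply: eq_Rintegral => t _.
by rewrite rnormZr exprMn real_normK ?num_real.
Qed.

Lemma indic_L2 V T E (x : V) : measurable E -> L2_on `[0, T] (fun t => (\1_E t : R)%:C *: x).
Proof.
move=> mE; apply: (bounded_L2 (M := rnorm x)).
  apply: smeas_sfun.
  rewrite (_ : (fun t => _) = (fun t => if t \in E then x else 0)).
    by apply: sfun_if => //; exact: sfun_cst.
  by apply/funext => t; rewrite indicE; case: (_ \in _); rewrite ?scale1r ?scale0r.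
move=> t _; rewrite rnormZr indicE; case: (_ \in _); rewrite ?normr1 ?mul1r ?normr0 ?mul0r //.
exact: rnorm_ge0.
Qed.

(** Inner regularity replaces E by a compact subset, whose indicator is the
    pointwise limit of the functions [bump]. *)
Lemma lip_approx_indic V T E (x : V) : 0 < T -> measurable E ->
  lip_approx T (fun t => (\1_E t : R)%:C *: x).
Proof.
move=> T0 mE; set D : set R := `[0, T]%classic.
have mD : measurable D by exact: measurable_itv.
apply: lip_approx_lim => //; first exact: indic_L2.
move=> e e0; have c0 : 0 < e / (rnorm x ^+ 2 + 1).
  by rewrite divr_gt0 //; have := sqr_ge0 (rnorm x); lra.
have mDE : measurable (D `&` E) by exact: measurableI.
have fDE : (mu (D `&` E) < +oo)%E.
  by apply: le_lt_trans (itv_measure_fin 0 T); apply: le_measure => //; rewrite inE.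
have [K [cK KDE muK]] := lebesgue_regularity_inner mDE fDE c0.
have clK : closed K by apply: compact_closed.
have mK : measurable K by exact: closed_measurable.
exists (fun t => (\1_K t : R)%:C *: x); split.
- exact: indic_L2.
- move=> e1 e10.
  have [K0|/set0P K0] := eqVneq K set0.
    exists (fun=> 0); first by exists 0 => // s t; rewrite subrr rnorm0 mul0r.
    by rewrite sqint_eq0 ?(ltW e10) // => t _; rewrite K0 indic0 scale0r subrr.
  pose r n t : R := bump K n t - \1_K t.
  have mr n : measurable_fun D (r n).
    apply: measurable_funB; last exact: measurable_indic.
    apply: measurable_maxr => //; apply: measurable_funB => //.
    apply: measurable_funM => //.
    apply: (measurable_funS measurableT) => //.
    apply: continuous_measurable_fun => t; apply/cvgrPdist_lt => e2 e20.
    apply/nbhs_ballP; exists e2 => // s; rewrite /ball /= => st.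
    exact: le_lt_trans (dist_set_lip _ _ K0) st.
  have r1 n t : `|r n t| <= 1.
    have /andP[b0 b1] := bump_itv n t K0; rewrite /r indicE.
    by case: (_ \in _) => /=; rewrite ler_norml; apply/andP; split; lra.
  have ri n : rint D (fun t => r n t ^+ 2).
    apply: (rint_le mD _ (rint_cst 1 mD (itv_measure_fin 0 T))); first exact: measurable_funX.
    move=> t _; rewrite ger0_norm ?sqr_ge0 // -real_normK ?num_real //.
    by have := r1 n t; have := normr_ge0 (r n t); nra.
  have rcvg t : D t -> r n t @[n --> \oo] --> (0 : R).
    move=> _; have [Kt|Kt] := pselect (K t).
      rewrite (_ : (fun n => _) = fun=> 0); first exact: cvg_cst.
      apply/funext => n; rewrite /r /bump dist_set_in // mulr0 subr0 indicE mem_set //.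
      by rewrite max_r ?subrr.
    have d0 := dist_set_gt0 clK K0 Kt.
    apply/cvgrPdist_lt => e2 e20; exists (Num.truncn (dist_set K t)^-1).+1 => // n /= nn.
    rewrite /r indicE memNset // subr0 sub0r normrN /bump max_l ?normr0 //.
    rewrite subr_le0 -ler_pdivrMr // div1r; apply/ltW/(lt_le_trans (truncnS_gt _)).
    by rewrite ler_nat.
  have := @dominated_convergence _ _ R mu D mD (fun n t => (r n t ^+ 2)%:E) (cst 0%E) (cst 1%E).
  case=> //.
  - by move=> n; apply/measurable_EFinP; exact: (measurable_funX _ (mr n)).
  - apply: ae_of_all => t Dt; apply: cvg_EFin; first exact: nearW.
    rewrite [X in X @ _ --> _](_ : _ = fun n => r n t ^+ 2) //.
    under eq_fun do rewrite expr2; rewrite -(mulr0 (0 : R)).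
    by apply: cvgM; exact: rcvg.
  - exact: (rint_cst 1 mD (itv_measure_fin 0 T)).
  - apply: ae_of_all => t n Dt; rewrite lee_fin ger0_norm ?sqr_ge0 // -real_normK ?num_real //.
    by have := r1 n t; have := normr_ge0 (r n t); nra.
  move=> _ _; rewrite integral0 => h.
  have c1 : 0 < e1 / (rnorm x ^+ 2 + 1).
    by rewrite divr_gt0 //; have := sqr_ge0 (rnorm x); lra.
  have [N _ hN] := h _ (@nbhs_open_ereal_lt R 0 (cst _) c1).
  have := hN N (leqnn _); rewrite /= rint_fin // lte_fin => hN'.
  exists (fun t => (bump K N t)%:C *: x).
    by apply: lipschitz_scalar (ler0n _ N) _ => s t; exact: bump_lip.
  rewrite (_ : sqint _ _ = sqint D (fun t => (r N t)%:C *: x)); last first.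
    by apply: sqint_eq => t _; rewrite /r rmorphB scalerBl.
  rewrite sqint_scalar //; move: hN'; rewrite ltr_pdivlMr; last by have := sqr_ge0 (rnorm x); lra.
  have : 0 <= \int[mu]_(t in D) (r N t ^+ 2) by apply: Rintegral_ge0 => t _; exact: sqr_ge0.
  have := sqr_ge0 (rnorm x); nra.
have mF : measurable ((D `&` E) `\` K) by exact: measurableD.
pose r t : R := \1_((D `&` E) `\` K) t.
have ri : rint D (fun t => r t ^+ 2).
  apply: (rint_le mD _ (rint_cst 1 mD (itv_measure_fin 0 T))).
    by apply: measurable_funX; exact: measurable_indic.
  by move=> t _; rewrite /r indicE; case: (_ \in _) => /=; rewrite ?expr1n ?expr0n ?normr1 ?normr0.
have -> : sqint D (fun t => (\1_K t)%:C *: x - (\1_E t)%:C *: x) = sqint D (fun t => (- r t)%:C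
  *: x).
  apply: sqint_eq => t /set_mem Dt; rewrite -scalerBl -rmorphB /r !indicE.
  congr (_%:C *: _); have [Kt|Kt] := pselect (K t).
    have [_ Et] := KDE t Kt; rewrite (mem_set Kt) (mem_set Et) subrr memNset ?oppr0 //.
    by move=> [_]; apply.
  rewrite (memNset Kt); have [Et|Et] := pselect (E t).
    by rewrite (mem_set Et) mem_set // sub0r.
  by rewrite (memNset Et) memNset ?subrr ?oppr0 // => -[[_ ]].
rewrite sqint_scalar //; last by under eq_fun do rewrite sqrrN.
under eq_Rintegral do rewrite sqrrN.
have : \int[mu]_(t in D) r t ^+ 2 <= e / (rnorm x ^+ 2 + 1).
  rewrite -lee_fin -rint_fin //; apply: le_trans (ltW muK).
  have -> : (\int[mu]_(t in D) (r t ^+ 2)%:E)%E =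
      (\int[mu]_(t in D) (\1_((D `&` E) `\` K) t)%:E)%E.
    by apply: eq_integral => t _; rewrite /r indicE; case: (_ \in _); rewrite ?expr1n ?expr0n.
  rewrite (@integral_indic _ _ _ mu D mD _ mF); apply: le_measure => //; rewrite ?inE //.
  exact: measurableI.
rewrite ler_pdivlMr; last by have := sqr_ge0 (rnorm x); lra.
have : 0 <= \int[mu]_(t in D) (r t ^+ 2) by apply: Rintegral_ge0 => t _; exact: sqr_ge0.
have := sqr_ge0 (rnorm x); nra.
Qed.

Lemma lip_approx_sfun V T (s : R -> V) : 0 < T -> sfun s -> lip_approx T s.
Proof.
move=> T0 [fs ms].
have [L0 hL0] : exists L : seq V, range s = [set` L] by apply/finite_seqP.
pose L := undup L0.
have hL t : s t \in L.
  by rewrite mem_undup; have : [set` L0] (s t) by rewrite -hL0; exists t.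
have sE : s = fun t => \sum_(v <- L) ((\1_(s @^-1` [set v]) t : R)%:C *: v).
  apply/funext => t; rewrite (bigD1_seq (s t)) ?undup_uniq //=.
  rewrite big1 ?addr0 => [|v /eqP vs]; first by rewrite indicE mem_set ?scale1r.
  by rewrite indicE memNset ?scale0r //= => sv; apply: vs.
rewrite sE; elim: L {hL sE} => [|v L IH].
  move=> e e0; exists (fun=> 0); first by exists 0 => // a b; rewrite subrr rnorm0 mul0r.
  by rewrite sqint_eq0 ?(ltW e0) // => t _; rewrite big_nil subrr.
have [IH1 IH2] : L2_on `[0, T] (fun t => \sum_(v <- L) ((\1_(s @^-1` [set v]) t : R)%:C *: v)) /\
   lip_approx T (fun t => \sum_(v <- L) ((\1_(s @^-1` [set v]) t : R)%:C *: v)).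
  split=> //; elim: L {IH} => [|w L IH].
    rewrite (_ : (fun t => _) = fun=> 0); first exact: L2_cst (itv_measure_fin _ _).
    by apply/funext => t; rewrite big_nil.
  rewrite (_ : (fun t => _) = fun t => (\1_(s @^-1` [set w]) t : R)%:C *: w +
      \sum_(v <- L) ((\1_(s @^-1` [set v]) t : R)%:C *: v)); last first.
    by apply/funext => t; rewrite big_cons.
  by apply: L2D => //; exact: indic_L2.
rewrite (_ : (fun t => _) = fun t => (\1_(s @^-1` [set v]) t : R)%:C *: v +
    \sum_(v <- L) ((\1_(s @^-1` [set v]) t : R)%:C *: v)); last first.
  by apply/funext => t; rewrite big_cons.
apply: lip_approxD => //; [exact: indic_L2|exact: lip_approx_indic].
Qed.

Lemma lipschitz_dense0 V T (f : R -> V) : 0 < T -> L2_on `[0, T] f -> lip_approx T f.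
Proof.
move=> T0 f2; apply: lip_approx_lim => // e e0.
set D : set R := `[0, T]%classic.
have mD : measurable D by exact: measurable_itv.
have [s [ss sf sle]] := smeas_approx mD (L2_smeas f2).
have s2 n : L2_on D (s n).
  apply: (L2_le (h := fun t => 2 * rnorm (f t) ^+ 2 + 2 * rnorm (f t) ^+ 2)) => //.
  - exact: smeas_sfun.
  - by apply: rintD => //; apply: rintZ => //; exact: L2_rint.
  move=> t Dt; have -> : s n t = f t + (s n t - f t) by vlin.
  rewrite rnorm_sqD.
  have := @rdot_young _ _ 1 (f t) (s n t - f t) ltr01; rewrite invr1 !mul1r.
  have : rnorm (s n t - f t) ^+ 2 <= rnorm (f t) ^+ 2.
    by rewrite rnormB ler_pXn2r ?nnegrE ?rnorm_ge0 // sle.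
  lra.
have d2 n : L2_on D (fun t => s n t - f t) by exact: L2B.
have := @dominated_convergence _ _ R mu D mD (fun n t => (rnorm (s n t - f t) ^+ 2)%:E)
  (cst 0%E) (fun t => (rnorm (f t) ^+ 2)%:E).
case=> //.
- by move=> n; apply/measurable_EFinP; exact: (smeas_rnorm2 mD (L2_smeas (d2 n))).
- apply: ae_of_all => t Dt; apply: cvg_EFin; first exact: nearW.
  rewrite [X in X @ _ --> _](_ : _ = fun n => rnorm (s n t - f t) ^+ 2) //.
  under eq_fun do rewrite expr2; rewrite -(mulr0 (0 : R)).
  by apply: cvgM; apply/cvg_rnorm0; exact: sf.
- exact: L2_rint.
- apply: ae_of_all => t n Dt; rewrite lee_fin ger0_norm ?sqr_ge0 //.
  by rewrite rnormB ler_pXn2r ?nnegrE ?rnorm_ge0 // sle.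
move=> _ _; rewrite integral0 => h.
have [N _ hN] := h _ (@nbhs_open_ereal_lt R 0 (cst _) e0).
have := hN N (leqnn _); rewrite /= sqintE // lte_fin => hN'.
exists (s N); split=> //; [exact: lip_approx_sfun|exact: ltW].
Qed.

(** Adding a tent of height a - v 0 on a short interval next to 0 prescribes the
    value at 0 at a small cost in L^2. *)
Lemma lipschitz_dense V T (f : R -> V) (a : V) (e : R) : 0 < T -> 0 < e -> L2_on `[0, T] f ->
  exists v, [/\ lipschitz_fun v, v 0 = a & sqint `[0, T] (fun t => v t - f t) <= e].
Proof.
move=> T0 e0 f2; have e4 : 0 < e / 4 by rewrite divr_gt0.
have [v lv vf] := lipschitz_dense0 T0 f2 e4.
pose c := rnorm (a - v 0) ^+ 2.
have c0 : 0 <= c by exact: sqr_ge0.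
(* The tent is narrower than T, and its squared L^2 norm is at most c / n. *)
pose n := (Num.truncn ((c + 1) / (e / 4) + T^-1)).+1.
have nE : (c + 1) / (e / 4) + T^-1 < n%:R by exact: truncnS_gt.
have i1 : 0 < (c + 1) / (e / 4) by rewrite divr_gt0 //; lra.
have i2 : 0 < T^-1 by rewrite invr_gt0.
have n0 : 0 < n%:R :> R by rewrite ltr0n.
have nT : n%:R^-1 <= T by rewrite invf_ple ?posrE // ltW //; lra.
have nc : c / n%:R <= e / 4.
  rewrite ler_pdivrMr // mulrC -ler_pdivrMr //.
  apply: le_trans (_ : (c + 1) / (e / 4) <= _); last lra.
  by rewrite ler_pM2r ?invr_gt0 //; lra.
pose K : set R := [set 0].
have K0 : K !=set0 by exists 0.
pose b t := bump K n t.
pose w t := (b t)%:C *: (a - v 0).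
have lw : lipschitz_fun w by apply: lipschitz_scalar (ler0n _ n) _ => s t; exact: bump_lip.
have dE t : 0 <= t -> dist_set K t = t.
  move=> t0; rewrite /dist_set; have -> : [set `|t - k| | k in K] = [set t].
    apply/seteqP; split=> [_ [k -> <-]|_ ->]; rewrite /= ?subr0 ?ger0_norm //.
    by exists 0; rewrite //= subr0 ger0_norm.
  exact: inf1.
exists (fun t => v t + w t); split; first exact: lipschitzD.
  rewrite /w /b /bump dE // mulr0 subr0 max_r // scale1r; vlin.
have -> : sqint `[0, T] (fun t => v t + w t - f t) = sqint `[0, T] (fun t => (v t - f t) + w t).
  by apply: sqint_eq => t _; vlin.
have w2 := lipschitz_L2loc lw T0.
have := sqintD_le (measurable_itv _) (L2B (measurable_itv _) (lipschitz_L2loc lv T0) f2) w2.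
suff : sqint `[0, T] w <= e / 4 by lra.
apply: le_trans nc.
have Qw : sqint `[0, T] w = sqint `[0, n%:R^-1] w.
  have <- : sqint `[0, T] (trunc n%:R^-1 w) = sqint `[0, n%:R^-1] w.
    by apply: sqint_trunc => //; exact: subset_itvcc.
  apply: sqint_eq => t; rewrite inE /= in_itv /= => /andP[t0 tT].
  have [tn|tn] := leP t n%:R^-1; first by rewrite trunc_in // t0.
  rewrite trunc_out; last by rewrite t0 /= -ltNge.
  rewrite /w /b /bump dE // max_l ?scale0r // subr_le0 mulrC -ler_pdivrMr // div1r.
  exact: ltW.
rewrite Qw; apply: sqint_bound; first by rewrite invr_ge0 ltW.
  by apply: L2_sub w2 => //; exact: subset_itvcc.
move=> t _; rewrite /w rnormZr exprMn; have /andP[b0 b1] := bump_itv n t K0.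
rewrite ger0_norm // -/c; have : b t ^+ 2 <= 1 by rewrite expr_le1.
rewrite /b; nra.
Qed.

End Density.

(** * Density of the domain of a generator *)

Section Semigroups.
Context {R : realType}.
Local Notation mu := (@lebesgue_measure R).
Local Notation rint D f := (mu.-integrable D (EFin \o f)).
Implicit Types (V W : hilbertType R) (D : set R) (h t s : R).

Lemma bounded_linearD V W (F : V -> W) : bounded_linear F ->
  forall x y, F (x + y) = F x + F y.
Proof. by move=> [lF _] x y; have := lF 1 x y; rewrite !scale1r. Qed.

Lemma bounded_linear0 V W (F : V -> W) : bounded_linear F -> F 0 = 0.
Proof.
move=> lF; have := bounded_linearD lF 0 0; rewrite addr0 => /eqP.
by rewrite -subr_eq subrr eq_sym => /eqP.
Qed.

Lemma bounded_linearZ V W (F : V -> W) : bounded_linear F ->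
  forall (a : R[i]) x, F (a *: x) = a *: F x.
Proof.
by move=> lF a x; have := lF.1 a x 0; rewrite !addr0 bounded_linear0 // addr0.
Qed.

Lemma bounded_linearB V W (F : V -> W) : bounded_linear F ->
  forall x y, F (x - y) = F x - F y.
Proof.
move=> lF x y; rewrite bounded_linearD // -scaleN1r bounded_linearZ //.
by rewrite scaleN1r.
Qed.

Lemma bounded_linear_bound V W (F : V -> W) : bounded_linear F ->
  exists2 M, 0 <= M & forall x, rnorm (F x) <= M * rnorm x.
Proof.
move=> lF; have [_ /(_ 0) cF] := lF.
have /cvg_rnormP/(_ 1 ltr01) := cF; rewrite bounded_linear0 //.
move=> /nbhs_ballP[/= e e0 he].
have er : e = (complex.Re e)%:C.
  by move: e0; case: (e) => a b; rewrite ltcE /= => /andP[/eqP -> _].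
have d0 : 0 < complex.Re e by move: e0; rewrite er ltcR.
set d := complex.Re e in er d0.
exists (2 / d); first by rewrite divr_ge0 // ltW.
move=> x; have [x0|x0] := eqVneq (rnorm x) 0.
  by rewrite (rnorm_eq0 x0) bounded_linear0 // !rnorm0 mulr0.
have xp : 0 < rnorm x by rewrite lt_def x0 rnorm_ge0.
pose a := d / 2 / rnorm x.
have a0 : 0 < a by rewrite /a !divr_gt0.
have := he (a%:C *: x); rewrite -ball_normE /= sub0r normrN norm_rnorm er ltcR.
rewrite rnormZr gtr0_norm // /a divfK //.
have d2 : d / 2 < d by lra.
move=> /(_ d2); rewrite subr0 bounded_linearZ // rnormZr gtr0_norm // /a => h.
have -> : 2 / d * rnorm x = a^-1 by rewrite /a; field; rewrite x0 gt_eqF.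
by rewrite -div1r ler_pdivlMr // mulrC ltW.
Qed.

Lemma real_linear_comp V W (F : V -> W) z : bounded_linear F ->
  real_linear (fun x => rdot (F x) z).
Proof.
move=> lF; have [M M0 hM] := bounded_linear_bound lF.
split=> [x y|a x|].
- by rewrite bounded_linearD // rdotDl.
- by rewrite bounded_linearZ // rdotZl.
exists (M * rnorm z) => x; apply: le_trans (rdot_le _ _) _.
by rewrite mulrAC ler_wpM2r ?rnorm_ge0.
Qed.

Lemma near0P (P : R -> Prop) :
  (\forall h \near 0^'+, P h) <-> exists2 d : R, 0 < d & forall h, 0 < h -> h < d -> P h.
Proof.
rewrite /at_right near_withinE; split=> [/nbhs_ballP[d d0 hd]|[d d0 hd]].
  by exists d => // h h0 hd'; apply: hd => //; rewrite /ball /= sub0r normrN gtr0_norm.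
apply/nbhs_ballP; exists d => // h; rewrite /ball /= sub0r normrN => hd' h0.
by apply: hd => //; rewrite -(gtr0_norm h0).
Qed.

Lemma cvg_right0P V (f : R -> V) l : f h @[h --> 0^'+] --> l <-> forall e, 0 < e ->
  exists2 d : R, 0 < d & forall h, 0 < h -> h < d -> rnorm (f h - l) < e.
Proof.
rewrite cvg_rnormP; split=> h e e0; first exact/near0P/h.
by apply/near0P/h.
Qed.

Section Orbit.
Variables (V : hilbertType R) (T : R -> V -> V) (hT : C0_semigroup T) (x : V).

Lemma orbit_right_cvg t : 0 <= t -> forall e : R, 0 < e -> exists2 d : R, 0 < d &
  forall s, t <= s -> s < t + d -> rnorm (T s x - T t x) < e.
Proof.
case: hT => lT T0 TD cT t0 e e0.
have [M M0 hM] := bounded_linear_bound (lT t t0).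
have M1 : 0 < M + 1 by lra.
have [d d0 hd] := (cvg_right0P _ _).1 (cT x) (e / (M + 1)) (divr_gt0 e0 M1).
exists d => // s ts std; have [->|st] := eqVneq s t; first by rewrite subrr rnorm0.
have st' : 0 < s - t by rewrite subr_gt0 lt_neqAle eq_sym st.
have -> : T s x = T t (T (s - t) x) by rewrite -TD ?(ltW st') //; congr (T _ x); ring.
rewrite -bounded_linearB; last exact: lT.
apply: le_lt_trans (hM _) _.
have := hd _ st'; rewrite ltrBlDl => /(_ std); rewrite ltr_pdivlMr //.
have := rnorm_ge0 (T (s - t) x - x); nra.
Qed.

(** Strong continuity at 0 bounds the orbit on a short interval only, whence the
    restriction b < d. *)
Lemma orbit_L2 d : 0 < d -> (forall h, 0 < h -> h < d -> rnorm (T h x - x) < 1) ->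
  forall a b, 0 <= a -> b < d -> L2_on `[a, b] (fun s => T s x).
Proof.
case: (hT) => lT T0 TD cT d0 hd a b a0 bd.
have [b0|b0] := ltP b 0.
  apply: L2_onI => //; rewrite set_itv_ge ?bnd_simp -?ltNge ?(lt_le_trans b0) //.
  - by exists (fun _ _ => 0); split=> // _; exact: sfun_cst.
  - exact: integrable_set0.
apply: (@L2_sub _ _ `[0, b]); rewrite //; first exact: subset_itvcc.
apply: (bounded_L2 (M := rnorm x + 1)).
  apply: right_cvg_smeas => t /andP[t0 _] e e0.
  by have [d1 d10 h1] := orbit_right_cvg t0 e0; exists d1 => // s ts st _; exact: h1.
move=> t /andP[t0 tb]; have -> : T t x = x + (T t x - x) by vlin.
apply: le_trans (rnormD_le _ _) _; rewrite lerD2l.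
have [->|tn] := eqVneq t 0; first by rewrite T0 subrr rnorm0.
by apply/ltW/hd; [rewrite lt_neqAle eq_sym tn|exact: le_lt_trans bd].
Qed.

Lemma orbit_mean a e d b v : 0 < b -> b < d ->
  L2_on `[a, a + b] (fun s => T s x) ->
  (forall s, a <= s -> s < a + d -> rnorm (T s x - T a x) < e) ->
  weak_int `[a, a + b] (fun s => T s x) v -> rnorm (v - b%:C *: T a x) <= b * e.
Proof.
move=> b0 bd L hd hv.
have mD : measurable (`[a, a + b] : set R) by exact: measurable_itv.
have fD := itv_measure_fin a (a + b).
have Lc := L2_cst (T a x) mD fD.
have hc : weak_int `[a, a + b] (fun=> T a x) (b%:C *: T a x).
  by move=> z; rewrite Rintegral_itv_cst ?rdotZl; [ring|lra].
apply: le_trans (weak_int_dist_le mD (L2_smeas L) (L2_smeas Lc) (L2_rint1 mD fD L)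
  (L2_rint1 mD fD Lc) hv hc) _.
have := @Rintegral_itv_cst R a (a + b) e; rewrite addrAC subrr add0r mulrC => <-; last lra.
apply: le_Rintegral; rewrite //.
- exact: L2_rint1 (L2B mD L Lc).
- exact: rint_cst.
move=> s; rewrite /= in_itv /= => /andP[as_ sb]; apply/ltW/hd => //.
by apply: le_lt_trans sb _; rewrite ltrD2l.
Qed.

End Orbit.

(** The mean of the orbit of x over [0, h] tends to x as h tends to 0, and it
    lies in the domain: T t moves the window [0, h] by t, so that the difference
    quotient is a difference of means over [h, h + t] and [0, t], which tends to
    (T h x - x) / h. *)
Lemma generator_dense V (T : R -> V -> V) dom A : C0_semigroup T -> is_generator T dom A ->
  forall x e, 0 < e -> exists2 v, dom v & rnorm (v - x) <= e.
Proof.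
move=> hT gT x e e0; have [lT T0 TD cT] := hT.
have [d1 d10 hd1] := (cvg_right0P _ _).1 (cT x) 1 ltr01.
have [d2 d20 hd2] := orbit_right_cvg hT x (lexx 0) e0.
pose h := Num.min d1 d2 / 2.
have dm : 0 < Num.min d1 d2 by rewrite lt_min d10.
have h0 : 0 < h by rewrite divr_gt0.
have [hl1 hl2] : h < d1 /\ h < d2.
  have : h < Num.min d1 d2 by rewrite /h; lra.
  by rewrite lt_min => /andP.
clearbody h.
have L := orbit_L2 hT d10 hd1.
have mD a b : measurable (`[a, b] : set R) by exact: measurable_itv.
have L0 := L 0 h (lexx 0) hl1.
have [v hv] := weak_int_exists (mD 0 h) (itv_measure_fin 0 h) (L2_smeas L0) (L2_rint1 (mD 0 h)
  (itv_measure_fin 0 h) L0).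
have diff t : 0 < t -> h + t < d1 -> exists a b,
    [/\ weak_int `[0, 0 + t] (fun s => T s x) a, weak_int `[h, h + t] (fun s => T s x) b
      & T t v - v = b - a].
  move=> t0 htd.
  have Lt : L2_on `[0, t] (fun s => T s x) by apply: L => //; lra.
  have Lh : L2_on `[h, h + t] (fun s => T s x) by apply: L => //; lra.
  have Lht : L2_on `[0, h + t] (fun s => T s x) by apply: L => //.
  have [a ha] := weak_int_exists (mD 0 t) (itv_measure_fin 0 t) (L2_smeas Lt) (L2_rint1 (mD _ _)
    (itv_measure_fin _ _) Lt).
  have [b hb] := weak_int_exists (mD h (h + t)) (itv_measure_fin _ _) (L2_smeas Lh) (L2_rint1 (mD
    _ _) (itv_measure_fin _ _) Lh).
  exists a, b; split; rewrite ?add0r //; apply: rdot_ext => z.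
  have bv := weak_int_bochner (mD _ _) (itv_measure_fin _ _) (L2_smeas L0) (L2_rint1 (mD _ _)
    (itv_measure_fin 0 h) L0) hv.
  have [_ E] := bochner_lin (mD _ _) (itv_measure_fin _ _) (real_linear_comp z (lT t (ltW t0))) bv.
  rewrite !rdotBl E hv ha hb.
  have rz : rint `[0, h + t] (fun s => rdot (T s x) z).
    by exact: (rdot_rint (mD _ _) Lht (L2_cst z (mD _ _) (itv_measure_fin _ _))).
  rewrite (@rint_itvB _ _ 0 h (h + t)) //; last by apply/andP; split; lra.
  have -> : \int[mu]_(s in `[0, h]) rdot (T t (T s x)) z =
            \int[mu]_(s in `[t, h + t]) rdot (T s x) z.
    have <- := @Rintegral_shift R t `[t, h + t] (fun s => rdot (T s x) z) (mD _ _).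
      rewrite shift_itvcc subrr addrK; apply: eq_Rintegral => s.
      by rewrite inE /= in_itv /= => /andP[s0 _]; rewrite addrC TD // ltW.
    by apply: (rint_sub (mD _ _) (mD _ _) _ rz); apply: subset_itvcc => //; exact: ltW.
  rewrite (@rint_itvB _ _ 0 t (h + t)) //; last by apply/andP; split; lra.
  ring.
exists (h^-1%:C *: v).
  suff : (dom (h^-1%:C *: v) /\ A (h^-1%:C *: v) = h^-1%:C *: (T h x - x)) by case.
  apply/gT.
  apply/cvg_right0P => e1 e10.
  pose e2 := h * e1 / 4; have e20 : 0 < e2 by rewrite /e2 divr_gt0 // mulr_gt0.
  have [d3 d30 hd3] := orbit_right_cvg hT x (lexx 0) e20.
  have [d4 d40 hd4] := orbit_right_cvg hT x (ltW h0) e20.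
  exists (Num.min (d1 - h) (Num.min d3 d4)); first by rewrite !lt_min subr_gt0 hl1 d30.
  move=> t t0; rewrite !lt_min => /and3P[td1 td3 td4].
  have [||a [b [ha hb E]]] := diff t => //; first lra.
  rewrite (bounded_linearZ (lT t (ltW t0))).
  have na : rnorm (a - t%:C *: T 0 x) <= t * e2.
    apply: (orbit_mean (d := d3) t0 td3 _ _ ha) => //.
    by apply: L => //; lra.
  have nb : rnorm (b - t%:C *: T h x) <= t * e2.
    apply: (orbit_mean (d := d4) t0 td4 _ _ hb) => //.
    by apply: L => //; lra.
  have -> : t^-1%:C *: (h^-1%:C *: T t v - h^-1%:C *: v) - h^-1%:C *: (T h x - x) =
     (t^-1 * h^-1)%:C *: ((b - t%:C *: T h x) - (a - t%:C *: T 0 x)).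
    rewrite T0 [in LHS](_ : T t v = v + (b - a)); last by rewrite -E; vlin.
    apply: rdot_ext => z; rewrite !(rdotBl, rdotZl, rdotDl, rdotNl).
    by move: (rdot b z) (rdot a z) (rdot v z) (rdot x z) (rdot (T h x) z) => *; field;
      rewrite !gt_eqF.
  rewrite rnormZr gtr0_norm ?mulr_gt0 ?invr_gt0 //.
  apply: le_lt_trans (_ : t^-1 * h^-1 * (t * e2 + t * e2) < _).
    rewrite ler_pM2l ?mulr_gt0 ?invr_gt0 //; apply: le_trans (rnormB_le _ _) _.
    exact: lerD.
  have -> : t^-1 * h^-1 * (t * e2 + t * e2) = e1 / 2.
    by rewrite /e2; field; rewrite !gt_eqF.
  lra.
have hn : rnorm (v - h%:C *: T 0 x) <= h * e.
  apply: (orbit_mean (d := d2) h0 hl2) => //.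
  - by rewrite add0r.
  - by rewrite add0r.
have -> : h^-1%:C *: v - x = h^-1%:C *: (v - h%:C *: T 0 x).
  by apply: rdot_ext => z; rewrite T0 !(rdotBl, rdotZl); field; rewrite gt_eqF.
by rewrite rnormZr gtr0_norm ?invr_gt0 // mulrC ler_pdivrMr // mulrC.
Qed.

End Semigroups.

(** * Energy balance of passive nodes *)

Section Energy.
Context {R : realType}.
Local Notation mu := (@lebesgue_measure R).
Local Notation rint D f := (mu.-integrable D (EFin \o f)).
Implicit Types (V : hilbertType R) (D : set R) (tau h T : R).

Lemma has_deriv_continuous V (x dx : R -> V) : (forall t, 0 <= t -> has_deriv x t (dx t)) ->
  continuous_halfline x.
Proof.
move=> hx; apply/continuous_halflineP => t t0 e e0.
have [d d0 hd] := (has_derivP _ _ _).1 (hx t t0) 1 ltr01.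
pose M := rnorm (dx t) + 1; have M0 : 0 < M by rewrite /M; have := rnorm_ge0 (dx t); lra.
exists (Num.min d (e / M)); first by rewrite lt_min d0 divr_gt0.
move=> s s0; rewrite lt_min ltr_pdivlMr // => /andP[sd sM].
have [->|st] := eqVneq s t; first by rewrite subrr rnorm0.
have ne : s - t != 0 by rewrite subr_eq0.
have := hd _ ne sd; rewrite (_ : t + (s - t) = s); last by ring.
move=> /(_ s0) hds; apply: le_lt_trans sM.
have -> : x s - x t = (s - t)%:C *: ((s - t)^-1%:C *: (x s - x t) - dx t + dx t).
  by rewrite subrK scalerA -rmorphM divff // scale1r.
rewrite rnormZr ler_wpM2l //; apply: le_trans (rnormD_le _ _) _; rewrite /M; lra.
Qed.

Lemma cont_on_cvg V T (x : R -> V) t : cont_on T x -> 0 <= t <= T ->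
  x s @[s --> within `[0, T]%classic (nbhs t)] --> x t.
Proof.
move=> cx tT; apply/cvg_rnormP => e e0; have [d d0 hd] := cx t tT e e0.
rewrite near_withinE; apply/nbhs_ballP; exists d => // s.
by rewrite /ball /= distrC in_itv /= => st sT; exact: hd.
Qed.

Lemma cont_on_cvg_in V T (x : R -> V) t : cont_on T x -> 0 < t < T ->
  x s @[s --> t] --> x t.
Proof.
move=> cx /andP[t0 tT]; have tT' : 0 <= t <= T by rewrite !ltW.
apply/cvg_rnormP => e e0; have [d d0 hd] := cx t tT' e e0.
apply/nbhs_ballP; exists (Num.min d (Num.min t (T - t))).
  by rewrite /= !lt_min d0 t0 subr_gt0.
move=> s; rewrite /ball /= distrC !lt_min => /and3P[sd st sT]; apply: hd => //.
by move: st sT; rewrite !ltr_norml => /andP[? ?] /andP[? ?]; apply/andP; split; lra.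
Qed.

Lemma cont_on_rdot V T (x y : R -> V) : cont_on T x -> cont_on T y ->
  {within `[0, T], continuous (fun t => rdot (x t) (y t))}.
Proof.
move=> cx cy; apply/subspace_continuousP => t; rewrite /= in_itv /= => tT.
by apply: cvg_rdot; exact: cont_on_cvg.
Qed.

Lemma has_deriv_sq V (x : R -> V) T t v : cont_on T x -> 0 < t < T -> has_deriv x t v ->
  is_derive t 1 (fun s => rnorm (x s) ^+ 2) (2 * rdot v (x t)).
Proof.
move=> cx tT hv; have /andP[t0 _] := tT.
suff h : (h^-1 *: (rnorm (x (h *: 1 + t)) ^+ 2 - rnorm (x t) ^+ 2)) @[h --> 0^'] -->
  2 * rdot v (x t).
  by apply: DeriveDef; [apply/cvg_ex; eexists; exact: h|exact: cvg_lim h].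
have hv' : (h^-1)%:C *: (x (t + h) - x t) @[h --> 0^'] --> v.
  apply/cvg_rnormP => e e0; have [d d0 hd] := (has_derivP _ _ _).1 hv e e0.
  rewrite near_withinE; apply/nbhs_ballP; exists (Num.min d t); first by rewrite /= lt_min d0.
  move=> h; rewrite /ball /= sub0r normrN lt_min => /andP[h1 h2] h0; apply: hd => //.
  by move: h2; rewrite ltr_norml => /andP[]; lra.
have hx : x (t + h) + x t @[h --> 0^'] --> x t + x t.
  apply: cvgD; last exact: cvg_cst.
  apply: cvg_within_filter; apply: (cvg_comp _ _ _ (cont_on_cvg_in cx tT)).
  apply/cvgrPdist_lt => e e0; apply/nbhs_ballP; exists e => // h.
  by rewrite /ball /= sub0r opprD addrA subrr sub0r.
rewrite (_ : 2 * rdot v (x t) = rdot v (x t + x t)); last by rewrite rdotDr; ring.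
rewrite (_ : (fun h => _) = fun h => rdot ((h^-1)%:C *: (x (t + h) - x t)) (x (t + h) + x t)).
  exact: cvg_rdot hv' hx.
apply/funext => h; rewrite rdotZl rdotBl !rdotDr !rdotxx (_ : h *: 1 = h) ?(addrC h).
  by rewrite (rdotC (x t)) /GRing.scale /=; ring.
exact: mulr1.
Qed.

(** By passivity |x|^2 minus twice the energy supplied so far has a nonpositive
    derivative. *)
Lemma passive_energy (U X : hilbertType R) (S : systemNode U X U) (x : R -> X) (w y : R -> U) :
  impedance_passive S -> continuous_halfline w -> continuous_halfline y ->
  (forall t, 0 <= t -> [/\ sn_dom S (x t, w t), has_deriv x t (sn_op S (x t, w t)).1
     & y t = (sn_op S (x t, w t)).2]) ->
  forall t, 0 <= t -> rnorm (x t) ^+ 2 <= rnorm (x 0) ^+ 2 + 2 * L2dot `[0, t] y w.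
Proof.
move=> pS cw cy hx t; rewrite le_eqVlt => /predU1P[<-|t0].
  by rewrite /L2dot set_itv1 Rintegral_set1 mulr0 addr0.
have cx : continuous_halfline x.
  by apply: (has_deriv_continuous (dx := fun t => (sn_op S (x t, w t)).1)) => s /hx[].
pose T := t + 1; have T0 : 0 < T by rewrite /T; lra.
have [cxT cwT cyT] : [/\ cont_on T x, cont_on T w & cont_on T y].
  by split; exact: halfline_cont_on.
pose f s := rdot (y s) (w s).
have fi : rint `[0, T] f by apply: rdot_rint => //; apply: cont_on_L2.
pose F s := \int[mu]_(r in `[0, s]) f r.
have dF s : 0 < s < T -> is_derive s 1 F (f s).
  move=> sT; have /andP[s0 s1] := sT.
  have cf : {for s, continuous f}.
    by apply: cvg_rdot; [exact: cont_on_cvg_in cyT sT|exact: cont_on_cvg_in cwT sT].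
  have [d1 d2] := continuous_FTC1_closed s1 fi s0 cf.
  have d3 : 'D_1 F s = f s by rewrite -derive1E.
  exact: (DeriveDef d1 d3).
pose g s := rnorm (x s) ^+ 2 - 2 * F s.
have dg s : 0 < s < T -> is_derive s 1 g (2 * rdot (sn_op S (x s, w s)).1 (x s) - 2 * f s).
  move=> sT; have /andP[s0 s1] := sT; have [_ hd _] := hx s (ltW s0).
  have h1 := has_deriv_sq cxT sT hd; have h2 := dF s sT.
  exact: (is_deriveB h1 (is_deriveZ 2 h2)).
suff : g t <= g 0.
  by rewrite /g /F set_itv1 Rintegral_set1 /L2dot -/f; lra.
have cg : {within `[0, t], continuous g}.
  apply: (@continuous_subspaceW _ _ `[0, t] `[0, T]).
    by apply: subset_itvcc => //; rewrite /T; lra.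
  move=> s; apply: cvgB.
    have := cont_on_rdot cxT cxT; rewrite (_ : (fun s => rdot (x s) (x s)) = fun s => rnorm (x s)
      ^+ 2).
      exact.
    by apply/funext => r; rewrite rdotxx.
  apply: cvgM; first exact: cvg_cst.
  exact: (parameterized_integral_continuous (ltW T0) fi).
apply: (ler0_derive1_le_cc _ _ cg); rewrite ?in_itv /= ?lexx ?(ltW t0) //.
- move=> s; rewrite in_itv /= => /andP[s0 s1]; have sT : 0 < s < T by rewrite s0 /= /T; lra.
  by have [] := dg s sT.
- move=> s; rewrite in_itv /= => /andP[s0 s1]; have sT : 0 < s < T by rewrite s0 /= /T; lra.
  have [_ dgs] := dg s sT; rewrite derive1E dgs /f; have [hd _ ->] := hx s (ltW s0).
  by have := pS _ _ hd; rewrite -!/(rdot _ _); lra.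
Qed.

End Energy.

(** * Convergence in L^2 and uniform convergence *)

Section Limits.
Context {R : realType}.
Local Notation mu := (@lebesgue_measure R).
Implicit Types (V W : hilbertType R) (D : set R) (tau h T : R).

Lemma cvgn_real0P (a : nat -> R) : (forall n, 0 <= a n) ->
  a @ \oo --> (0 : R) <-> forall e : R, 0 < e -> exists N, forall n, (N <= n)%N -> a n < e.
Proof.
move=> a0; split=> [/cvgrPdist_lt ha e /ha[N _ hN]|ha].
  by exists N => n /hN; rewrite sub0r normrN ger0_norm.
apply/cvgrPdist_lt => e /ha[N hN]; exists N => // n /hN.
by rewrite sub0r normrN ger0_norm.
Qed.

Lemma uniformP V (D : set R) (f : nat -> R -> V) (g : R -> V) :
  {uniform D, f @ \oo --> g} <-> forall e : R, 0 < e ->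
    exists N, forall n, (N <= n)%N -> forall t, D t -> rnorm (f n t - g t) < e.
Proof.
split=> [h e e0|h].
  have e0' : 0 < e%:C by rewrite ltcR.
  pose A : set {uniform` D -> V} := [set k | forall t, D t -> rnorm (k t - g t) < e].
  have nA : nbhs (g : {uniform` D -> V}) A.
    apply/uniform_nbhs; exists [set xy | ball xy.1 (PosNum e0')%:num xy.2]; split.
      exact: entourage_ball.
    move=> k hk t Dt; have := hk t Dt; rewrite -ball_normE /= norm_rnorm ltcR.
    by rewrite rnormB.
  have [N _ hN] := h _ nA; exists N => n nN t Dt; exact: (hN n nN t Dt).
move=> A /uniform_nbhs[E [eE hA]].
move: eE; rewrite -entourage_from_ballE => -[e /= e0 he].
have er : e = (complex.Re e)%:C.
  by move: e0; case: (e) => a b; rewrite ltcE /= => /andP[/eqP -> _].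
have e0' : 0 < complex.Re e by move: e0; rewrite er ltcR.
have [N hN] := h _ e0'; exists N => // n nN; apply: hA => t Dt; apply: he.
by rewrite /= -ball_normE /= norm_rnorm er ltcR rnormB; exact: hN.
Qed.

Lemma L2norm_cvg0 V D (f : nat -> R -> V) : measurable D -> (forall n, L2_on D (f n)) ->
  L2norm D (f n) @[n --> \oo] --> 0%E <-> sqint D (f n) @[n --> \oo] --> (0 : R).
Proof.
move=> mD f2.
have -> : (fun n => L2norm D (f n)) = fun n => (Num.sqrt (sqint D (f n)))%:E.
  by apply/funext => n; rewrite L2norm_sqint.
split=> h.
  have h1 : Num.sqrt (sqint D (f n)) @[n --> \oo] --> (0 : R) by exact: (@fine_cvg _ _ _ _ _ 0 h).
  rewrite (_ : (fun n => _) = fun n => Num.sqrt (sqint D (f n)) * Num.sqrt (sqint D (f n))).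
    by rewrite -(mulr0 (0 : R)); exact: cvgM.
  by apply/funext => n; rewrite -expr2 sqr_sqrtr ?sqint_ge0.
apply: cvg_EFin; first exact: nearW.
rewrite [X in X @ _ --> _](_ : _ = fun n => Num.sqrt (sqint D (f n))) //.
rewrite -(sqrtr0 R); apply: (cvg_comp _ _ h); exact: sqrt_continuous.
Qed.

(** Convergence in L^2(D). *)
Definition sqint_cvg V D (f : nat -> R -> V) (g : R -> V) : Prop :=
  sqint D (fun t => f n t - g t) @[n --> \oo] --> (0 : R).

Lemma sqint_cvg_sqint V D (f : nat -> R -> V) (g : R -> V) : measurable D ->
  (forall n, L2_on D (f n)) -> L2_on D g -> sqint_cvg D f g -> sqint D (f n) @[n --> \oo] -->
    sqint D g.
Proof.
move=> mD f2 g2 fg.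
have h : Num.sqrt (sqint D (fun t => f n t - g t)) @[n --> \oo] --> (0 : R).
  by rewrite -(sqrtr0 R); apply: (@cvg_comp _ _ _ _ Num.sqrt _ _ _ fg); exact: sqrt_continuous.
have hs : Num.sqrt (sqint D (f n)) @[n --> \oo] --> Num.sqrt (sqint D g).
  apply: (@squeeze_cvgr _ _ _ R (fun n => Num.sqrt (sqint D g) - Num.sqrt (sqint D (fun t => f n
    t - g t)))
    (fun n => Num.sqrt (sqint D g) + Num.sqrt (sqint D (fun t => f n t - g t))) (fun n =>
      Num.sqrt (sqint D (f n)))).
  - apply: nearW => n; have d2 := L2B mD (f2 n) g2; apply/andP; split.
      have := sqrt_sqintD mD (f2 n) (L2B mD g2 (f2 n)).
      rewrite (_ : (fun t => _) = g) ?(sqint_distC D g); first by lra.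
      by apply/funext => t; vlin.
    have := sqrt_sqintD mD g2 d2.
    rewrite (_ : (fun t => _) = f n); first by lra.
    by apply/funext => t; vlin.
  - by rewrite -[X in _ --> X]subr0; apply: cvgB => //; exact: cvg_cst.
  - by rewrite -[X in _ --> X]addr0; apply: cvgD => //; exact: cvg_cst.
rewrite (_ : (fun n => _) = fun n => Num.sqrt (sqint D (f n)) * Num.sqrt (sqint D (f n))).
  by rewrite -[sqint D g]sqr_sqrtr ?sqint_ge0 // expr2; exact: cvgM.
by apply/funext => n; rewrite -expr2 sqr_sqrtr ?sqint_ge0.
Qed.

Lemma sqint_cvg_le V D (f : nat -> R -> V) (g : R -> V) (b : nat -> R) :
  (forall n, sqint D (fun t => f n t - g t) <= b n) -> b @ \oo --> (0 : R) -> sqint_cvg D f g.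
Proof.
move=> fb b0; apply: squeeze_cvgr b0; last exact: cvg_cst.
by apply: nearW => n; rewrite sqint_ge0 fb.
Qed.

Lemma sqint_cvgB V D (f f' : nat -> R -> V) (g g' : R -> V) : measurable D ->
  (forall n, L2_on D (f n)) -> L2_on D g -> (forall n, L2_on D (f' n)) -> L2_on D g' ->
  sqint_cvg D f g -> sqint_cvg D f' g' ->
  sqint_cvg D (fun n t => f n t - f' n t) (fun t => g t - g' t).
Proof.
move=> mD f2 g2 f2' g2' fg fg'.
apply: (sqint_cvg_le (b := fun n => 2 * sqint D (fun t => f n t - g t) + 2 * sqint D (fun t => g'
  t - f' n t))).
  move=> n; rewrite (_ : (fun t => _ - _ - _) = fun t => (f n t - g t) + (g' t - f' n t)).
    by apply: sqintD_le => //; exact: L2B.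
  by apply/funext => t; vlin.
rewrite -[X in _ --> X](addr0 (0 : R)); apply: cvgD.
  by rewrite -(mulr0 (2 : R)); apply: cvgM fg; exact: cvg_cst.
rewrite -(mulr0 (2 : R)); apply: cvgM; first exact: cvg_cst.
by under eq_fun do rewrite sqint_distC; exact: fg'.
Qed.

Lemma sqint_cvg_lip V W D (h : V -> W) (L : R) (f : nat -> R -> V) (g : R -> V) : measurable D ->
  (mu D < +oo)%E -> 0 <= L -> (forall v w, rnorm (h v - h w) <= L * rnorm (v - w)) ->
  (forall n, L2_on D (f n)) -> L2_on D g -> sqint_cvg D f g ->
  sqint_cvg D (fun n t => h (f n t)) (fun t => h (g t)).
Proof.
move=> mD fD L0 hL f2 g2 fg.
apply: (sqint_cvg_le (b := fun n => L ^+ 2 * sqint D (fun t => f n t - g t))).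
  move=> n; apply: sqint_le => //; [apply: L2B => //; exact: L2_lipschitz L0 hL _|exact: L2B|].
  by move=> t _; rewrite -exprMn ler_pXn2r ?nnegrE ?mulr_ge0 ?rnorm_ge0.
by rewrite -(mulr0 (L ^+ 2)); apply: cvgM fg; exact: cvg_cst.
Qed.

End Limits.

(** * Cocoercive feedback *)

Section Monotone.
Context {R : realType} (U : hilbertType R) (phi : U -> U) (gamma : R).
Hypothesis gamma0 : 0 < gamma.
Hypothesis hphi : forall u1 u2 : U,
  gamma * rnorm (phi u2 - phi u1) ^+ 2 <= complex.Re '[phi u2 - phi u1, u2 - u1].
Local Notation mu := (@lebesgue_measure R).
Implicit Types (D : set R).

Lemma cocoercive (u1 u2 : U) :
  gamma * rnorm (phi u1 - phi u2) ^+ 2 <= rdot (phi u1 - phi u2) (u1 - u2).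
Proof. exact: hphi. Qed.

Lemma cocoercive_lipschitz (u1 u2 : U) : rnorm (phi u1 - phi u2) <= gamma^-1 * rnorm (u1 - u2).
Proof.
have h := le_trans (cocoercive u1 u2) (le_trans (ler_norm _) (rdot_le _ _)).
have [->|n0] := eqVneq (rnorm (phi u1 - phi u2)) 0.
  by rewrite mulr_ge0 ?rnorm_ge0 // invr_ge0 ltW.
have np : 0 < rnorm (phi u1 - phi u2) by rewrite lt_def n0 rnorm_ge0.
rewrite mulrC ler_pdivlMr // -(ler_pM2l np); move: h; rewrite expr2; lra.
Qed.

Lemma cocoercive_L2 D (e : R -> U) : measurable D -> (mu D < +oo)%E ->
  L2_on D e -> L2_on D (fun t => phi (e t)).
Proof.
move=> mD fD; apply: (L2_lipschitz mD fD) => [|v w]; last exact: cocoercive_lipschitz.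
by rewrite invr_ge0 ltW.
Qed.

(** Cocoercivity contributes - 2 gamma |w2 - w1|^2, of which Young's inequality
    for Re <u2 - u1, w2 - w1> uses up one half. *)
Lemma feedback_supply (u1 u2 y1 y2 w1 w2 : U) : w1 = phi (u1 - y1) -> w2 = phi (u2 - y2) ->
  2 * rdot (y2 - y1) (w2 - w1) <= gamma^-1 * rnorm (u2 - u1) ^+ 2 - gamma * rnorm (w2 - w1) ^+ 2.
Proof.
move=> e1 e2; have := cocoercive (u2 - y2) (u1 - y1); rewrite -e1 -e2.
have -> : u2 - y2 - (u1 - y1) = (u2 - u1) - (y2 - y1) by vlin.
have := rdot_young (w2 - w1) (u2 - u1) gamma0.
rewrite rdotBr (rdotC (y2 - y1)); lra.
Qed.

Lemma feedback_supply_L2 D (u1 u2 y1 y2 w1 w2 : R -> U) : measurable D -> (mu D < +oo)%E ->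
  L2_on D u1 -> L2_on D u2 -> L2_on D y1 -> L2_on D y2 -> L2_on D w1 -> L2_on D w2 ->
  (\forall t \ae mu, D t -> w1 t = phi (u1 t - y1 t)) ->
  (\forall t \ae mu, D t -> w2 t = phi (u2 t - y2 t)) ->
  2 * L2dot D (fun t => y2 t - y1 t) (fun t => w2 t - w1 t) <=
  gamma^-1 * sqint D (fun t => u2 t - u1 t) - gamma * sqint D (fun t => w2 t - w1 t).
Proof.
move=> mD fD u1L u2L y1L y2L w1L w2L e1 e2.
pose v1 t := phi (u1 t - y1 t); pose v2 t := phi (u2 t - y2 t).
have v1L : L2_on D v1 by apply: cocoercive_L2 => //; exact: L2B.
have v2L : L2_on D v2 by apply: cocoercive_L2 => //; exact: L2B.
have [yL wL vL] : [/\ L2_on D (fun t => y2 t - y1 t), L2_on D (fun t => w2 t - w1 t)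
  & L2_on D (fun t => v2 t - v1 t)] by split; exact: L2B.
have wv : \forall t \ae mu, D t -> w2 t - w1 t = v2 t - v1 t.
  by apply: ae_imply2 e1 e2 => t h1 h2 Dt; rewrite h1 // h2.
rewrite (L2dot_ae mD (L2_smeas yL) (L2_smeas wL) (L2_smeas yL) (L2_smeas vL) (ae_of_all _) wv) //.
rewrite (sqint_ae mD (L2_smeas wL) (L2_smeas vL) wv) /L2dot /sqint.
have uL := L2B mD u2L u1L.
rewrite -!RintegralZl //; try exact: L2_rint; last exact: rdot_rint.
rewrite -RintegralB //; try (by apply: rintZ => //; exact: L2_rint).
apply: le_Rintegral => //.
- by apply: rintZ => //; exact: rdot_rint.
- by apply: rintB => //; apply: rintZ => //; exact: L2_rint.
by move=> t _; exact: feedback_supply.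
Qed.

End Monotone.

(** * The incremental estimate *)

Section Increment.
Context {R : realType} {U X : hilbertType R} (S : systemNode U X U) (phi : U -> U) (gamma : R).
Hypothesis pS : impedance_passive S.
Hypothesis gamma0 : 0 < gamma.
Hypothesis hphi : forall u1 u2 : U,
  gamma * rnorm (phi u2 - phi u1) ^+ 2 <= complex.Re '[phi u2 - phi u1, u2 - u1].
Local Notation mu := (@lebesgue_measure R).

Lemma continuous_halflineB (V : hilbertType R) (x y : R -> V) : continuous_halfline x ->
  continuous_halfline y -> continuous_halfline (fun t => x t - y t).
Proof.
move=> /continuous_halflineP hx /continuous_halflineP hy; apply/continuous_halflineP => t t0 e e0.
have e2 : 0 < e / 2 by rewrite divr_gt0.
have [d d0 hd] := hx t t0 _ e2; have [d' d'0 hd'] := hy t t0 _ e2.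
exists (Num.min d d'); first by rewrite lt_min d0.
move=> s s0; rewrite lt_min => /andP[h1 h2].
have -> : x s - y s - (x t - y t) = (x s - x t) - (y s - y t) by vlin.
apply: le_lt_trans (rnormB_le _ _) _; have := hd s s0 h1; have := hd' s s0 h2; lra.
Qed.

Lemma continuous_halfline_lip (V W : hilbertType R) (h : V -> W) (L : R) (x : R -> V) :
  0 <= L -> (forall v w, rnorm (h v - h w) <= L * rnorm (v - w)) ->
  continuous_halfline x -> continuous_halfline (fun t => h (x t)).
Proof.
move=> L0 hL /continuous_halflineP hx; apply/continuous_halflineP => t t0 e e0.
have L1 : 0 < L + 1 by lra.
have [d d0 hd] := hx t t0 _ (divr_gt0 e0 L1); exists d => // s s0 st.
apply: le_lt_trans (hL _ _) _; have := hd s s0 st; rewrite ltr_pdivlMr //.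
have := rnorm_ge0 (x s - x t); nra.
Qed.

Lemma has_derivB (V : hilbertType R) (x y : R -> V) t v w : has_deriv x t v -> has_deriv y t w ->
  has_deriv (fun t => x t - y t) t (v - w).
Proof.
move=> hx hy; rewrite /has_deriv.
rewrite (_ : (fun h => _) = fun h => (h^-1)%:C *: (x (t + h) - x t) - (h^-1)%:C *: (y (t + h) - y
  t)).
  exact: cvgB hx hy.
by apply/funext => h; vlin.
Qed.

Lemma sn_sub (p q : X * U) : sn_dom S p -> sn_dom S q ->
  sn_dom S (q - p) /\ sn_op S (q - p) = sn_op S q - sn_op S p.
Proof.
move=> hp hq; have [h1 h2] := sn_linear (-1) hp hq; split.
  by rewrite addrC -scaleN1r.
by rewrite addrC -scaleN1r h2 scaleN1r addrC.
Qed.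

Definition increment_ineq (x1 x2 : R -> X) (u1 u2 w1 w2 : R -> U) t : Prop :=
  rnorm (x2 t - x1 t) ^+ 2 + gamma * sqint `[0, t] (fun s => w2 s - w1 s) <=
  rnorm (x2 0 - x1 0) ^+ 2 + gamma^-1 * sqint `[0, t] (fun s => u2 s - u1 s).

(** The difference of two solutions is a trajectory of the linear system with
    input w2 - w1, so that [passive_energy] applies to it. *)
Lemma classical_increment (x1 x2 : R -> X) (u1 u2 y1 y2 : R -> U) :
  classical_solution S phi x1 u1 y1 -> classical_solution S phi x2 u2 y2 ->
  forall t, 0 <= t -> increment_ineq x1 x2 u1 u2
    (fun s => phi (u1 s - y1 s)) (fun s => phi (u2 s - y2 s)) t.
Proof.
move=> [cx1 cu1 cy1 h1] [cx2 cu2 cy2 h2] t t0.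
pose w1 s := phi (u1 s - y1 s); pose w2 s := phi (u2 s - y2 s).
have [cw1 cw2] : continuous_halfline w1 /\ continuous_halfline w2.
  by split; apply: (continuous_halfline_lip (L := gamma^-1)); rewrite ?invr_ge0 ?(ltW gamma0) //;
    solve [move=> *; exact: cocoercive_lipschitz gamma0 hphi _ _|exact: continuous_halflineB].
have cw := continuous_halflineB cw2 cw1; have cy := continuous_halflineB cy2 cy1.
have := passive_energy (x := fun s => x2 s - x1 s) pS cw cy _ t0.
have hsol s : 0 <= s -> [/\ sn_dom S (x2 s - x1 s, w2 s - w1 s),
   has_deriv (fun s => x2 s - x1 s) s (sn_op S (x2 s - x1 s, w2 s - w1 s)).1
   & y2 s - y1 s = (sn_op S (x2 s - x1 s, w2 s - w1 s)).2].
  move=> s0; have [d1 D1 e1] := h1 s s0; have [d2 D2 e2] := h2 s s0.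
  have [d E] := sn_sub d1 d2; rewrite -/(w1 s) -/(w2 s) in d1 d2 D1 D2 e1 e2 d E.
  have pE : (x2 s - x1 s, w2 s - w1 s) = (x2 s, w2 s) - (x1 s, w1 s) by [].
  split; rewrite pE ?E //=; first exact: has_derivB.
  by rewrite e1 e2.
move=> /(_ hsol) h; rewrite /increment_ineq.
have mD : measurable (`[0, t] : set R) by exact: measurable_itv.
have L (f : R -> U) : continuous_halfline f -> L2_on `[0, t] f.
  by move=> cf; apply: L2loc_on => //; exact: halfline_L2loc.
have := feedback_supply_L2 gamma0 hphi mD (itv_measure_fin 0 t) (L _ cu1) (L _ cu2) (L _ cy1) (L
  _ cy2)
  (L _ cw1) (L _ cw2) (ae_of_all _) (ae_of_all _).
move=> /(_ (fun _ _ => erefl) (fun _ _ => erefl)); lra.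
Qed.

Lemma generalised_increment (x1 x2 : R -> X) (u1 u2 y1 y2 : R -> U) :
  generalised_solution S phi x1 u1 y1 -> generalised_solution S phi x2 u2 y2 ->
  forall t, 0 <= t -> increment_ineq x1 x2 u1 u2
    (fun s => phi (u1 s - y1 s)) (fun s => phi (u2 s - y2 s)) t.
Proof.
move=> [cx1 u1L y1L [xk1 [uk1 [yk1 [hk1 lim1]]]]] [cx2 u2L y2L [xk2 [uk2 [yk2 [hk2 lim2]]]]] t t0.
set D : set R := `[0, t]%classic.
have mD : measurable D by exact: measurable_itv.
have t1 : 0 < t + 1 by lra.
have fD := itv_measure_fin 0 t : (mu D < +oo)%E.
have on (f : R -> U) : L2loc f -> L2_on D f by move=> fL; exact: L2loc_on.
have oc (f : R -> U) : continuous_halfline f -> L2_on D f by move=> /halfline_L2loc; exact: on.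
have key (uk : nat -> R -> U) (u : R -> U) : (forall k, continuous_halfline (uk k)) -> L2loc u ->
    L2norm `[0, t + 1] (fun s => uk k s - u s) @[k --> \oo] --> 0%E -> sqint_cvg D uk u.
  move=> cuk uL /L2norm_cvg0 h.
  have d2 k : L2_on `[0, t + 1] (fun s => uk k s - u s).
    by apply: L2B; rewrite //; [exact: halfline_L2loc|exact: uL].
  apply: (sqint_cvg_le _ (h _ d2)); rewrite // => n.
  by apply: sqint_sub; rewrite //; apply: subset_itvcc => //; lra.
have ptw (xk : nat -> R -> X) (x : R -> X) s : 0 <= s <= t + 1 ->
    {uniform `[0, t + 1]%classic, xk @ \oo --> x} -> xk n s @[n --> \oo] --> x s.
  move=> st /uniformP h; apply/cvg_rnormP => e e0; have [N hN] := h e e0.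
  by exists N => // n nN; apply: hN => //; rewrite /= in_itv.
have [l1 l2 l3] := lim1 _ t1; have [l1' l2' l3'] := lim2 _ t1.
have cu1 k : continuous_halfline (uk1 k) by case: (hk1 k).
have cu2 k : continuous_halfline (uk2 k) by case: (hk2 k).
have cy1 k : continuous_halfline (yk1 k) by case: (hk1 k).
have cy2 k : continuous_halfline (yk2 k) by case: (hk2 k).
have Q1 := key _ _ cu1 u1L l2; have Q2 := key _ _ cu2 u2L l2'.
have R1 := key _ _ cy1 y1L l3; have R2 := key _ _ cy2 y2L l3'.
have g0 : 0 <= gamma^-1 by rewrite invr_ge0 ltW.
have lp := cocoercive_lipschitz gamma0 hphi.
have E1 := sqint_cvgB mD (fun k => oc _ (cu1 k)) (on _ u1L) (fun k => oc _ (cy1 k)) (on _ y1L) Q1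
  R1.
have E2 := sqint_cvgB mD (fun k => oc _ (cu2 k)) (on _ u2L) (fun k => oc _ (cy2 k)) (on _ y2L) Q2
  R2.
have LE1 k : L2_on D (fun s => uk1 k s - yk1 k s) by apply: L2B => //; exact: oc.
have LE2 k : L2_on D (fun s => uk2 k s - yk2 k s) by apply: L2B => //; exact: oc.
have Le1 : L2_on D (fun s => u1 s - y1 s) by apply: L2B => //; exact: on.
have Le2 : L2_on D (fun s => u2 s - y2 s) by apply: L2B => //; exact: on.
have W1 := sqint_cvg_lip mD fD g0 lp LE1 Le1 E1.
have W2 := sqint_cvg_lip mD fD g0 lp LE2 Le2 E2.
have c2 e := cocoercive_L2 gamma0 hphi mD fD (e := e).
have QW := sqint_cvg_sqint mD (fun k => L2B mD (c2 _ (LE2 k)) (c2 _ (LE1 k))) (L2B mD (c2 _ Le2)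
  (c2 _ Le1))
  (sqint_cvgB mD (fun k => c2 _ (LE2 k)) (c2 _ Le2) (fun k => c2 _ (LE1 k)) (c2 _ Le1) W2 W1).
have QU := sqint_cvg_sqint mD (fun k => L2B mD (oc _ (cu2 k)) (oc _ (cu1 k))) (L2B mD (on _ u2L)
  (on _ u1L))
  (sqint_cvgB mD (fun k => oc _ (cu2 k)) (on _ u2L) (fun k => oc _ (cu1 k)) (on _ u1L) Q2 Q1).
have sq s : 0 <= s <= t + 1 -> rnorm (xk2 n s - xk1 n s) ^+ 2 @[n --> \oo] -->
  rnorm (x2 s - x1 s) ^+ 2.
  move=> st; rewrite -rdotxx; under eq_fun do rewrite -rdotxx.
  by apply: cvg_rdot; apply: cvgB; apply: ptw.
rewrite /increment_ineq.
have s0 : 0 <= (0 : R) <= t + 1 by rewrite lexx ltW.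
have st : 0 <= t <= t + 1 by apply/andP; split; lra.
apply: (ler_cvg_to (cvgD (sq _ st) (cvgM (cvg_cst gamma) QW)) (cvgD (sq _ s0) (cvgM (cvg_cst
  gamma^-1) QU))).
by apply: nearW => k; exact: (classical_increment (hk1 k) (hk2 k) t0).
Qed.

End Increment.

(** * Functions up to null sets *)

Section AlmostEverywhere.
Context {R : realType}.
Local Notation mu := (@lebesgue_measure R).
Implicit Types (V : hilbertType R) (D : set R) (tau h T : R).

Lemma ae_and (P1 P2 : R -> Prop) : (\forall t \ae mu, P1 t) -> (\forall t \ae mu, P2 t) ->
  \forall t \ae mu, P1 t /\ P2 t.
Proof. by apply: ae_imply2 => t. Qed.

Lemma ae_shift (P : R -> Prop) h : (\forall t \ae mu, P t) -> \forall t \ae mu, P (t + h).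
Proof.
move=> [N [mN N0 hN]]; exists (shiftR h @^-1` N); split.
- exact: measurable_shift_preimage.
- by rewrite -N0 -(lebesgue_shift h mN).
by move=> t /= nP; apply: hN.
Qed.

Lemma ae_equalP V (f g : R -> V) :
  ae_equal f g <-> \forall t \ae mu, 0 <= t -> f t = g t.
Proof.
by split; apply: ae_imply => t h; move: h; rewrite /= in_itv /= andbT.
Qed.

Lemma ae_equal_nat V (f g : R -> V) :
  (forall n : nat, \forall t \ae mu, 0 <= t <= n%:R -> f t = g t) -> ae_equal f g.
Proof.
move=> h; apply/ae_equalP; have := ae_foralln h; apply: ae_imply => t ht t0.
apply: (ht (Num.truncn t).+1); rewrite t0 /=.
by have /andP[_ /ltW] := truncn_itv t0.
Qed.

Lemma L2_ae V D (f g : R -> V) : measurable D -> smeas D g -> L2_on D f ->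
  (\forall t \ae mu, D t -> f t = g t) -> L2_on D g.
Proof.
move=> mD mg f2 fg; split=> //; have [mf] := f2; congr (_ < _)%E.
rewrite !L2normE; congr sqrte; apply: ae_eq_integral => //.
- by apply/measurable_EFinP; apply: smeas_rnorm2.
- by apply/measurable_EFinP; apply: smeas_rnorm2.
by apply: ae_imply fg => t fg /fg ->.
Qed.

Lemma L2_of_loc V (f : R -> V) tau : L2 f -> 0 <= tau -> L2_on `[0, tau] f.
Proof.
move=> f2 t0; apply: L2_sub f2 => //.
by move=> t /=; rewrite !in_itv /= andbT => /andP[].
Qed.

Lemma L2_of_trunc V (w : R -> V) tau : L2_on `[0, tau] w -> L2 (trunc tau w).
Proof. by move=> /L2_trunc[_ h]; apply: L2_sub h. Qed.

Lemma sqint_halfline_trunc V (w : R -> V) tau : sqint `[0, +oo[ (trunc tau w) = sqint `[0, tau] w.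
Proof.
apply: sqint_trunc => // t /=.
by rewrite !in_itv /= andbT => /andP[].
Qed.

Lemma trunc_split V (w : R -> V) h t : 0 <= h -> 0 <= t ->
  trunc (h + t) w = concat h (trunc h w) (trunc t (fun s => w (s + h))).
Proof.
move=> h0 t0; apply/funext => s; rewrite /concat; case: ltP => sh.
  have [s0|s0] := leP 0 s.
    by rewrite !trunc_in // s0 ?(ltW sh) //= (le_trans (ltW sh)) ?lerDl.
  by rewrite !trunc_out // negb_and -ltNge s0.
have [st|st] := leP s (h + t).
  rewrite !trunc_in ?subrK //; first by rewrite subr_ge0 sh lerBlDl.
  by rewrite st (le_trans h0 sh).
rewrite !trunc_out // negb_and -!ltNge ?st ?orbT //.
by rewrite ltrBrDl st orbT.
Qed.

(** On [n, n + 1) the function takes the values of z (n + 1); only countably many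
    members of the family are used, so the exceptional null sets can be
    collected. *)
Lemma glue_truncations V (z : R -> R -> V) : (forall t, 0 <= t -> L2 (z t)) ->
  (forall t t', 0 <= t -> t <= t' -> \forall s \ae mu, 0 <= s < t -> z t s = z t' s) ->
  (forall t, 0 <= t -> \forall s \ae mu, t < s -> z t s = 0) ->
  exists g : R -> V, L2loc g /\ forall t, 0 <= t -> ae_equal (trunc t g) (z t).
Proof.
move=> z2 zc z0.
pose g s : V := z (Num.truncn s).+1%:R s.
have gz t : 0 <= t -> \forall s \ae mu, 0 <= s < t -> g s = z t s.
  move=> t0.
  have h (k : nat) : \forall s \ae mu, 0 <= s < Num.min k.+1%:R t -> z k.+1%:R s = z t s.
    have [kt|tk] := leP k.+1%:R t; first exact: zc.
    by have := zc t k.+1%:R t0 (ltW tk); apply: ae_imply => s hs /hs.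
  have := ae_foralln h; apply: ae_imply => s hs /andP[s0 st].
  have /andP[_ s1] := truncn_itv s0.
  by apply: hs; rewrite s0 lt_min s1.
have mg tau : smeas `[0, tau] g.
  pose gn (n : nat) := fun s => if s \in (`[0%R, n%:R[%classic : set R) then g s else 0.
  apply: (smeas_lim (f := gn)); first exact: measurable_itv.
    elim=> [|n IH].
      apply: (smeas_eq _ (smeas_cst _ (0 : V))) => s _; rewrite /gn.
      case: ifP => // /set_mem /=; rewrite in_itv /= => /andP[a b].
      by have := le_lt_trans a b; rewrite ltxx.
    have E : gn n.+1 = fun s => if s \in (`[n%:R,
      n.+1%:R[%classic : set R) then z n.+1%:R s else gn n s.
      apply/funext => s; rewrite /gn !mem_setE !in_itv /=.
      have [ns|ns] := leP n%:R s => /=; last first.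
        rewrite andbT; have -> : s < n.+1%:R by apply: lt_trans ns _; rewrite ltr_nat.
        by rewrite andbT.
      have s0 : 0 <= s by apply: le_trans ns; rewrite ler0n.
      rewrite s0 /=; case: ifP => // sn; rewrite /g.
      by rewrite (@truncn_def _ s n) // ns.
    rewrite E; apply: smeas_if => //.
      apply: smeas_sub (L2_smeas (z2 _ (ler0n _ n.+1))) => s [] /=.
      by rewrite !in_itv /= andbT => /andP[].
    by apply: smeas_sub IH => s [].
  move=> s; rewrite /= in_itv /= => /andP[s0 _].
  apply/cvg_rnormP => e e0; exists (Num.truncn s).+1 => // n /= sn;
    rewrite /gn mem_set ?subrr ?rnorm0 //= in_itv /= s0 /=.
  have /andP[_ s1] := truncn_itv s0.
  by apply: lt_le_trans s1 _; rewrite ler_nat.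
exists g; split=> [tau tau0|t t0].
  have t1 : 0 <= tau + 1 by lra.
  apply: (@L2_ae _ _ (z (tau + 1))); rewrite //; first exact: L2_of_loc (z2 _ t1) (ltW tau0).
  have := gz _ t1; apply: ae_imply => s hs; rewrite /= in_itv /= => /andP[s0 st]; apply/esym/hs.
  by rewrite s0 /=; lra.
apply/ae_equalP.
have nt : \forall s \ae mu, s != t.
  exists [set t]; split; rewrite ?lebesgue_measure_set1 //.
  by move=> s /= /negP; rewrite negbK => /eqP.
apply: ae_imply2 (ae_imply2 (P := fun s => s != t /\ (t < s ->
  z t s = 0)) _ nt (z0 t t0)) (gz t t0) => //.
move=> s [st hz] hg s0; have [lt|lt|eq] := ltgtP s t.
- by rewrite trunc_in ?s0 ?(ltW lt) // hg // s0.
- by rewrite trunc_out ?hz // s0 /= -ltNge.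
- by rewrite eq eqxx in st.
Qed.

End AlmostEverywhere.

(** * State and output of a well-posed linear system *)

Section Outputs.
Context {R : realType} {U X Y : hilbertType R} (Sigma : wpls U X Y).
Local Notation mu := (@lebesgue_measure R).
Implicit Types (x : X) (w : R -> U) (t h : R).

(** The composition law with a second interval of length 0, on which all outputs
    vanish. *)
Lemma Psi_vanish t x : 0 <= t -> \forall s \ae mu, t < s -> wPsi Sigma t x s = 0.
Proof.
move=> t0; have /ae_equalP := wPsi_concat Sigma x t0 (lexx 0); rewrite addr0 => h1.
have /ae_equalP h2 := wPsi0 Sigma (wT Sigma t x).
apply: ae_imply2 h1 (ae_shift (- t) h2) => s e1 e2 ts.
rewrite e1 ?(le_trans t0 (ltW ts)) // /concat ltNge (ltW ts) /=.
by apply: e2; rewrite subr_ge0 ltW.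
Qed.

Lemma F_vanish t w : 0 <= t -> L2loc w -> \forall s \ae mu, t < s -> wF Sigma t (trunc t w) s = 0.
Proof.
move=> t0 w2; have u2 : L2 (trunc t w) by apply: L2_of_trunc; exact: L2loc_on.
have v2 : L2 (trunc 0 (fun s => w (s + t))) by apply: L2_of_trunc; apply/L2loc_on/lexx/L2loc_shift.
have /ae_equalP := wF_concat Sigma t0 (lexx 0) u2 v2; rewrite -trunc_split // addr0 => h1.
have /ae_equalP h2 := wPsi0 Sigma (wPhi Sigma t (trunc t w)).
have /ae_equalP h3 := wF0 Sigma v2.
apply: ae_imply2 h1 (ae_shift (- t) (ae_and h2 h3)) => s e1 [e2 e3] ts.
rewrite e1 ?(le_trans t0 (ltW ts)) // /concat ltNge (ltW ts) /=.
by rewrite e2 ?e3 ?addr0 // subr_ge0 ltW.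
Qed.

(** The composition laws say that the finite-time outputs are consistent, so they
    can be glued. *)
Lemma wPsi_infP x : L2loc (wPsi_inf Sigma x) /\
  forall t, 0 <= t -> ae_equal (trunc t (wPsi_inf Sigma x)) (wPsi Sigma t x).
Proof.
apply: (getPex (P := fun z => L2loc z /\ forall t, 0 <= t ->
  ae_equal (trunc t z) (wPsi Sigma t x))).
apply: glue_truncations => [t t0|t t' t0 tt'|t t0].
- exact: wPsi_L2.
- have tt0 : 0 <= t' - t by rewrite subr_ge0.
  have /ae_equalP := wPsi_concat Sigma x t0 tt0; rewrite addrC subrK.
  by apply: ae_imply => s hs /andP[s0 st]; rewrite hs // /concat st.
exact: Psi_vanish.
Qed.

Lemma wF_infP w : L2loc w -> L2loc (wF_inf Sigma w) /\
  forall t, 0 <= t -> ae_equal (trunc t (wF_inf Sigma w)) (wF Sigma t (trunc t w)).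
Proof.
move=> w2.
apply: (getPex (P := fun z => L2loc z /\ forall t, 0 <= t ->
  ae_equal (trunc t z) (wF Sigma t (trunc t w)))).
have l2 t : L2 (trunc t w) by apply: L2_of_trunc; exact: L2loc_on.
apply: glue_truncations => [t t0|t t' t0 tt'|t t0].
- exact: wF_L2.
- have tt0 : 0 <= t' - t by rewrite subr_ge0.
  have v2 : L2 (trunc (t' - t) (fun s => w (s + t))).
    by apply: L2_of_trunc; apply/L2loc_on/lexx/L2loc_shift.
  have /ae_equalP := wF_concat Sigma t0 tt0 (l2 t) v2; rewrite -trunc_split // addrC subrK.
  by apply: ae_imply => s hs /andP[s0 st]; rewrite hs // /concat st.
exact: F_vanish.
Qed.

Definition wpl_state x w t : X := wT Sigma t x + wPhi Sigma t (trunc t w).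

Definition wpl_output x w : R -> Y := fun s => wPsi_inf Sigma x s + wF_inf Sigma w s.

Local Notation st := wpl_state.
Local Notation out := wpl_output.

Lemma L2locD (V : hilbertType R) (f g : R -> V) : L2loc f -> L2loc g -> L2loc (fun t => f t + g t).
Proof. by move=> f2 g2 tau tau0; apply: L2D; [exact: measurable_itv|exact: f2|exact: g2]. Qed.

Lemma L2locB (V : hilbertType R) (f g : R -> V) : L2loc f -> L2loc g -> L2loc (fun t => f t - g t).
Proof. by move=> f2 g2 tau tau0; apply: L2B; [exact: measurable_itv|exact: f2|exact: g2]. Qed.

Lemma output_L2loc x w : L2loc w -> L2loc (out x w).
Proof. by move=> w2; apply: L2locD; [case: (wPsi_infP x)|case: (wF_infP w2)]. Qed.

Lemma output_on x w t : L2loc w -> 0 <= t -> \forall s \ae mu, 0 <= s <= t ->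
  out x w s = wPsi Sigma t x s + wF Sigma t (trunc t w) s.
Proof.
move=> w2 t0; have [_ /(_ t t0)/ae_equalP h1] := wPsi_infP x.
have [_ /(_ t t0)/ae_equalP h2] := wF_infP w2.
apply: ae_imply2 h1 h2 => s e1 e2 st; have /andP[s0 _] := st.
by rewrite /wpl_output -e1 // -e2 // !trunc_in.
Qed.

Lemma truncB (w1 w2 : R -> U) t :
  trunc t (fun s => w1 s - w2 s) = fun s => (-1) *: trunc t w2 s + trunc t w1 s.
Proof.
apply/funext => s; rewrite /trunc /patch; case: ifP => _; first by rewrite scaleN1r addrC.
by rewrite scaler0 addr0.
Qed.

Lemma outputB x1 x2 w1 w2 : L2loc w1 -> L2loc w2 ->
  ae_equal (out (x1 - x2) (fun s => w1 s - w2 s)) (fun s => out x1 w1 s - out x2 w2 s).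
Proof.
move=> w1L w2L; apply: ae_equal_nat => n; have n0 : 0 <= n%:R :> R by exact: ler0n.
have wL := L2locB w1L w2L.
have l2 w : L2loc w -> L2 (trunc n%:R w) by move=> h; apply: L2_of_trunc; exact: L2loc_on.
have /ae_equalP hF := wF_linear Sigma (-1) n0 (l2 _ w2L) (l2 _ w1L).
have /ae_equalP hP := wPsi_linear Sigma (-1) x2 x1 n0.
have h := ae_and hF hP.
have h' := ae_and (output_on (x1 - x2) wL n0)
  (ae_and (output_on x1 w1L n0) (output_on x2 w2L n0)).
apply: ae_imply2 h h' => s [eF eP] [e [e1 e2]] sn; have /andP[s0 _] := sn.
rewrite e // e1 // e2 // truncB eF // (_ : x1 - x2 = (-1) *: x2 + x1) ?eP //;
  last by rewrite scaleN1r addrC.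
rewrite !scaleN1r; vlin.
Qed.

Lemma stateB x1 x2 w1 w2 t : 0 <= t -> L2loc w1 -> L2loc w2 ->
  st (x1 - x2) (fun s => w1 s - w2 s) t = st x1 w1 t - st x2 w2 t.
Proof.
move=> t0 w1L w2L; have [lT _ _ _] := wT_semigroup Sigma.
have l2 w : L2loc w -> L2 (trunc t w) by move=> h; apply: L2_of_trunc; exact: L2loc_on.
rewrite /wpl_state truncB wPhi_linear //; [|exact: l2..].
by rewrite (bounded_linearB (lT t t0)) scaleN1r; vlin.
Qed.

Lemma output_shift x w h : 0 <= h -> L2loc w ->
  ae_equal (fun s => out x w (s + h)) (out (st x w h) (fun s => w (s + h))).
Proof.
move=> h0 w2; apply: ae_equal_nat => n; have n0 : 0 <= n%:R :> R by exact: ler0n.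
have hn0 : 0 <= h + n%:R by exact: addr_ge0.
have wh2 := L2loc_shift h0 w2.
have u2 : L2 (trunc h w) by apply: L2_of_trunc; exact: L2loc_on.
have v2 : L2 (trunc n%:R (fun s => w (s + h))) by apply: L2_of_trunc; exact/L2loc_on/lexx.
have e1 := ae_shift h (output_on x w2 hn0).
have /ae_equalP/(ae_shift h) e2 := wPsi_concat Sigma x h0 n0.
have /ae_equalP/(ae_shift h) e3 := wF_concat Sigma h0 n0 u2 v2.
have /ae_equalP e4 := wPsi_linear Sigma 1 (wT Sigma h x) (wPhi Sigma h (trunc h w)) n0.
have e5 := output_on (st x w h) wh2 n0.
apply: ae_imply2 (ae_and e1 e2) (ae_and (ae_and e3 e4) e5).
move=> s [h1 h2] [[h3 h4] h5] sn; have /andP[s0 sn'] := sn.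
have s1 : 0 <= s + h by exact: addr_ge0.
rewrite h1; last by rewrite s1 addrC lerD2l.
rewrite h2 // trunc_split // h3 // h5 //.
move: h4; rewrite !scale1r => h4; rewrite /wpl_state h4 // /concat.
by rewrite ltNge lerDr s0 /= addrK addrA.
Qed.

Lemma Phi_bound t : 0 <= t -> exists2 M, 0 <= M & forall w, L2loc w ->
  rnorm (wPhi Sigma t (trunc t w)) ^+ 2 <= M * sqint `[0, t] w.
Proof.
move=> t0; have [M hM] := wPhi_bounded Sigma t0; exists (M ^+ 2); first exact: sqr_ge0.
move=> w w2; have u2 : L2 (trunc t w) by apply: L2_of_trunc; exact: L2loc_on.
have := hM _ u2; rewrite L2norm_sqint // sqint_halfline_trunc -EFinM lee_fin => h.
rewrite -[sqint _ _]sqr_sqrtr ?sqint_ge0 // -exprMn ler_pXn2r // ?nnegrE ?rnorm_ge0 //.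
exact: le_trans (rnorm_ge0 _) h.
Qed.

Lemma Psi_bound t : 0 <= t -> exists2 M, 0 <= M & forall x,
  sqint `[0, t] (wPsi Sigma t x) <= M * rnorm x ^+ 2.
Proof.
move=> t0; have [M hM] := wPsi_bounded Sigma t0; exists (M ^+ 2); first exact: sqr_ge0.
move=> x; have u2 := wPsi_L2 Sigma x t0.
have := hM x; rewrite L2norm_sqint // lee_fin => h.
apply: le_trans (_ : sqint `[0, +oo[ (wPsi Sigma t x) <= _).
  by apply: sqint_sub => // s /=; rewrite !in_itv /= andbT => /andP[].
rewrite -[sqint _ _]sqr_sqrtr ?sqint_ge0 // -exprMn ler_pXn2r // ?nnegrE ?sqrtr_ge0 //.
exact: le_trans (sqrtr_ge0 _) h.
Qed.

Lemma F_bound t : 0 <= t -> exists2 M, 0 <= M & forall w, L2loc w ->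
  sqint `[0, t] (wF Sigma t (trunc t w)) <= M * sqint `[0, t] w.
Proof.
move=> t0; have [M hM] := wF_bounded Sigma t0; exists (M ^+ 2); first exact: sqr_ge0.
move=> w w2; have u2 : L2 (trunc t w) by apply: L2_of_trunc; exact: L2loc_on.
have f2 := wF_L2 Sigma t0 u2.
have := hM _ u2; rewrite !L2norm_sqint // sqint_halfline_trunc -EFinM lee_fin => h.
apply: le_trans (_ : sqint `[0, +oo[ (wF Sigma t (trunc t w)) <= _).
  by apply: sqint_sub => // s /=; rewrite !in_itv /= andbT => /andP[].
rewrite -[sqint `[0, +oo[ _]sqr_sqrtr ?sqint_ge0 // -[sqint `[0,
  t] w]sqr_sqrtr ?sqint_ge0 // -exprMn.
rewrite ler_pXn2r // ?nnegrE ?sqrtr_ge0 //.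
exact: le_trans (sqrtr_ge0 _) h.
Qed.

Lemma state_bound t : 0 <= t -> exists2 M, 0 <= M & forall x w, L2loc w ->
  rnorm (st x w t) ^+ 2 <= M * (rnorm x ^+ 2 + sqint `[0, t] w).
Proof.
move=> t0; have [M M0 hM] := Phi_bound t0.
have [lT _ _ _] := wT_semigroup Sigma; have [L L0 hL] := bounded_linear_bound (lT t t0).
exists (2 * (L ^+ 2 + M)); first by rewrite mulr_ge0 // addr_ge0 ?sqr_ge0.
move=> x w w2; have := hM w w2; have := hL x; set a := wT _ _ _; set b := wPhi _ _ _ => ha hb.
have ha2 : rnorm a ^+ 2 <= L ^+ 2 * rnorm x ^+ 2.
  by rewrite -exprMn ler_pXn2r ?nnegrE ?mulr_ge0 ?rnorm_ge0.
rewrite rnorm_sqD; have := @rdot_young _ _ 1 a b ltr01; rewrite invr1 !mul1r.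
have := sqint_ge0 `[0, t]%classic w; have := sqr_ge0 (rnorm x); have := sqr_ge0 L; nra.
Qed.

Lemma output_bound t : 0 <= t -> exists2 M, 0 <= M & forall x w, L2loc w ->
  sqint `[0, t] (out x w) <= M * (rnorm x ^+ 2 + sqint `[0, t] w).
Proof.
move=> t0; have [M M0 hM] := Psi_bound t0; have [L L0 hL] := F_bound t0.
exists (2 * (L + M)); first by rewrite mulr_ge0 // addr_ge0.
move=> x w w2; have u2 : L2 (trunc t w) by apply: L2_of_trunc; exact: L2loc_on.
have mD : measurable (`[0, t] : set R) by exact: measurable_itv.
have f2 := L2_of_loc (wF_L2 Sigma t0 u2) t0; have p2 := L2_of_loc (wPsi_L2 Sigma x t0) t0.
rewrite (sqint_ae mD _ (L2_smeas (L2D mD p2 f2))).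
- have := sqintD_le mD p2 f2; have := hM x; have := hL w w2.
  have := sqint_ge0 `[0, t]%classic w; have := sqr_ge0 (rnorm x); nra.
- by apply: L2_smeas; apply: L2loc_on => //; exact: output_L2loc.
by have := output_on x w2 t0; apply: ae_imply => s hs; rewrite /= in_itv.
Qed.

(** Causality, from linearity and the bound by the norm of the input on [0, t]. *)
Lemma state_ext x w1 w2 t : 0 <= t -> L2loc w1 -> L2loc w2 ->
  (\forall s \ae mu, 0 <= s <= t -> w1 s = w2 s) -> st x w1 t = st x w2 t.
Proof.
move=> t0 w1L w2L e; have [M M0 hM] := state_bound t0.
have := hM (x - x) _ (L2locB w1L w2L); rewrite stateB // subrr rnorm0 expr0n add0r.
have mD : measurable (`[0, t] : set R) by exact: measurable_itv.
rewrite (sqint_ae (g := fun=> 0) mD).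
- rewrite sqint_eq0 // mulr0 => h; apply: sqdist_eq => e1 e10; exact: le_trans h (ltW e10).
- by apply: L2_smeas; apply: L2loc_on => //; exact: L2locB.
- exact: smeas_cst.
by apply: ae_imply e => s e; rewrite /= in_itv /= => /e ->; rewrite subrr.
Qed.

Lemma output_ext x w1 w2 t : 0 <= t -> L2loc w1 -> L2loc w2 ->
  (\forall s \ae mu, 0 <= s <= t -> w1 s = w2 s) ->
  \forall s \ae mu, 0 <= s <= t -> out x w1 s = out x w2 s.
Proof.
move=> t0 w1L w2L e; have [M M0 hM] := output_bound t0.
have mD : measurable (`[0, t] : set R) by exact: measurable_itv.
have oL w : L2loc w -> L2_on `[0, t] (out x w) by move=> h; apply: L2loc_on => //;
  exact: output_L2loc.
have E : \forall s \ae mu, `[0, t]%classic s -> out x w1 s = out x w2 s.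
  apply: sqint0_ae; [exact: mD|exact: oL|exact: oL|].
  have := hM (x - x) _ (L2locB w1L w2L).
  rewrite (sqint_ae (f := fun s => w1 s - w2 s) (g := fun=> 0) mD); first last.
  - by apply: ae_imply e => s e; rewrite /= in_itv /= => /e ->; rewrite subrr.
  - exact: smeas_cst.
  - by apply: L2_smeas; apply: L2loc_on => //; exact: L2locB.
  rewrite [sqint _ (fun=> 0)]sqint_eq0 // addr0 subrr rnorm0 expr0n mulr0 => h.
  apply/eqP; rewrite eq_le sqint_ge0 andbT; apply: le_trans h; rewrite le_eqVlt; apply/orP; left;
    apply/eqP.
  apply: sqint_ae => //.
  - by apply: L2_smeas; apply: L2B => //; exact: oL.
  - by apply: L2_smeas; apply: L2loc_on => //; apply: output_L2loc; exact: L2locB.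
  have /ae_equalP := outputB x x w1L w2L; apply: ae_imply => s hs.
  by rewrite /= in_itv /= => /andP[s0 _]; rewrite -hs // subrr.
by apply: ae_imply E => s hs st; apply: hs; rewrite /= in_itv.
Qed.

Lemma state0 x w : L2loc w -> st x w 0 = x.
Proof.
move=> w2; have [_ T0 _ _] := wT_semigroup Sigma; have [M M0 hM] := Phi_bound (lexx 0).
have := hM w w2; rewrite /sqint set_itv1 Rintegral_set1 mulr0 => h.
rewrite /wpl_state T0 (_ : wPhi _ _ _ = 0) ?addr0 //; apply: sqdist_eq => e e0.
by rewrite subr0; exact: le_trans h (ltW e0).
Qed.

End Outputs.

(** * Passivity for L^2 inputs *)

Section Approximation.
Context {R : realType}.
Implicit Types (V : hilbertType R) (D : set R).

Lemma sqint_cvg_L2dot V D (f f' : nat -> R -> V) (g g' : R -> V) : measurable D ->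
  (forall n, L2_on D (f n)) -> L2_on D g -> (forall n, L2_on D (f' n)) -> L2_on D g' ->
  sqint_cvg D f g -> sqint_cvg D f' g' -> L2dot D (f n) (f' n) @[n --> \oo] --> L2dot D g g'.
Proof.
move=> mD f2 g2 f2' g2' fg fg'.
have ipE (a b : R -> V) : L2_on D a -> L2_on D b ->
    L2dot D a b = 2^-1 * (sqint D a + sqint D b - sqint D (fun t => a t - b t)).
  by move=> a2 b2; rewrite sqintB //; field.
rewrite ipE // (_ : (fun n => _) = fun n => 2^-1 *
    (sqint D (f n) + sqint D (f' n) - sqint D (fun t => f n t - f' n t))); last first.
  by apply/funext => n; rewrite ipE.
apply: cvgM; first exact: cvg_cst.
apply: cvgB; first by apply: cvgD; exact: sqint_cvg_sqint.
apply: sqint_cvg_sqint => //; [move=> n|..|exact: sqint_cvgB]; exact: L2B.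
Qed.

Lemma sqr_le_inv_nat (b : R) (n : nat) : 0 <= b -> b <= n.+1%:R^-1 -> b ^+ 2 <= n.+1%:R^-1.
Proof.
move=> b0 bn; have b1 : b <= 1 by apply: le_trans bn _; rewrite invf_le1 ?ltr0n ?ler1n.
by apply: le_trans bn; rewrite expr2 -[X in _ <= X]mulr1 ler_wpM2l.
Qed.

End Approximation.

Section StateApproximation.
Context {R : realType} {U X Y : hilbertType R} (Sigma : wpls U X Y).

Lemma state_output_cvg (x : X) (xk : nat -> X) (w : R -> U) (wk : nat -> R -> U) (b : nat -> R) t :
  0 <= t -> L2loc w -> (forall k, L2loc (wk k)) ->
  (forall k, rnorm (xk k - x) ^+ 2 + sqint `[0, t] (fun s => wk k s - w s) <= b k) ->
  b @ \oo --> (0 : R) ->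
  wpl_state Sigma (xk k) (wk k) t @[k --> \oo] --> wpl_state Sigma x w t /\
  sqint_cvg `[0, t] (fun k => wpl_output Sigma (xk k) (wk k)) (wpl_output Sigma x w).
Proof.
move=> t0 wL wkL hb b0; split.
  have [M M0 hM] := state_bound Sigma t0.
  apply/cvg_rnorm0.
  have h : rnorm (wpl_state Sigma (xk k) (wk k) t - wpl_state Sigma x w t) ^+ 2 @[k --> \oo] -->
    (0 : R).
    apply: (@squeeze_cvgr _ _ _ _ (fun=> 0) (fun k => M * b k)).
    - apply: nearW => k; rewrite sqr_ge0 -stateB //= .
      apply: le_trans (hM _ _ (L2locB (wkL k) wL)) _.
      by rewrite ler_wpM2l.
    - exact: cvg_cst.
    - by rewrite -(mulr0 M); apply: cvgM => //; exact: cvg_cst.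
  rewrite (_ : (fun k => _) = fun k => Num.sqrt (rnorm (wpl_state Sigma (xk k) (wk k) t -
    wpl_state Sigma x w t) ^+ 2)).
    by rewrite -(sqrtr0 R); apply: (@cvg_comp _ _ _ _ Num.sqrt _ _ _ h); exact: sqrt_continuous.
  by apply/funext => k; rewrite sqrtr_sqr ger0_norm ?rnorm_ge0.
have [M M0 hM] := output_bound Sigma t0.
apply: (sqint_cvg_le (b := fun k => M * b k)); last first.
  by rewrite -(mulr0 M); apply: cvgM => //; exact: cvg_cst.
move=> k; have dL := L2locB (wkL k) wL.
have := hM (xk k - x) _ dL.
have mD : measurable (`[0, t] : set R) by exact: measurable_itv.
rewrite (sqint_ae (g := fun s => wpl_output Sigma (xk k) (wk k) s - wpl_output Sigma x w s) mD).
- by move=> h; apply: le_trans h _; rewrite ler_wpM2l.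
- by apply: L2_smeas; apply: L2loc_on => //; exact: output_L2loc.
- by apply: L2_smeas; apply: L2loc_on => //; apply: L2locB; exact: output_L2loc.
have /ae_equalP := outputB Sigma (xk k) x (wkL k) wL; apply: ae_imply => s hs.
by rewrite /= in_itv /= => /andP[s0 _]; exact: hs.
Qed.

End StateApproximation.

Section Passivity.
Context {R : realType} {U X : hilbertType R} (S : systemNode U X U) (Sigma : wpls U X U).
Hypothesis pS : impedance_passive S.
Hypothesis hS : associated_wpls S Sigma.

Lemma passive_state_smooth (x0 : X) (w : R -> U) t : H1loc w -> sn_dom S (x0, w 0) -> 0 <= t ->
  rnorm (wpl_state Sigma x0 w t) ^+ 2 <= rnorm x0 ^+ 2 + 2 * L2dot `[0,
    t] (wpl_output Sigma x0 w) w.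
Proof.
move=> hw dw t0; have [y [ye _ hy sol]] := hS hw dw.
have := passive_energy (x := wpl_state Sigma x0 w) pS (H1loc_continuous hw) (H1loc_continuous hy)
  sol t0.
have wL := H1loc_L2loc hw; have yL := H1loc_L2loc hy.
rewrite state0 //.
have mD : measurable (`[0, t] : set R) by exact: measurable_itv.
have sm (f : R -> U) : L2loc f -> smeas `[0, t] f by move=> fL; apply/L2_smeas/L2loc_on/lexx.
rewrite (L2dot_ae mD (sm _ yL) (sm _ wL) (sm _ (output_L2loc Sigma x0 wL)) (sm _ wL) _ (ae_of_all
  _)) //.
have /ae_equalP := ye; apply: ae_imply => s hs.
by rewrite /= in_itv /= => /andP[s0 _]; exact: hs.
Qed.

Lemma sn_domA_dense (x : X) (e : R) : 0 < e -> exists2 v, sn_dom S (v, 0) & rnorm (v - x) <= e.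
Proof.
by move=> e0; have [T [hT gT]] := sn_generator S; exact: (generator_dense hT gT x e0).
Qed.

(** Both sides depend continuously on the initial state and the input; initial
    states in the domain of the generator and Lipschitz inputs vanishing at 0 are
    dense, and they give rise to classical solutions. *)
Lemma passive_state (x0 : X) (w : R -> U) t : L2loc w -> 0 <= t ->
  rnorm (wpl_state Sigma x0 w t) ^+ 2 <= rnorm x0 ^+ 2 + 2 * L2dot `[0,
    t] (wpl_output Sigma x0 w) w.
Proof.
move=> wL; rewrite le_eqVlt => /predU1P[<-|t0].
  by rewrite state0 // /L2dot set_itv1 Rintegral_set1 mulr0 addr0.
have n0 (k : nat) : 0 < k.+1%:R^-1 :> R by rewrite invr_gt0 ltr0n.
have /choice[xk hx] : forall k : nat, exists v, sn_dom S (v, 0) /\ rnorm (v - x0) <= k.+1%:R^-1.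
  by move=> k; have [v dv hv] := sn_domA_dense x0 (n0 k); exists v.
have wt : L2_on `[0, t] w by exact: wL.
have /choice[wk hw] := fun k : nat => lipschitz_dense (0 : U) t0 (n0 k) wt.
have wkL k : L2loc (wk k) by have [h _ _] := hw k; exact: lipschitz_L2loc.
have b0 : (fun k : nat => 2 * k.+1%:R^-1) @ \oo --> (0 : R).
  by rewrite -(mulr0 (2 : R)); apply: cvgM; [exact: cvg_cst|exact: cvg_harmonic].
have [k|st_c out_c] := @state_output_cvg _ _ _ _ Sigma x0 xk _ _ _ _ (ltW t0) wL wkL _ b0.
  have [_ h1] := hx k; have [_ _ h2] := hw k.
  have := sqr_le_inv_nat (rnorm_ge0 _) h1.
  move: h2; move: (k.+1%:R^-1 : R) => b; lra.
have mD : measurable (`[0, t] : set R) by exact: measurable_itv.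
have xk_c : xk k @[k --> \oo] --> x0.
  apply/cvg_rnorm0; apply: squeeze_cvgr (@cvg_harmonic R); last exact: cvg_cst.
  by apply: nearW => k; rewrite rnorm_ge0; case: (hx k).
have sq (a : nat -> X) l : a @ \oo --> l -> rnorm (a k) ^+ 2 @[k --> \oo] --> rnorm l ^+ 2.
  by move=> al; rewrite -rdotxx; under eq_fun do rewrite -rdotxx; exact: cvg_rdot.
have on (f : R -> U) : L2loc f -> L2_on `[0, t] f by move=> fL; exact: fL.
have wk_c : sqint_cvg `[0, t] wk w.
  by apply: (sqint_cvg_le _ (@cvg_harmonic R)) => k; case: (hw k).
have ic := sqint_cvg_L2dot mD (fun k => on _ (output_L2loc Sigma (xk k) (wkL k))) (on _
  (output_L2loc Sigma x0 wL))
  (fun k => on _ (wkL k)) (on _ wL) out_c wk_c.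
apply: (ler_cvg_to (sq _ _ st_c) (cvgD (sq _ _ xk_c) (cvgM (cvg_cst (2 : R)) ic))).
apply: nearW => k; apply: passive_state_smooth (ltW t0).
  by apply: lipschitz_H1loc; case: (hw k).
by have [h _] := hx k; have [_ -> _] := hw k.
Qed.

End Passivity.

(** * Solvability of the feedback equation *)

Section FixedPoints.
Context {R : realType}.
Local Notation mu := (@lebesgue_measure R).
Implicit Types (V : hilbertType R) (D : set R).

Lemma contraction_fixpoint V (F : V -> V) (q : R) : 0 <= q < 1 ->
  (forall v w, rnorm (F v - F w) <= q * rnorm (v - w)) -> exists v, F v = v.
Proof.
move=> q01 hF; have /andP[q0 q1] := q01; pose e n := iter n F 0.
have step n : rnorm (e n - e n.+1) <= rnorm (e 0%N - e 1%N) * q ^+ n.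
  elim: n => [|n IH]; first by rewrite expr0 mulr1.
  apply: le_trans (hF _ _) _; rewrite exprS mulrCA; exact: ler_wpM2l.
have cauchy : forall r, 0 < r -> exists N, forall m n, (N <= m)%N -> (N <= n)%N ->
    rnorm (e m - e n) < r.
  apply: (geometric_cauchy q01 (rnorm_ge0 (e 0%N - e 1%N))).
  - by move=> n; rewrite subrr rnorm0.
  - by move=> m n; exact: rnormB.
  - by move=> m n; apply: le_trans (rnorm_distD (e n) _ _) _; rewrite lerD2l.
have [l /cvg_rnormP hl] := rnorm_cauchy_cvg cauchy; exists l.
apply/eqP; rewrite -subr_eq0; apply/eqP/rnorm_eq0/eqP.
rewrite eq_le rnorm_ge0 andbT; apply/ler_addgt0Pl => r r0; rewrite addr0.
have [N _ hN] := hl (r / 2) (divr_gt0 r0 (ltr0n _ 2)).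
have h1 := hN N (leqnn _); have h2 := hN N.+1 (leqnSn _).
have := rnorm_distD (F (e N)) (F l) l; have := hF l (e N); rewrite (rnormB l).
move: h2 => /=; have := rnorm_ge0 (e N - l); move: h1 => /=; nra.
Qed.

(** G acts on functions rather than on classes; P singles out the functions on
    which it acts, among which every class has a representative. *)
Lemma L2_contraction_fixpoint V D (G : (R -> V) -> R -> V) (P : (R -> V) -> Prop) (q : R) :
  measurable D -> 0 <= q < 1 -> P (fun=> 0) -> (forall f, P f -> P (G f)) ->
  (forall f, P f -> L2_on D f) ->
  (forall f, L2_on D f -> exists2 g, P g & \forall t \ae mu, D t -> f t = g t) ->
  (forall f g, P f -> P g -> sqint D (fun t => G f t - G g t) <= q * sqint D (fun t => f t - g
    t)) ->
  exists2 f, P f & \forall t \ae mu, D t -> f t = G f t.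
Proof.
move=> mD q01 P0 PG PL Pex hG; have /andP[q0 q1] := q01.
pose f n := iter n G (fun=> 0).
have Pf n : P (f n) by elim: n => //= n IH; exact: PG.
have fL n : L2_on D (f n) by exact: PL.
pose C := Num.sqrt (sqint D (fun t => f 0%N t - f 1%N t)).
have sq01 : 0 <= Num.sqrt q < 1 by rewrite sqrtr_ge0 /= -(sqrtr1 R) ltr_sqrt.
have step n : sqint D (fun t => f n t - f n.+1 t) <= C ^+ 2 * q ^+ n.
  rewrite sqr_sqrtr ?sqint_ge0 //; elim: n => [|n IH]; first by rewrite expr0 mulr1.
  apply: le_trans (hG _ _ (Pf n) (Pf n.+1)) _; rewrite exprS mulrCA; exact: ler_wpM2l.
have sstep n : Num.sqrt (sqint D (fun t => f n t - f n.+1 t)) <= C * Num.sqrt q ^+ n.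
  have C0 : 0 <= C * Num.sqrt q ^+ n by rewrite mulr_ge0 ?exprn_ge0 ?sqrtr_ge0.
  rewrite -(ger0_norm C0) -sqrtr_sqr ler_sqrt ?sqr_ge0 // exprMn exprAC.
  by rewrite (sqr_sqrtr q0); exact: step.
have cauchy : forall e, 0 < e -> exists N, forall m n, (N <= m)%N -> (N <= n)%N ->
    Num.sqrt (sqint D (fun t => f m t - f n t)) < e.
  apply: (@geometric_cauchy R (fun m n => Num.sqrt (sqint D (fun t => f m t - f n t))) C
    (Num.sqrt q)) => //.
  - exact: sqrtr_ge0.
  - by move=> n; rewrite sqint_eq0 ?sqrtr0 // => t _; rewrite subrr.
  - by move=> m n; rewrite sqint_distC.
  - move=> m n; apply: le_trans (sqrt_sqint_triangle mD (fL m) (fL n) (fL n.+1)) _.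
    by rewrite lerD2l.
have [|g gL hg] := @L2_complete R V D f mD fL.
  move=> e e0; have se : 0 < Num.sqrt e by rewrite sqrtr_gt0.
  have [N hN] := cauchy _ se; exists N => m n Nm Nn.
  by have := hN m n Nm Nn; rewrite ltr_sqrt.
have [g' Pg' gg'] := Pex g gL; exists g' => //.
have gL' := PL _ Pg'.
have hg' e : 0 < e -> exists N, forall n, (N <= n)%N -> sqint D (fun t => f n t - g' t) <= e.
  move=> e0; have [N hN] := hg e e0; exists N => n nN.
  rewrite -(sqint_ae (f := fun t => f n t - g t)) //; first exact: hN.
  - by apply: L2_smeas; exact: L2B.
  - by apply: L2_smeas; exact: L2B.
  by apply: ae_imply gg' => t h Dt; rewrite h.
apply: sqint0_ae => //; first exact/PL/PG.
apply/eqP; rewrite eq_le sqint_ge0 andbT; apply/ler_addgt0Pl => e e0; rewrite addr0.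
have [N hN] := hg' (e / 4) (divr_gt0 e0 (ltr0n _ 4)).
have h1 := hN N (leqnn _); have h2 := hN N.+1 (leqnSn _).
have h3 := hG _ _ (Pf N) Pg'.
have GL := PL _ (PG _ Pg').
have := sqintD_le mD (L2B mD gL' (fL N.+1)) (L2B mD (fL N.+1) GL).
rewrite (_ : (fun t => _ + _) = fun t => g' t - G g' t); last by apply/funext => t; vlin.
move=> h4; apply: le_trans h4 _; rewrite sqint_distC.
have -> : sqint D (fun t => f N.+1 t - G g' t) = sqint D (fun t => G (f N) t - G g' t) by [].
have h5 := sqint_ge0 D (fun t => f N t - g' t).
have : q * sqint D (fun t => f N t - g' t) <= sqint D (fun t => f N t - g' t).
  by rewrite -[X in _ <= X]mul1r ler_wpM2r // ltW.
lra.
Qed.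

End FixedPoints.

Section Resolvent.
Context {R : realType} (U : hilbertType R) (phi : U -> U) (gamma : R).
Hypothesis gamma0 : 0 < gamma.
Hypothesis hphi : forall u1 u2 : U,
  gamma * rnorm (phi u2 - phi u1) ^+ 2 <= complex.Re '[phi u2 - phi u1, u2 - u1].

(** By cocoercivity e - gamma phi(e) is a nonexpansive function of e, so
    e |-> (e - gamma (phi e - g)) / (1 + gamma m) is a contraction; its fixed
    point solves the equation. *)
Lemma phi_resolvent (m : R) (g : U) : 0 < m -> exists e, phi e + m%:C *: e = g.
Proof.
move=> m0; pose a := 1 + gamma * m; have gm : 0 < gamma * m by exact: mulr_gt0.
have a1 : 1 < a by rewrite /a; lra.
have a0 : 0 < a by lra.
pose F e := (a^-1)%:C *: (e - gamma%:C *: (phi e - g)).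
have [||e he] := @contraction_fixpoint R U F a^-1.
- by rewrite invr_ge0 ltW //= invf_lt1.
- move=> v w; rewrite /F -scalerBr rnormZr gtr0_norm ?invr_gt0 // ler_pM2l ?invr_gt0 //.
  rewrite -(@ler_pXn2r _ 2) ?nnegrE ?rnorm_ge0 //.
  have -> : v - gamma%:C *: (phi v - g) - (w - gamma%:C *: (phi w - g)) =
    (v - w) - gamma%:C *: (phi v - phi w) by vlin.
  rewrite rnorm_sqB rdotZr rnormZr exprMn gtr0_norm // (rdotC (v - w)).
  have := cocoercive hphi v w; have := sqr_ge0 (rnorm (phi v - phi w)); nra.
exists e; apply: rdot_ext => z; have /(congr1 (fun x => rdot x z)) := he.
rewrite /F rdotZl rdotDl rdotNl rdotZl rdotDl rdotNl => h; rewrite rdotDl rdotZl.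
have {}h : rdot e z - gamma * (rdot (phi e) z - rdot g z) = a * rdot e z.
  by rewrite -[in RHS]h mulVKf ?gt_eqF // gt_eqF.
have : gamma * (rdot (phi e) z + m * rdot e z) = gamma * rdot g z.
  by move: h; rewrite /a; lra.
by move/mulfI; apply; rewrite gt_eqF.
Qed.

(** In the square of the right-hand side, cocoercivity bounds the inner product
    and the norm of e1 - e2 from below in terms of phi e1 - phi e2. *)
Lemma phi_resolvent_lipschitz (m : R) (e1 e2 : U) : 0 < m ->
  (1 + m * gamma) * rnorm (phi e1 - phi e2) <=
    rnorm (phi e1 + m%:C *: e1 - (phi e2 + m%:C *: e2)).
Proof.
move=> m0; have mg : 0 < m * gamma by exact: mulr_gt0.
rewrite -(@ler_pXn2r _ 2) ?nnegrE ?mulr_ge0 ?rnorm_ge0 //; last by lra.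
have -> : phi e1 + m%:C *: e1 - (phi e2 + m%:C *: e2) = (phi e1 - phi e2) + m%:C *: (e1 - e2) by
  vlin.
rewrite rnorm_sqD rdotZr rnormZr !exprMn gtr0_norm //.
have h1 := cocoercive hphi e1 e2.
have h2 := cocoercive_lipschitz gamma0 hphi e1 e2.
have {}h2 : gamma * rnorm (phi e1 - phi e2) <= rnorm (e1 - e2).
  by rewrite -ler_pdivlMl.
have h3 : (gamma * rnorm (phi e1 - phi e2)) ^+ 2 <= rnorm (e1 - e2) ^+ 2.
  by rewrite ler_pXn2r ?nnegrE ?mulr_ge0 ?rnorm_ge0 // ltW.
move: h3; rewrite exprMn; set p := rnorm (phi e1 - phi e2) ^+ 2 in h1 *.
set e := rnorm (e1 - e2) ^+ 2; set d := rdot _ _ in h1 * => h3.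
have h1' : m * (gamma * p) <= m * d by rewrite ler_pM2l.
have h3' : m ^+ 2 * (gamma ^+ 2 * p) <= m ^+ 2 * e by rewrite ler_pM2l // exprn_gt0.
lra.
Qed.

End Resolvent.

Section Existence.
Context {R : realType} {U X : hilbertType R} (S : systemNode U X U) (Sigma : wpls U X U).
Hypothesis pS : impedance_passive S.
Hypothesis hS : associated_wpls S Sigma.
Context (phi : U -> U) (gamma : R).
Hypothesis gamma0 : 0 < gamma.
Hypothesis hphi : forall u1 u2 : U,
  gamma * rnorm (phi u2 - phi u1) ^+ 2 <= complex.Re '[phi u2 - phi u1, u2 - u1].
Local Notation mu := (@lebesgue_measure R).
Local Notation st := (wpl_state Sigma).
Local Notation out := (wpl_output Sigma).

(** The feedback loop closed on [0, t]: w is the input of Sigma. *)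
Definition feedback_on t (x0 : X) (u w : R -> U) : Prop :=
  \forall s \ae mu, 0 <= s <= t -> w s = phi (u s - out x0 w s).

Lemma feedback_increment t (x1 x2 : X) (u1 u2 w1 w2 : R -> U) : 0 <= t ->
  L2loc u1 -> L2loc u2 -> L2loc w1 -> L2loc w2 ->
  feedback_on t x1 u1 w1 -> feedback_on t x2 u2 w2 ->
  increment_ineq gamma (st x1 w1) (st x2 w2) u1 u2 w1 w2 t.
Proof.
move=> t0 u1L u2L w1L w2L h1 h2; rewrite /increment_ineq !state0 //.
have mD : measurable (`[0, t] : set R) by exact: measurable_itv.
have on (f : R -> U) : L2loc f -> L2_on `[0, t] f by move=> fL; exact: L2loc_on.
have := passive_state pS hS (x2 - x1) (L2locB w2L w1L) t0; rewrite stateB //.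
have o1 := output_L2loc Sigma x1 w1L; have o2 := output_L2loc Sigma x2 w2L.
have sm (f : R -> U) : L2loc f -> smeas `[0, t] f by move=> fL; exact/L2_smeas/on.
have oE : \forall s \ae mu, `[0, t]%classic s ->
    out (x2 - x1) (fun s => w2 s - w1 s) s = out x2 w2 s - out x1 w1 s.
  have /ae_equalP := outputB Sigma x2 x1 w2L w1L; apply: ae_imply => s hs.
  by rewrite /= in_itv /= => /andP[s0 _]; exact: hs.
have wL := L2locB w2L w1L.
rewrite (L2dot_ae mD (sm _ (output_L2loc _ _ wL)) (sm _ wL) (sm _ (L2locB o2 o1)) (sm _ wL) oE
  (ae_of_all _)) //.
have cl x0 (u w : R -> U) : feedback_on t x0 u w ->
    \forall s \ae mu, `[0, t]%classic s -> w s = phi (u s - out x0 w s).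
  by apply: ae_imply => s h; rewrite /= in_itv /= => /h.
have := feedback_supply_L2 gamma0 hphi mD (itv_measure_fin 0 t) (on _ u1L) (on _ u2L) (on _ o1)
  (on _ o2)
  (on _ w1L) (on _ w2L) (cl _ _ _ h1) (cl _ _ _ h2).
lra.
Qed.

Lemma feedback_unique t (x0 : X) (u w1 w2 : R -> U) : 0 <= t ->
  L2loc u -> L2loc w1 -> L2loc w2 -> feedback_on t x0 u w1 -> feedback_on t x0 u w2 ->
  \forall s \ae mu, 0 <= s <= t -> w1 s = w2 s.
Proof.
move=> t0 uL w1L w2L h1 h2.
have := feedback_increment t0 uL uL w1L w2L h1 h2.
rewrite /increment_ineq !state0 // subrr rnorm0 [sqint _ (fun s => u s - u s)]sqint_eq0; last first.
  by move=> s _; rewrite subrr.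
rewrite expr0n mulr0 addr0 => h.
have mD : measurable (`[0, t] : set R) by exact: measurable_itv.
have E : \forall s \ae mu, `[0, t]%classic s -> w2 s = w1 s.
  apply: sqint0_ae; [exact: mD|exact: L2loc_on|exact: L2loc_on|].
  apply/eqP; rewrite eq_le sqint_ge0 andbT -(ler_pM2l gamma0) mulr0.
  by apply: le_trans h; rewrite lerDr sqr_ge0.
by apply: ae_imply E => s hs st; rewrite hs //= in_itv.
Qed.

(** Let k g = phi e, where phi e + m e = g.  Then w = phi (u - y) is equivalent
    to w = k (w + m (u - y)).  The function k is Lipschitz with constant
    1 / (1 + m gamma), while the squared norm of the increment of w - m y is at
    most 1 + m^2 M times that of w: the mixed term has a sign by passivity, and
    M bounds the input-output map.  For m = gamma / (M + 1) one has
    m^2 M <= m gamma, so that the composition contracts on all of [0, T]. *)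
Lemma feedback_exists_on T (x0 : X) (u : R -> U) : 0 < T -> L2loc u ->
  exists2 w, L2loc w & feedback_on T x0 u w.
Proof.
move=> T0 uL; have [M M0 hM] := output_bound Sigma (ltW T0).
pose m := gamma / (M + 1); have M1 : 0 < M + 1 by lra.
have m0 : 0 < m by exact: divr_gt0.
have mg : 0 < m * gamma by exact: mulr_gt0.
have /choice[k hk] : forall g, exists kg, exists2 e, phi e + m%:C *: e = g & kg = phi e.
  by move=> g; have [e he] := phi_resolvent gamma0 hphi g m0; exists (phi e), e.
have kL v w : rnorm (k v - k w) <= (1 + m * gamma)^-1 * rnorm (v - w).
  have [e <- ->] := hk v; have [e' <- ->] := hk w.
  rewrite mulrC ler_pdivlMr; last by lra.
  by rewrite mulrC; exact: phi_resolvent_lipschitz.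
set D : set R := `[0, T]%classic.
have mD : measurable D by exact: measurable_itv.
have on (f : R -> U) : L2loc f -> L2_on D f by move=> fL; exact: L2loc_on.
have L2loc_trunc (f : R -> U) : L2_on D f -> L2loc (trunc T f).
  by move=> fL tau tau0; have [_ h] := L2_trunc fL; apply: L2_sub h.
pose gw (w : R -> U) t := w t + m%:C *: (u t - out x0 w t).
have gL w : L2loc w -> L2_on D (gw w).
  move=> wL; apply: L2D => //; first exact: on.
  by apply: L2Z => //; apply: L2B => //; [exact: on|exact/on/output_L2loc].
pose G w := trunc T (fun t => k (gw w t)).
have q0 : 0 <= (1 + m * gamma)^-1 by rewrite invr_ge0; lra.
have kgL w : L2loc w -> L2_on D (fun t => k (gw w t)).
  by move=> wL; apply: (L2_lipschitz mD (itv_measure_fin 0 T) q0 kL); exact: gL.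
have [||||||w wL hw] := @L2_contraction_fixpoint R U D G (@L2loc R U) (1 + m * gamma)^-1 mD.
- by rewrite q0 /= invf_lt1; lra.
- by move=> tau tau0; apply: L2_cst; [exact: measurable_itv|exact: itv_measure_fin].
- by move=> w wL; exact/L2loc_trunc/kgL.
- by move=> f fL; exact: on.
- move=> f fL; exists (trunc T f); first exact: L2loc_trunc.
  by apply: ae_of_all => t; rewrite /D /= in_itv /= => tT; rewrite trunc_in.
- move=> f g fL gL'.
  have -> : sqint D (fun t => G f t - G g t) = sqint D (fun t => k (gw f t) - k (gw g t)).
    by apply: sqint_eq => t; rewrite inE /D /= in_itv /= => tT; rewrite /G !trunc_in.
  apply: le_trans (sqint_le (c := (1 + m * gamma)^-1 ^+ 2) mD (L2B mD (kgL _ fL) (kgL _ gL'))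
    (L2B mD (gL _ fL) (gL _ gL')) _) _.
    by move=> t _; rewrite -exprMn ler_pXn2r ?nnegrE ?mulr_ge0 ?rnorm_ge0.
  have dL := L2locB fL gL'.
  have oL := output_L2loc Sigma (x0 - x0) dL.
  have -> : sqint D (fun t => gw f t - gw g t) =
      sqint D (fun t => (f t - g t) - m%:C *: out (x0 - x0) (fun t => f t - g t) t).
    apply: sqint_ae => //.
    - by apply: L2_smeas; apply: L2B => //; exact: gL.
    - apply: L2_smeas; apply: L2B => //; first exact: on.
      by apply: L2Z => //; exact: on.
    have /ae_equalP := outputB Sigma x0 x0 fL gL'; apply: ae_imply => t ht.
    by rewrite /D /= in_itv /= => /andP[t0 _]; rewrite ht // /gw; vlin.
  rewrite sqintB //; [|exact: on|by apply: L2Z => //; exact: on].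
  rewrite L2dotZr //; [|exact: on|exact: on].
  rewrite sqintZ //; last exact: on.
  have := passive_state pS hS (x0 - x0) dL (ltW T0); rewrite L2dotC.
  have := hM (x0 - x0) _ dL; rewrite subrr rnorm0 expr0n /= !add0r.
  set b := sqint _ _; set a := sqint _ _; set i := L2dot _ _ _ => hb hi.
  have i0 : 0 <= i by have := le_trans (sqr_ge0 _) hi; lra.
  have a0 : 0 <= a by exact: sqint_ge0.
  have mM : m * M <= gamma.
    by rewrite /m mulrAC ler_pdivrMr // ler_pM2l //; lra.
  have le1 : a - 2 * (m * i) + m ^+ 2 * b <= (1 + m * gamma) * a.
    have : m ^+ 2 * b <= m ^+ 2 * (M * a) by rewrite ler_pM2l // exprn_gt0.
    have : m * (m * M) * a <= m * gamma * a by rewrite ler_wpM2r // ler_pM2l.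
    have : 0 <= m * i by rewrite mulr_ge0 // ltW.
    rewrite expr2; lra.
  rewrite -[X in _ <= X * _]mulr1 -[X in _ <= _ * X * _](@mulVf _ (1 + m * gamma));
    last by rewrite gt_eqF //; lra.
  apply: le_trans (ler_wpM2l (exprn_ge0 2 q0) le1) _.
  by rewrite expr2 !mulrA.
exists w => //; apply: ae_imply hw => t ht tT.
have [e he kE] := hk (gw w t).
have we : w t = phi e by rewrite ht ?/G ?trunc_in // /D /= in_itv.
have mC : m%:C != 0 :> R[i].
  by apply/eqP => /(congr1 (@complex.Re R)) /= m00; move: m0; rewrite m00 ltxx.
move: he; rewrite /gw [in X in _ = X + _]we => /addrI /(scalerI mC) <-.
exact: we.
Qed.

(** Solutions on [0, T] for different T agree by uniqueness, so they can be
    glued. *)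
Lemma feedback_exists (x0 : X) (u : R -> U) : L2loc u ->
  exists2 w, L2loc w & forall t, 0 <= t -> feedback_on t x0 u w.
Proof.
move=> uL.
(* The margin 1 makes the interval nondegenerate also for T = 0. *)
have /choice[W hW] : forall T : R, exists w, 0 <= T -> L2loc w /\ feedback_on (T + 1) x0 u w.
  move=> T; have [T0|T0] := leP 0 T; last by exists (fun=> 0).
  have T1 : 0 < T + 1 by lra.
  by have [w wL hw] := feedback_exists_on x0 T1 uL; exists w.
have fb_sub T t w : t <= T -> feedback_on T x0 u w -> feedback_on t x0 u w.
  by move=> tT; apply: ae_imply => s hs /andP[s0 st]; apply: hs; rewrite s0 (le_trans st).
have [t t0|t t' t0 tt'|t t0|w [wL hw]] := @glue_truncations R U (fun t => trunc t (W t)).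
- by apply: L2_of_trunc; apply: L2loc_on => //; case: (hW t t0).
- have [w1 h1] := hW t t0; have [w2 h2] := hW t' (le_trans t0 tt').
  have := feedback_unique t0 uL w1 w2 (fb_sub _ _ _ _ h1) (fb_sub _ _ _ _ h2).
  have e1 : t <= t + 1 by lra.
  have e2 : t <= t' + 1 by lra.
  move=> /(_ e1 e2); apply: ae_imply => s hs /andP[s0 /ltW st].
  by rewrite !trunc_in ?hs ?s0 //= (le_trans st).
- by apply: ae_of_all => s ts; rewrite trunc_out // negb_and -!ltNge ts orbT.
exists w => // t t0; have [w2 h2] := hW t t0.
have e : \forall s \ae mu, 0 <= s <= t -> w s = W t s.
  have /ae_equalP := hw t t0; apply: ae_imply => s hs st; have /andP[s0 _] := st.
  by have := hs s0; rewrite !trunc_in.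
have eo := output_ext Sigma x0 t0 wL w2 e.
have h2' : feedback_on t x0 u (W t) by apply: fb_sub h2; lra.
apply: ae_imply2 (ae_and e eo) h2' => s [h3 h4] h5 st; rewrite h3 // h4 //; exact: h5.
Qed.

End Existence.

(** * Classical solutions for compatible data *)

Section CompatibleData.
Context {R : realType} {U X : hilbertType R} (S : systemNode U X U) (Sigma : wpls U X U).
Hypothesis pS : impedance_passive S.
Hypothesis hS : associated_wpls S Sigma.
Context (phi : U -> U) (gamma : R).
Hypothesis gamma0 : 0 < gamma.
Hypothesis hphi : forall u1 u2 : U,
  gamma * rnorm (phi u2 - phi u1) ^+ 2 <= complex.Re '[phi u2 - phi u1, u2 - u1].
Local Notation mu := (@lebesgue_measure R).
Local Notation st := (wpl_state Sigma).
Local Notation out := (wpl_output Sigma).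
Local Notation feedback_on := (feedback_on Sigma phi).

Lemma D_comp_domP (x0 : X) (u0 : U) : D_comp S phi (x0, u0) <->
  exists v, sn_dom S (x0, phi (u0 - v)) /\ v = (sn_op S (x0, phi (u0 - v))).2.
Proof.
by split=> -[v [h1 h2]]; exists v; split=> //; apply/sn_domE.
Qed.

Lemma cont_on_sub (V : hilbertType R) T T' (x : R -> V) : T' <= T -> cont_on T x -> cont_on T' x.
Proof.
move=> TT cx t /andP[t0 tT] e e0; have [|d d0 hd] := cx t _ e e0; first by rewrite t0 (le_trans tT).
by exists d => // s /andP[s0 sT]; apply: hd; rewrite s0 (le_trans sT).
Qed.

Lemma H1loc_of_ae (V : hilbertType R) (w : R -> V) :
  (forall T, 0 < T -> exists2 W, H1_on T W & \forall t \ae mu, `[0, T]%classic t -> w t = W t) ->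
  exists2 W, H1loc W & ae_equal w W.
Proof.
move=> h.
have /choice[W hW] : forall T : R, exists W, 0 < T -> H1_on T W /\
    \forall t \ae mu, 0 <= t <= T -> w t = W t.
  move=> T; have [T0|T0] := ltP 0 T; last by exists (fun=> 0).
  have [W HW wW] := h T T0; exists W => _; split=> //.
have eq T t : 0 <= t <= T -> 0 < T -> W (t + 1) t = W T t.
  move=> /andP[t0 tT] T0; have t1 : 0 < t + 1 by lra.
  have m0 : 0 < Num.min (t + 1) T by rewrite lt_min t1.
  have [H1 e1] := hW _ T0; have [H2 e2] := hW _ t1.
  have m1 : Num.min (t + 1) T <= T by rewrite ge_min lexx orbT.
  have m2 : Num.min (t + 1) T <= t + 1 by rewrite ge_min lexx.
  apply: (cont_on_eq m0 (cont_on_sub m2 (H1_cont_on H2)) (cont_on_sub m1 (H1_cont_on H1))).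
    apply: ae_imply2 e1 e2 => s h1 h2; rewrite /= in_itv /= => /andP[s0 sm].
    by rewrite -h1 ?h2 ?s0 //=; [exact: le_trans m2|exact: le_trans m1].
  by rewrite t0 le_min tT andbT; lra.
exists (fun t => W (t + 1) t) => [T T0|].
  have [H1 _] := hW _ T0; apply: (H1_on_eq _ (ltW T0) H1) => t tT; apply/esym/eq => //.
apply: ae_equal_nat => n; have n1 : 0 < n%:R + 1 :> R by rewrite ltr_wpDl ?ler0n.
have [_ e] := hW _ n1; apply: ae_imply e => t ht /andP[t0 tn].
have tn1 : 0 <= t <= n%:R + 1 by rewrite t0 /= (le_trans tn) // lerDl.
by rewrite ht // (eq (n%:R + 1)).
Qed.

Lemma feedback_shift (x0 : X) (u w : R -> U) h : 0 <= h -> L2loc w ->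
  (forall t, 0 <= t -> feedback_on t x0 u w) ->
  forall t, 0 <= t -> feedback_on t (st x0 w h) (fun s => u (s + h)) (fun s => w (s + h)).
Proof.
move=> h0 wL hw t t0; have th0 : 0 <= t + h by exact: addr_ge0.
have /ae_equalP o := output_shift Sigma x0 h0 wL.
have e := ae_shift h (hw _ th0).
apply: ae_imply2 o e => s e1 e2 /andP[s0 st]; rewrite -e1 // e2 //.
by rewrite addr_ge0 //= lerD2r.
Qed.

Lemma ae_continuous_eq (V : hilbertType R) (f g : R -> V) : continuous_halfline f ->
  continuous_halfline g -> ae_equal f g -> forall t, 0 <= t -> f t = g t.
Proof.
move=> cf cg /ae_equalP e t t0; have t1 : 0 < t + 1 by lra.
apply: (cont_on_eq t1 (halfline_cont_on cf) (halfline_cont_on cg)).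
  by apply: ae_imply e => s h; rewrite /= in_itv /= => /andP[s0 _]; exact: h.
by rewrite t0; lra.
Qed.

(** With constant input w0 the node has a classical solution, whose output yt
    starts at v.  It solves the feedback equation for the external input
    u 0 - v + yt, which starts at u 0 and is H^1, hence differs from u by
    O(sqrt h) on [0, h].  The incremental estimate turns this into O(h^2) bounds
    for the squared differences, and the classical solution itself moves by
    O(h). *)
Lemma compatible_start (x0 : X) (u w : R -> U) (v : U) : H1loc u -> L2loc w ->
  (forall t, 0 <= t -> feedback_on t x0 u w) ->
  let w0 := phi (u 0 - v) in sn_dom S (x0, w0) -> v = (sn_op S (x0, w0)).2 ->
  exists C, exists2 d : R, 0 < d & forall h, 0 <= h -> h < d ->
    rnorm (st x0 w h - x0) ^+ 2 <= C * h ^+ 2 /\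
    sqint `[0, h] (fun s => w s - w0) <= C * h ^+ 2.
Proof.
move=> uH wL hw w0 dom vE.
have cH : H1loc (fun _ : R => w0) by apply: lipschitz_H1loc; exists 0 => // s t;
  rewrite subrr rnorm0 mul0r.
have cL := H1loc_L2loc cH.
have [yt [yE cx yH sol]] := hS cH dom; have uL := H1loc_L2loc uH.
have y0 : yt 0 = v.
  by have [_ _ ->] := sol 0 (lexx 0); rewrite -/(st x0 (fun=> w0) 0) state0 // -vE.
pose ut s := yt s + (u 0 - v).
have utL : L2loc ut.
  apply: L2locD; first exact: H1loc_L2loc.
  by move=> tau _; apply: L2_cst; [exact: measurable_itv|exact: itv_measure_fin].
have fb t : 0 <= t -> feedback_on t x0 ut (fun=> w0).
  move=> t0; have /ae_equalP := yE; apply: ae_imply => s hs /andP[s0 _].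
  have -> : out x0 (fun=> w0) s = yt s by rewrite hs.
  rewrite /ut /w0; congr phi; vlin.
have [C1 C10 hC1] := H1_holder (uH 1 ltr01); have [C2 C20 hC2] := H1_holder (yH 1 ltr01).
have [dx [_ hdx]] := cx; have /has_derivP/(_ 1 ltr01)[d d0 hd] := hdx 0 (lexx 0).
pose G := gamma^-1 * (2 * (C1 + C2)); pose L := rnorm (dx 0) + 1.
have g0 : 0 < gamma^-1 by rewrite invr_gt0.
have G0 : 0 <= G by rewrite /G mulr_ge0 ?(ltW g0) //; lra.
have L0 : 0 <= L by rewrite /L addr_ge0 ?rnorm_ge0.
exists (2 * G + 2 * L ^+ 2 + gamma^-1 * G), (Num.min d 1); first by rewrite lt_min d0 ltr01.
move=> h h0; rewrite lt_min => /andP[hd' h1].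
have := feedback_increment pS hS gamma0 hphi h0 utL uL cL wL (fb h h0) (hw h h0).
rewrite /increment_ineq !state0 // subrr rnorm0 expr0n add0r.
have uu s : 0 <= s <= h -> rnorm (u s - ut s) ^+ 2 <= 2 * (C1 + C2) * h.
  move=> /andP[s0 sh]; have s1 : s <= 1 by rewrite (le_trans sh) // ltW.
  have -> : u s - ut s = (u s - u 0) - (yt s - yt 0) by rewrite /ut y0; vlin.
  have := hC1 0 s (lexx 0) s0 s1; have := hC2 0 s (lexx 0) s0 s1; rewrite !subr0 => a b.
  rewrite rnorm_sqB; have := @rdot_young _ _ 1 (u s - u 0) (- (yt s - yt 0)) ltr01.
  rewrite invr1 !mul1r rdotNr rnormN.
  have : s * C1 <= h * C1 by rewrite ler_wpM2r.
  have : s * C2 <= h * C2 by rewrite ler_wpM2r.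
  lra.
have uuL : L2_on `[0, h] (fun s => u s - ut s) by apply: L2loc_on => //; exact: L2locB.
have QU := sqint_bound h0 uuL uu.
have QU' : gamma^-1 * sqint `[0, h] (fun s => u s - ut s) <= G * h ^+ 2.
  by rewrite /G -mulrA ler_pM2l //; apply: le_trans QU _; rewrite expr2 !mulrA.
have Qw0 := sqint_ge0 `[0, h]%classic (fun s => w s - w0).
move=> inc; split.
  have e1 : rnorm (st x0 w h - st x0 (fun=> w0) h) ^+ 2 <= G * h ^+ 2.
    have := mulr_ge0 (ltW gamma0) Qw0; lra.
  have e2 : rnorm (st x0 (fun=> w0) h - x0) ^+ 2 <= L ^+ 2 * h ^+ 2.
    have [->|hn] := eqVneq h 0.
      by rewrite state0 // subrr rnorm0 expr0n mulr_ge0 ?sqr_ge0.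
    have hp : 0 < h by rewrite lt_def hn.
    rewrite -exprMn ler_pXn2r ?nnegrE ?mulr_ge0 ?rnorm_ge0 //.
    have := hd h hn; rewrite ger0_norm // add0r => /(_ hd' h0).
    rewrite -/(st x0 (fun=> w0) h) -/(st x0 (fun=> w0) 0) state0 // => hd2.
    have -> : st x0 (fun=> w0) h - x0 =
      h%:C *: ((h^-1)%:C *: (st x0 (fun=> w0) h - x0) - dx 0 + dx 0).
      by rewrite subrK scalerA -rmorphM divff // scale1r.
    rewrite rnormZr ger0_norm // mulrC ler_wpM2r //; apply: le_trans (rnormD_le _ _) _.
    by rewrite /L addrC lerD2l ltW.
  have -> : st x0 w h - x0 = (st x0 w h - st x0 (fun=> w0) h) + (st x0 (fun=> w0) h - x0) by vlin.
  rewrite rnorm_sqD; have := @rdot_young _ _ 1 (st x0 w h - st x0 (fun=> w0) h)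
     (st x0 (fun=> w0) h - x0) ltr01; rewrite invr1 !mul1r.
  have : 0 <= gamma^-1 * G * h ^+ 2 by rewrite mulr_ge0 ?sqr_ge0 // mulr_ge0 // ltW.
  lra.
have e3 : sqint `[0, h] (fun s => w s - w0) <= gamma^-1 * (G * h ^+ 2).
  rewrite -(ler_pM2l gamma0) mulVKf ?gt_eqF //.
  have := sqr_ge0 (rnorm (st x0 w h - st x0 (fun=> w0) h)); lra.
have : 0 <= G * h ^+ 2 by rewrite mulr_ge0 ?sqr_ge0.
have : 0 <= L ^+ 2 * h ^+ 2 by rewrite mulr_ge0 ?sqr_ge0.
lra.
Qed.

(** Otherwise the integral would be at least of order h. *)
Lemma initial_value (V : hilbertType R) (W : R -> V) (a : V) (C d : R) : 0 < d ->
  continuous_halfline W ->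
  (forall h, 0 <= h -> h < d -> sqint `[0, h] (fun s => W s - a) <= C * h ^+ 2) -> W 0 = a.
Proof.
move=> d0 cW hC; apply: sqdist_eq => e e0.
have C1 : 0 < `|C| + 1 by rewrite ltr_wpDl.
have e1 : 0 < Num.sqrt (e / 4) by rewrite sqrtr_gt0 divr_gt0.
have /continuous_halflineP/(_ 0 (lexx 0) _ e1)[r r0 hr] := cW.
pose m := Num.min (Num.min d r) (e / 4 / (`|C| + 1)); pose h := m / 2.
have m0 : 0 < m by rewrite !lt_min d0 r0 !divr_gt0.
have h0 : 0 < h by rewrite divr_gt0.
have hm : h < m by rewrite /h; lra.
move: hm; rewrite /m !lt_min ltr_pdivlMr // => /andP[/andP[hd hr'] hC'].
have WL := halfline_L2loc cW.
have mD : measurable (`[0, h] : set R) by exact: measurable_itv.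
have aL := L2_cst a mD (itv_measure_fin 0 h); have bL := L2_cst (W 0) mD (itv_measure_fin 0 h).
have wL : L2_on `[0, h] W by exact: WL.
have := sqintD_le mD (L2B mD bL wL) (L2B mD wL aL).
rewrite (_ : (fun t => _ + _) = fun=> W 0 - a); last by apply/funext => t; vlin.
have -> : sqint `[0, h] (fun=> W 0 - a) = rnorm (W 0 - a) ^+ 2 * h.
  by rewrite /sqint Rintegral_itv_cst ?subr0 // ltW.
have := hC h (ltW h0) hd.
have : sqint `[0, h] (fun t => W 0 - W t) <= e / 4 * h.
  apply: sqint_bound (ltW h0) (L2B mD bL wL) _ => s /andP[s0 sh].
  rewrite rnormB -[e / 4]sqr_sqrtr ?divr_ge0 ?(ltW e0) // ler_pXn2r ?nnegrE ?rnorm_ge0 ?sqrtr_ge0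
    //.
  by apply/ltW/hr => //; rewrite subr0 ger0_norm //; exact: le_lt_trans hr'.
move=> a1 a2 a3; rewrite -(ler_pM2r h0).
have : C * h ^+ 2 <= e / 4 * h.
  rewrite expr2 mulrA ler_pM2r //; apply: le_trans (ltW hC').
  rewrite mulrC ler_pM2l //; apply: le_trans (ler_norm C) _; lra.
lra.
Qed.

(** The incremental estimate is applied to the solution and its translate by h:
    the initial states differ by O(h) according to [compatible_start], and the
    inputs differ by O(h) in L^2 because u is H^1.  So w satisfies the
    translation criterion. *)
Lemma feedback_regular (x0 : X) (u : R -> U) : H1loc u -> D_comp S phi (x0, u 0) ->
  exists W y, [/\ H1loc W, H1loc y, forall t, 0 <= t -> W t = phi (u t - y t),
    ae_equal y (out x0 W) & classical_solution S phi (st x0 W) u y].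
Proof.
move=> uH /D_comp_domP[v [dom vE]]; have uL := H1loc_L2loc uH.
have [w wL hw] := feedback_exists pS hS gamma0 hphi x0 uL.
have [C [d d0 hC]] := compatible_start uH wL hw dom vE.
have [W WH wW] : exists2 W, H1loc W & ae_equal w W.
  apply: H1loc_of_ae => T T0; have [C' hC'] := H1_translation T0 uH.
  apply: (@H1_of_translation _ _ w T (Num.min d 1) (gamma^-1 * (C + gamma^-1 * C')) T0) => //.
    by rewrite lt_min d0 ltr01.
  move=> h /andP[h0]; rewrite lt_min => /andP[hd h1].
  have h0' := ltW h0; have [e1 _] := hC h h0' hd.
  have h01 : 0 < h < 1 by rewrite h0.
  have e2 := hC' h h01.
  have := feedback_increment pS hS gamma0 hphi (ltW T0) uL (L2loc_shift h0' uL) wL (L2loc_shift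
    h0' wL)
    (hw T (ltW T0)) (feedback_shift h0' wL hw (ltW T0)).
  rewrite /increment_ineq !state0 //; last exact: L2loc_shift.
  have g0 : 0 < gamma^-1 by rewrite invr_gt0.
  move=> inc; rewrite -(ler_pM2l gamma0) -mulrA mulVKf ?gt_eqF //.
  have : gamma^-1 * sqint `[0, T] (fun t => u (t + h) - u t) <= gamma^-1 * (C' * h ^+ 2) by
    rewrite ler_pM2l.
  have := sqr_ge0 (rnorm (st (st x0 w h) (fun s => w (s + h)) T - st x0 w T)); lra.
have WL := H1loc_L2loc WH; have cW := H1loc_continuous WH.
have wWt t : \forall s \ae mu, 0 <= s <= t -> w s = W s.
  by have /ae_equalP := wW; apply: ae_imply => s hs /andP[s0 _]; exact: hs.
have W0 : W 0 = phi (u 0 - v).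
  apply: (initial_value d0 cW (C := C)) => h h0 hd; have [_] := hC h h0 hd.
  have mD : measurable (`[0, h] : set R) by exact: measurable_itv.
  have cL := L2_cst (phi (u 0 - v)) mD (itv_measure_fin 0 h).
  rewrite (sqint_ae (f := fun s => w s - _) (g := fun s => W s - phi (u 0 - v)) mD) //.
  - by apply: L2_smeas; apply: L2B => //; exact: L2loc_on.
  - by apply: L2_smeas; apply: L2B => //; exact: L2loc_on.
  by apply: ae_imply (wWt h) => s hs; rewrite /= in_itv /= => /hs ->.
rewrite -W0 in dom.
have [y [yE cx yH sol]] := hS WH dom.
have cu := H1loc_continuous uH; have cy := H1loc_continuous yH.
have We t : 0 <= t -> W t = phi (u t - y t).
  have cG : continuous_halfline (fun t => phi (u t - y t)).
    apply: (continuous_halfline_lip (L := gamma^-1)); first by rewrite invr_ge0 ltW.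
      by move=> *; exact: (cocoercive_lipschitz gamma0 hphi).
    exact: continuous_halflineB.
  move: t; apply: (ae_continuous_eq cW cG).
  apply: ae_equal_nat => n; have n0 : 0 <= n%:R :> R by exact: ler0n.
  have := output_ext Sigma x0 n0 wL WL (wWt n%:R) => e1.
  have /ae_equalP e2 := yE.
  apply: ae_imply2 (ae_and e1 e2) (ae_and (wWt n%:R) (hw _ n0)) => s [h1 h2] [h3 h4] sn;
    have /andP[s0 _] := sn.
  by rewrite -h3 // h4 // h1 // -/(out x0 W s) h2.
exists W, y; split=> //; split=> // t t0.
by have := sol t t0; rewrite -We.
Qed.

End CompatibleData.

(** * Approximation by compatible data *)

Section Main.
Context {R : realType} {U X : hilbertType R} (S : systemNode U X U) (Sigma : wpls U X U).
Hypothesis pS : impedance_passive S.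
Hypothesis hS : associated_wpls S Sigma.
Context (phi : U -> U) (gamma : R).
Hypothesis gamma0 : 0 < gamma.
Hypothesis hphi : forall u1 u2 : U,
  gamma * rnorm (phi u2 - phi u1) ^+ 2 <= complex.Re '[phi u2 - phi u1, u2 - u1].
Local Notation st := (wpl_state Sigma).
Local Notation out := (wpl_output Sigma).
Local Notation feedback_on := (feedback_on Sigma phi).

(** The ramp t w0 starts from the admissible pair (0, 0) and has the value w0 at
    time 1. *)
Lemma node_point (w0 : U) : exists x, sn_dom S (x, w0).
Proof.
pose u (t : R) := t%:C *: w0.
have uH : H1loc u.
  apply: lipschitz_H1loc; exists (rnorm w0); first exact: rnorm_ge0.
  by move=> s t; rewrite /u -scalerBl -rmorphB rnormZr mulrC.
have u0 : u 0 = 0 by rewrite /u scale0r.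
have dom : sn_dom S (0, u 0) by rewrite u0; exact: sn_dom0.
have [y [_ _ _ sol]] := hS uH dom; have [d _ _] := sol 1 ler01.
by move: d; rewrite {2}/u scale1r => d; eexists; exact: d.
Qed.

(** Only compatible data with u 0 = y 0, that is, with initial internal input
    phi 0, are used: the states x with
    (x, phi 0) in the domain of the node form a translate of the domain of the
    generator, and u 0 has to be the corresponding output, which can be
    prescribed freely. *)
Lemma compatible_dense (x0 : X) (u : R -> U) (T e : R) : 0 < T -> 0 < e -> L2loc u ->
  exists x' u', [/\ H1loc u', D_comp S phi (x', u' 0), rnorm (x' - x0) <= e
    & sqint `[0, T] (fun t => u' t - u t) <= e].
Proof.
move=> T0 e0 uL; have [xp dp] := node_point (phi 0).
have [v dv vx] := sn_domA_dense S (x0 - xp) e0.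
have [dom _] := sn_linear 1 dp dv.
have domE : sn_dom S (xp + v, phi 0).
  suff -> : (xp + v, phi 0) = 1 *: (xp, phi 0) + (v, 0) :> X * U by [].
  by rewrite scale1r; congr pair; rewrite addr0.
pose y0 := (sn_op S (xp + v, phi 0)).2.
have [u' [lu u0 uu]] := lipschitz_dense y0 T0 e0 (uL T T0).
exists (xp + v), u'; split=> //; first exact: lipschitz_H1loc.
- by apply/D_comp_domP; exists y0; rewrite u0 subrr.
- by rewrite (_ : xp + v - x0 = v - (x0 - xp)) //; vlin.
Qed.

Lemma classical_generalised (x : R -> X) (u y : R -> U) : classical_solution S phi x u y ->
  generalised_solution S phi x u y.
Proof.
move=> sol; have [[dx [cdx hdx]] cu cy _] := sol.
split; [exact: has_deriv_continuous hdx|exact: halfline_L2loc|exact: halfline_L2loc|].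
exists (fun=> x), (fun=> u), (fun=> y); split=> // tau tau0; split.
- by apply/uniformP => e e0; exists 0%N => n _ t _; rewrite subrr rnorm0.
- have mD : measurable (`[0, tau] : set R) by exact: measurable_itv.
  apply/L2norm_cvg0 => //; first by move=> n; apply: L2B => //; exact: halfline_L2loc.
  by rewrite sqint_eq0 => [|t _]; [exact: cvg_cst|rewrite subrr].
- have mD : measurable (`[0, tau] : set R) by exact: measurable_itv.
  apply/L2norm_cvg0 => //; first by move=> n; apply: L2B => //; exact: halfline_L2loc.
  by rewrite sqint_eq0 => [|t _]; [exact: cvg_cst|rewrite subrr].
Qed.

Lemma uniform_limit_continuous (V : hilbertType R) (xk : nat -> R -> V) (x : R -> V) :
  (forall k, continuous_halfline (xk k)) ->
  (forall tau : R, 0 < tau -> {uniform `[0, tau]%classic, xk @ \oo --> x}) ->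
  continuous_halfline x.
Proof.
move=> cx hx; apply/continuous_halflineP => t t0 e e0.
have t1 : 0 < t + 1 by lra.
have e3 : 0 < e / 3 by rewrite divr_gt0.
have /uniformP/(_ _ e3)[N /(_ N (leqnn _)) hN] := hx _ t1.
have /continuous_halflineP/(_ t t0 _ e3)[d d0 hd] := cx N.
exists (Num.min d 1); first by rewrite lt_min d0 ltr01.
move=> s s0; rewrite lt_min => /andP[sd s1].
have -> : x s - x t = (xk N t - x t) - (xk N s - x s) + (xk N s - xk N t) by vlin.
apply: le_lt_trans (rnormD_le _ _) _.
have := rnormB_le (xk N t - x t) (xk N s - x s); have := hd s s0 sd.
have ht : rnorm (xk N t - x t) < e / 3 by apply: hN; rewrite /= in_itv /= t0; lra.
have hs : rnorm (xk N s - x s) < e / 3.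
  by apply: hN; rewrite /= in_itv /= s0; move: s1; rewrite ltr_norml => /andP[_]; lra.
lra.
Qed.

(** The solution of the L^2 problem is the limit of the classical solutions for
    compatible data approximating x0 and u, with error 1/(k+1) on [0, k+1]. *)
Lemma generalised_exists (x0 : X) (u : R -> U) : L2loc u ->
  exists w, [/\ L2loc w, ae_equal w (fun t => phi (u t - out x0 w t))
    & generalised_solution S phi (st x0 w) u (out x0 w)].
Proof.
move=> uL; have [w wL hw] := feedback_exists pS hS gamma0 hphi x0 uL.
exists w; split=> //.
  by apply: ae_equal_nat => n; exact: hw.
have n0 (k : nat) : 0 < k.+1%:R^-1 :> R by rewrite invr_gt0 ltr0n.
have n1 (k : nat) : 0 < k.+1%:R :> R by rewrite ltr0n.
have /choice[xu hxu] : forall k : nat, exists xu : X * (R -> U),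
    [/\ H1loc xu.2, D_comp S phi (xu.1, xu.2 0), rnorm (xu.1 - x0) <= k.+1%:R^-1
    & sqint `[0, k.+1%:R] (fun t => xu.2 t - u t) <= k.+1%:R^-1].
  by move=> k; have [x' [u' h]] := compatible_dense x0 (n1 k) (n0 k) uL; exists (x', u').
have /choice[Wy hWy] : forall k : nat, exists Wy : (R -> U) * (R -> U),
    [/\ H1loc Wy.1, H1loc Wy.2, forall t, 0 <= t -> Wy.1 t = phi ((xu k).2 t - Wy.2 t),
    ae_equal Wy.2 (out (xu k).1 Wy.1) & classical_solution S phi (st (xu k).1 Wy.1) (xu k).2 Wy.2].
  move=> k; have [h1 h2 _ _] := hxu k.
  by have [W [y h]] := feedback_regular pS hS gamma0 hphi h1 h2; exists (W, y).
pose xk k := st (xu k).1 (Wy k).1; pose uk k := (xu k).2; pose yk k := (Wy k).2.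
have ukL k : L2loc (uk k) by case: (hxu k) => h _ _ _; exact: H1loc_L2loc.
have WL k : L2loc (Wy k).1 by case: (hWy k) => h _ _ _ _; exact: H1loc_L2loc.
have ykL k : L2loc (yk k) by case: (hWy k) => _ h _ _ _; exact: H1loc_L2loc.
have fb k t : 0 <= t -> feedback_on t (xu k).1 (uk k) (Wy k).1.
  move=> t0; have [_ _ h1 /ae_equalP h2 _] := hWy k; apply: ae_imply h2 => s h2 /andP[s0 _].
  by rewrite -h2 // h1.
have oL := output_L2loc Sigma x0 wL.
pose G := 1 + gamma^-1; have g0 : 0 < gamma^-1 by rewrite invr_gt0.
have G0 : 0 < G by rewrite /G; lra.
(* The k-th data are accurate on [0, k+1], which contains [0, tau] from some k on. *)
have data tau k : tau <= k.+1%:R ->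
    rnorm ((xu k).1 - x0) ^+ 2 + gamma^-1 * sqint `[0,
      tau] (fun t => uk k t - u t) <= G * k.+1%:R^-1.
  move=> tk; have [_ _ h1 h2] := hxu k.
  have h3 := sqr_le_inv_nat (rnorm_ge0 _) h1.
  have h4 : sqint `[0, tau] (fun t => uk k t - u t) <= k.+1%:R^-1.
    apply: le_trans h2; apply: sqint_sub; rewrite //; first exact: subset_itvcc.
    by apply: L2B; [exact: measurable_itv|exact: ukL|exact: uL].
  have : gamma^-1 * sqint `[0, tau] (fun t => uk k t - u t) <= gamma^-1 * k.+1%:R^-1 by rewrite
    ler_pM2l.
  by move: h3; rewrite /G; move: (k.+1%:R^-1 : R) => b; lra.
have inc tau k : 0 <= tau -> tau <= k.+1%:R ->
    rnorm (xk k tau - st x0 w tau) ^+ 2 + gamma * sqint `[0,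
      tau] (fun t => (Wy k).1 t - w t) <= G * k.+1%:R^-1.
  move=> t0 tk; apply: le_trans (data tau k tk).
  have := feedback_increment pS hS gamma0 hphi t0 uL (ukL k) wL (WL k) (hw tau t0) (fb k tau t0).
  by rewrite /increment_ineq !state0.
have big (r : R) : 0 <= r -> exists N, forall n, (N <= n)%N -> r <= n.+1%:R.
  move=> r0; exists (Num.truncn r).+1 => n Nn; have /andP[_ /ltW h] := truncn_itv r0.
  by apply: le_trans h _; rewrite ler_nat leqW.
have small (e : R) : 0 < e -> exists N, forall n, (N <= n)%N -> G * n.+1%:R^-1 < e.
  move=> e0; have [|N hN] := big (G / e + 1); first by rewrite addr_ge0 // ltW // divr_gt0.
  exists N => n /hN h; rewrite ltr_pdivrMr // mulrC -ltr_pdivrMr //; lra.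
have unif tau : 0 < tau -> {uniform `[0, tau]%classic, xk @ \oo --> st x0 w}.
  move=> tau0; apply/uniformP => e e0; have e20 : 0 < e ^+ 2 by rewrite exprn_gt0.
  have [N1 h1] := big tau (ltW tau0); have [N2 h2] := small _ e20.
  exists (maxn N1 N2) => n; rewrite geq_max => /andP[nN1 nN2] t /=;
    rewrite in_itv /= => /andP[t0 tt].
  rewrite -(@ltr_pXn2r _ 2) ?nnegrE ?rnorm_ge0 ?(ltW e0) //.
  apply: le_lt_trans (h2 n nN2); apply: le_trans (inc t n t0 (le_trans tt (h1 n nN1))).
  by rewrite lerDl mulr_ge0 ?sqint_ge0 // ltW.
split=> //.
  apply: (uniform_limit_continuous _ unif) => k; have [_ _ _ _ [[dx [_ hdx]] _ _ _]] := hWy k.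
  exact: has_deriv_continuous hdx.
exists xk, uk, yk; split=> [k|tau tau0]; first by case: (hWy k).
have mD : measurable (`[0, tau] : set R) by exact: measurable_itv.
have [N1 hN1] := big tau (ltW tau0).
split; first exact: unif.
- apply/L2norm_cvg0 => //; first by move=> n; apply: L2B => //; [exact: ukL|exact: uL].
  apply/cvgn_real0P => [n|e e0]; first exact: sqint_ge0.
  have [N2 hN2] := small _ (mulr_gt0 g0 e0).
  exists (maxn N1 N2) => n; rewrite geq_max => /andP[/hN1 nN1 /hN2 nN2].
  rewrite -(ltr_pM2l g0); apply: le_lt_trans nN2; apply: le_trans (data tau n nN1).
  by rewrite lerDr sqr_ge0.
apply/L2norm_cvg0 => //; first by move=> n; apply: L2B => //; [exact: ykL|exact: oL].
apply/cvgn_real0P => [n|e e0]; first exact: sqint_ge0.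
have [M M0 hM] := output_bound Sigma (ltW tau0).
pose K := M * (1 + gamma^-1) + 1; have K0 : 0 < K by rewrite /K ltr_wpDl // mulr_ge0 //; lra.
have [N2 hN2] := small _ (divr_gt0 e0 K0).
exists (maxn N1 N2) => n; rewrite geq_max => /andP[/hN1 nN1 /hN2 nN2].
have wL' := L2locB (WL n) wL.
have h1 := hM ((xu n).1 - x0) _ wL'.
have E : sqint `[0, tau] (fun t => yk n t - out x0 w t) =
    sqint `[0, tau] (out ((xu n).1 - x0) (fun s => (Wy n).1 s - w s)).
  apply: sqint_ae => //.
  - by apply: L2_smeas; apply: L2B => //; [exact: ykL|exact: oL].
  - by apply: L2_smeas; exact: output_L2loc.
  have [_ _ _ /ae_equalP h2 _] := hWy n.
  have /ae_equalP h3 := outputB Sigma (xu n).1 x0 (WL n) wL.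
  apply: ae_imply2 h2 h3 => s h2 h3; rewrite /= in_itv /= => /andP[s0 _].
  by rewrite h3 // /yk h2.
rewrite E; apply: le_lt_trans h1 _.
have h2 := inc tau n (ltW tau0) nN1; have h3 := data tau n nN1.
set q := sqint _ _ in h2 *; set r := rnorm _ ^+ 2 in h3 *; set b := G * _ in nN2 h2 h3.
have q0 : 0 <= q by exact: sqint_ge0.
have r0 : r <= b.
  apply: le_trans h3; rewrite lerDl mulr_ge0 ?sqint_ge0 //; exact: ltW.
have qb : q <= gamma^-1 * b.
  rewrite -(ler_pM2l gamma0) mulrA mulfV ?gt_eqF // mul1r; apply: le_trans h2.
  by rewrite lerDr sqr_ge0.
move: nN2; rewrite ltr_pdivlMr // => nN2; apply: le_lt_trans nN2.
have b0 : 0 <= b by apply: le_trans r0; exact: sqr_ge0.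
have : M * (r + q) <= M * (b + gamma^-1 * b) by rewrite ler_wpM2l // lerD.
rewrite /K; lra.
Qed.

End Main.

(** * Well-posedness of the feedback system *)

Theorem theorem3p3 (R : realType) (U X : hilbertType R)
  (S : systemNode U X U) (Sigma : wpls U X U)
  (hpassive : impedance_passive S)
  (hSigma : associated_wpls S Sigma)
  (lambda c : R) (hlambda : 0 < lambda) (hc : 0 < c)
  (hP : re_ge (sn_transfer S lambda%:C) c)
  (phi : U -> U) (gamma : R) (hgamma : 0 < gamma)
  (hphi : forall u1 u2 : U,
     gamma * rnorm (phi u2 - phi u1) ^+ 2
       <= complex.Re '[phi u2 - phi u1, u2 - u1]) :
  (forall (x0 : X) (u : R -> U), L2loc u ->
     exists (x : R -> X) (y : R -> U),
       let w := fun t => phi (u t - y t) in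
       [/\ generalised_solution S phi x u y,
           x 0 = x0,
           L2loc w
         & [/\ forall t, 0 <= t ->
                 x t = wT Sigma t x0 + wPhi Sigma t (trunc t w),
               ae_equal y (fun s => wPsi_inf Sigma x0 s + wF_inf Sigma w s)
             & H1loc u -> D_comp S phi (x0, u 0) ->
                 classical_solution S phi x u y /\ H1loc y]])
  /\
  (forall (x1 x2 : R -> X) (u1 u2 y1 y2 : R -> U),
     generalised_solution S phi x1 u1 y1 ->
     generalised_solution S phi x2 u2 y2 ->
     forall t : R, 0 <= t ->
       ((rnorm (x2 t - x1 t) ^+ 2)%:E
         + gamma%:E * \int[lebesgue_measure]_(s in `[0%R, t])
             (rnorm (phi (u2 s - y2 s) - phi (u1 s - y1 s)) ^+ 2)%:E
        <= (rnorm (x2 0%R - x1 0%R) ^+ 2)%:E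
         + (gamma^-1)%:E * \int[lebesgue_measure]_(s in `[0%R, t])
             (rnorm (u2 s - u1 s) ^+ 2)%:E)%E).
Proof.
split=> [x0 u uL|x1 x2 u1 u2 y1 y2 g1 g2 t t0]; last first.
  have := generalised_increment hpassive hgamma hphi g1 g2 t0; rewrite /increment_ineq.
  have [_ u1L y1L _] := g1; have [_ u2L y2L _] := g2.
  have mD : measurable (`[0, t] : set R) by exact: measurable_itv.
  have on (f : R -> U) : L2loc f -> L2_on `[0, t] f by move=> fL; exact: L2loc_on.
  have wL (v y : R -> U) : L2loc v -> L2loc y -> L2_on `[0, t] (fun s => phi (v s - y s)).
    by move=> vL yL; apply: (cocoercive_L2 hgamma hphi mD (itv_measure_fin 0 t)); exact/on/L2locB.
  rewrite (sqintE mD (L2B mD (wL _ _ u2L y2L) (wL _ _ u1L y1L))) (sqintE mD (L2B mD (on _ u2L)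
    (on _ u1L))).
  by rewrite -!EFinM -!EFinD lee_fin.
(* For compatible H^1 data y has to be the continuous representative of the
   output, hence the case distinction. *)
have [[uH dom]|ncomp] := pselect (H1loc u /\ D_comp S phi (x0, u 0)).
  have [W [y [WH yH We ye sol]]] := feedback_regular hpassive hSigma hgamma hphi uH dom.
  have WL := H1loc_L2loc WH.
  have wL : L2loc (fun t => phi (u t - y t)).
    move=> tau tau0; apply: L2_eq (WL tau tau0) => //.
    by move=> t; rewrite inE /= in_itv /= => /andP[t0 _]; exact: We.
  have eW t : \forall s \ae lebesgue_measure, 0 <= s <= t -> W s = phi (u s - y s).
    by apply: ae_of_all => s /andP[s0 _]; exact: We.
  exists (wpl_state Sigma x0 W), y; split=> //; first exact: classical_generalised.
    exact: state0.
  split=> [t t0||//].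
    exact: (state_ext Sigma x0 t0 WL wL (eW t)).
  apply: ae_equal_nat => n; have n0 : 0 <= n%:R :> R by exact: ler0n.
  have /ae_equalP h := ye.
  by apply: ae_imply2 h (output_ext Sigma x0 n0 WL wL (eW n%:R)) => s h1 h2 sn;
    have /andP[s0 _] := sn; rewrite h1 // h2.
have [w [wL /ae_equalP we sol]] := generalised_exists hpassive hSigma hgamma hphi x0 uL.
have yL := output_L2loc Sigma x0 wL.
have wL' : L2loc (fun t => phi (u t - wpl_output Sigma x0 w t)).
  move=> tau tau0; apply: (cocoercive_L2 hgamma hphi _ (itv_measure_fin 0 tau)) => //.
  exact: (L2locB uL yL tau0).
have ew t : \forall s \ae lebesgue_measure, 0 <= s <= t ->
  w s = phi (u s - wpl_output Sigma x0 w s).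
  by apply: ae_imply we => s hs /andP[s0 _]; exact: hs.
exists (wpl_state Sigma x0 w), (wpl_output Sigma x0 w); split=> //; first exact: state0.
split=> [t t0||uH dom].
- exact: (state_ext Sigma x0 t0 wL wL' (ew t)).
- by apply: ae_equal_nat => n; exact: (output_ext Sigma x0 (ler0n _ n) wL wL' (ew n%:R)).
by case: ncomp.
Qed.
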